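(* Let $G$ be a directed graph with finitely many vertices, and let $\tilde G$ be its associated subgraph (defined in the context). Then $C^*(G)$ is matricially semiprojective if and only if $\tilde G$ is finite.
   Context: A directed graph $G=(G^0,G^1,s,r)$ consists of countable sets $G^0$ (vertices) and $G^1$ (edges) and maps $s,r:G^1\to G^0$ (source and range); a graph is finite if it has finitely many vertices and finitely many edges. The graph C*-algebra $C^*(G)$ is the universal C*-algebra generated by mutually orthogonal projections $p_v$ ($v\in G^0$) and partial isometries $s_e$ ($e\in G^1$) with mutually orthogonal ranges, subject to: (1) $s_e^*s_e=p_{s(e)}$ for each $e\in G^1$; (2) $p_v=\sum_{e\in r^{-1}(v)}s_es_e^*$ for each $v\in G^0$ with $0<\sharp(r^{-1}(v))<\infty$; (3) $s_es_e^*\le p_{r(e)}$ for each $e\in G^1$. A path is a sequence of edges $\nu=(\nu_n,\dots,\nu_1)$ with $s(\nu_{i+1})=r(\nu_i)$; write $s(\nu)=s(\nu_1)$. A cycle is a path $(\mu_n,\dots,\mu_1)$ with $s(\mu_1)=r(\mu_n)$. A path $\nu$ leads to a cycle $c$ if $\nu$ ends at a vertex of $c$ and no edge of $\nu$ belongs to $c$. $G'$ is the subgraph of $G$ consisting of all paths that lead to cycles: an edge $e$ is in $G'$ iff it is an edge of some path that leads to a cycle, and the vertices of $G'$ are the endpoints of its edges. For a subset (or subgraph) $S\subset G$, an edge $e$ can be reached from $S$ if there is a path $\nu=(e,\nu_n,\dots,\nu_1)$ with $s(\nu)\in S$ (the case $\nu=e$ is allowed). The subgraph $\tilde G$ of $G$: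 an edge $e$ belongs to $\tilde G$ if at least one of the following holds: (1) $e$ can be reached from a vertex of a cycle all of whose edges are not in $G'$; (2) $e$ cannot be reached from $G'$; (3) $e$ can be reached from a vertex of an edge satisfying (2); (4) there are vertices $p,q$ and infinitely many edges $f_i$ with $s(f_i)=p$, $r(f_i)=q$, $f_i\notin G'$, such that $e$ can be reached from $q$. A vertex $p$ belongs to $\tilde G$ if either $p$ is a vertex (source or range) of some edge of $\tilde G$, or $p$ is an infinite receiver (i.e. $r^{-1}(p)$ is infinite) and all the edges it receives are not in $G'$, or $p$ is an isolated vertex of $G$ (it neither receives nor emits edges). For C*-algebras $B_n$, $\prod B_n$ is the C*-algebra of bounded sequences $(b_n)$, $b_n\in B_n$, and $\bigoplus B_n$ the ideal of sequences with $\|b_n\|\to0$. $M_n$ is the algebra of complex $n\times n$ matrices. A separable C*-algebra $A$ is matricially semiprojective if every $*$-homomorphism $\varphi:A\to\prod_n M_n/\bigoplus_n M_n$ lifts to a $*$-homomorphism $\overline\varphi:A\to\prod_n M_n$ (i.e. $\pi\circ\overline\varphi=\varphi$ with $\pi$ the quotient map); equivalently, for every sequence $F_n$ of finite-dimensional C*-algebras every $*$-homomorphism $A\to\prod F_n/\bigoplus F_n$ lifts to a $*$-homomorphism $A\to\prod F_n$. *)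

(* Defs.v *)
From HB Require Import structures.
From mathcomp Require Import all_boot all_order all_algebra.
From mathcomp Require Import generic_quotient ring_quotient sesquilinear spectral.
From mathcomp Require Import complex.
From mathcomp Require Import all_classical all_reals all_analysis.

Set Implicit Arguments.
Unset Strict Implicit.
Unset Printing Implicit Defensive.

Import Order.TTheory GRing.Theory Num.Theory.
Import numFieldNormedType.Exports.
Import Quotient.Exports.

Local Open Scope classical_set_scope.
Local Open Scope ring_scope.

(** * *-algebras and C*-algebras *)

(* Neither *-algebras nor C*-algebras are required to be unital, which rules
   out the ring structures of MathComp: the product is a new operation [**]. *)
HB.mixin Record isStarAlgebra (K : numClosedFieldType) A & GRing.Lmodule K A := {
  amul : A -> A -> A;
  star : A -> A;
  amulA : associative amul;
  amulDl : left_distributive amul +%R;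
  amulDr : right_distributive amul +%R;
  amulZl : forall (k : K) (a b : A), amul (k *: a) b = k *: amul a b;
  amulZr : forall (k : K) (a b : A), amul a (k *: b) = k *: amul a b;
  starK : involutive star;
  starD : {morph star : a b / a + b};
  starZ : forall (k : K) (a : A), star (k *: a) = Num.conj k *: star a;
  starM : forall a b : A, star (amul a b) = amul (star b) (star a)
}.

#[short(type="starAlgType")]
HB.structure Definition StarAlgebra (K : numClosedFieldType) :=
  {A of isStarAlgebra K A & GRing.Lmodule K A}.

Notation "a ** b" := (amul a b) (at level 40, left associativity) : ring_scope.

(* As everywhere in MathComp-Analysis, the norm takes its values in the scalar
   field [K]; its values are nonnegative elements of [K], hence real. *)
HB.mixin Record isCStarAlgebra (K : numClosedFieldType) A
    & StarAlgebra K A & CompleteNormedModule K A := {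
  normM_le : forall a b : A, `|a ** b| <= `|a| * `|b|;
  norm_cstar : forall a : A, `|star a ** a| = `|a| ^+ 2
}.

#[short(type="cstarAlgType")]
HB.structure Definition CStarAlgebra (K : numClosedFieldType) :=
  {A of isCStarAlgebra K A & StarAlgebra K A & CompleteNormedModule K A}.

Definition is_starhom (K : numClosedFieldType) (A B : starAlgType K)
    (f : A -> B) : Prop :=
  [/\ linear f, {morph f : a b / a ** b} & {morph f : a / star a}].

Section StarAlgebraTheory.
Variables (K : numClosedFieldType) (A : starAlgType K).
Implicit Types a b : A.

Lemma amulNl a b : (- a) ** b = - (a ** b).
Proof. by rewrite -scaleN1r amulZl scaleN1r. Qed.

Lemma amulNr a b : a ** (- b) = - (a ** b).
Proof. by rewrite -scaleN1r amulZr scaleN1r. Qed.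

Lemma starN a : star (- a) = - star a.
Proof. by rewrite -scaleN1r starZ rmorphN1 scaleN1r. Qed.

End StarAlgebraTheory.

Lemma norm_star (K : numClosedFieldType) (A : cstarAlgType K) (a : A) :
  `|star a| = `|a|.
Proof.
have le (b : A) : `|b| <= `|star b|.
  have [->|b0] := eqVneq `|b| 0; first exact: normr_ge0.
  have bgt0 : 0 < `|b| by rewrite lt_def b0 normr_ge0.
  by rewrite -(ler_pM2r bgt0) -expr2 -norm_cstar normM_le.
by apply/eqP; rewrite eq_le le andbT -{2}[a]starK le.
Qed.

(** * The C*-algebra of bounded sequences, the ideal of null sequences, and
    their quotient *)

Section Product.
Variables (K : numClosedFieldType) (B : nat -> cstarAlgType K).

Record cprod := CProd {
  cseq :> forall n, B n;
  cseq_bounded : exists M : K, forall n, `|cseq n| <= M }.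

HB.instance Definition _ := gen_eqMixin cprod.
HB.instance Definition _ := gen_choiceMixin cprod.

Lemma cprodP (x y : cprod) : (forall n, x n = y n) -> x = y.
Proof.
case: x y => [x xb] [y yb] /= eqxy.
have {eqxy}xy := functional_extensionality_dep eqxy; subst y.
by congr CProd; exact: Prop_irrelevance.
Qed.

Lemma cprod0_subproof : exists M : K, forall n, `|0 : B n| <= M.
Proof. by exists 0 => n; rewrite normr0. Qed.

Lemma cprodN_subproof (x : cprod) : exists M : K, forall n, `|- x n| <= M.
Proof. by have [M xM] := cseq_bounded x; exists M => n; rewrite normrN. Qed.

Lemma cprodD_subproof (x y : cprod) :
  exists M : K, forall n, `|x n + y n| <= M.
Proof.
have [[M xM] [N yN]] := (cseq_bounded x, cseq_bounded y).
by exists (M + N) => n; rewrite (le_trans (ler_normD _ _)) ?lerD.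
Qed.

Lemma cprodZ_subproof k (x : cprod) : exists M : K, forall n, `|k *: x n| <= M.
Proof.
have [M xM] := cseq_bounded x.
by exists (`|k| * M) => n; rewrite normrZ ler_wpM2l ?xM.
Qed.

Lemma cprodM_subproof (x y : cprod) :
  exists M : K, forall n, `|x n ** y n| <= M.
Proof.
have [[M xM] [N yN]] := (cseq_bounded x, cseq_bounded y).
by exists (M * N) => n; rewrite (le_trans (normM_le _ _)) ?ler_pM ?xM ?yN.
Qed.

Lemma cprod_star_subproof (x : cprod) :
  exists M : K, forall n, `|star (x n)| <= M.
Proof. by have [M xM] := cseq_bounded x; exists M => n; rewrite norm_star. Qed.

Let add x y := CProd (cprodD_subproof x y).
Let opp x := CProd (cprodN_subproof x).
Let zero := CProd cprod0_subproof.
Let scale k x := CProd (cprodZ_subproof k x).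
Let mul x y := CProd (cprodM_subproof x y).
Let cstar x := CProd (cprod_star_subproof x).

Fact cprod_addA : associative add.
Proof. by move=> x y z; apply: cprodP => n; exact: (addrA (x n) (y n) (z n)). Qed.
Fact cprod_addC : commutative add.
Proof. by move=> x y; apply: cprodP => n; exact: (addrC (x n) (y n)). Qed.
Fact cprod_add0 : left_id zero add.
Proof. by move=> x; apply: cprodP => n; exact: (add0r (x n)). Qed.
Fact cprod_addN : left_inverse zero opp add.
Proof. by move=> x; apply: cprodP => n; exact: (addNr (x n)). Qed.

HB.instance Definition _ :=
  GRing.isZmodule.Build cprod cprod_addA cprod_addC cprod_add0 cprod_addN.

Fact cprod_scaleA k l x : scale k (scale l x) = scale (k * l) x.
Proof. by apply: cprodP => n; exact: (scalerA k l (x n)). Qed.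
Fact cprod_scale1 : left_id 1 scale.
Proof. by move=> x; apply: cprodP => n; exact: (scale1r (x n)). Qed.
Fact cprod_scaleDr : right_distributive scale +%R.
Proof. by move=> k x y; apply: cprodP => n; exact: (scalerDr k (x n) (y n)). Qed.
Fact cprod_scaleDl x : {morph scale^~ x : k l / k + l}.
Proof. by move=> k l; apply: cprodP => n; exact: (scalerDl (x n) k l). Qed.

HB.instance Definition _ := GRing.Zmodule_isLmodule.Build K cprod
  cprod_scaleA cprod_scale1 cprod_scaleDr cprod_scaleDl.

Fact cprod_mulA : associative mul.
Proof. by move=> x y z; apply: cprodP => n; exact: (amulA (x n) (y n) (z n)). Qed.
Fact cprod_mulDl : left_distributive mul +%R.
Proof. by move=> x y z; apply: cprodP => n; exact: (amulDl (x n) (y n) (z n)). Qed.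
Fact cprod_mulDr : right_distributive mul +%R.
Proof. by move=> x y z; apply: cprodP => n; exact: (amulDr (x n) (y n) (z n)). Qed.
Fact cprod_mulZl k x y : mul (k *: x) y = k *: mul x y.
Proof. by apply: cprodP => n; exact: (amulZl k (x n) (y n)). Qed.
Fact cprod_mulZr k x y : mul x (k *: y) = k *: mul x y.
Proof. by apply: cprodP => n; exact: (amulZr k (x n) (y n)). Qed.
Fact cprod_starK : involutive cstar.
Proof. by move=> x; apply: cprodP => n; exact: (starK (x n)). Qed.
Fact cprod_starD : {morph cstar : x y / x + y}.
Proof. by move=> x y; apply: cprodP => n; exact: (starD (x n) (y n)). Qed.
Fact cprod_starZ k x : cstar (k *: x) = Num.conj k *: cstar x.
Proof. by apply: cprodP => n; exact: (starZ k (x n)). Qed.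
Fact cprod_starM x y : cstar (mul x y) = mul (cstar y) (cstar x).
Proof. by apply: cprodP => n; exact: (starM (x n) (y n)). Qed.

HB.instance Definition _ := isStarAlgebra.Build K cprod
  cprod_mulA cprod_mulDl cprod_mulDr cprod_mulZl cprod_mulZr
  cprod_starK cprod_starD cprod_starZ cprod_starM.

Definition csum : {pred cprod} :=
  fun x => `[< (fun n => `|x n|) @ \oo --> (0 : K) >].

Lemma csumP (x : cprod) :
  reflect (forall e : K, 0 < e -> \forall n \near \oo, `|x n| < e) (x \in csum).
Proof.
apply: (iffP (asboolP _)) => [/cvgrPdist_lt x0 e e0|x0].
  near=> n; have -> : `|x n| = `|0 - `|x n| | by rewrite sub0r normrN normr_id.
  by near: n; exact: x0.
apply/cvgrPdist_lt => e e0; near=> n; rewrite sub0r normrN normr_id.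
by near: n; exact: x0.
Unshelve. all: by end_near. Qed.

Fact csum_zmod_closed : zmod_closed csum.
Proof.
split=> [|x y /csumP x0 /csumP y0]; apply/csumP => e e0.
  by near=> n; rewrite normr0.
near=> n; rewrite (le_lt_trans (ler_normB _ _))// (splitr e) ltrD//.
  by near: n; apply: x0; rewrite divr_gt0.
by near: n; apply: y0; rewrite divr_gt0.
Unshelve. all: by end_near. Qed.

HB.instance Definition _ := GRing.isZmodClosed.Build cprod csum csum_zmod_closed.

Lemma csum_dom (x y : cprod) (c : K) :
  x \in csum -> (forall n, `|y n| <= c * `|x n|) -> y \in csum.
Proof.
move=> /csumP x0 yx; apply/csumP => e e0.
have c1 : 0 < `|c| + 1 by rewrite ltr_wpDl.
have [M xM] := cseq_bounded x.
near=> n; have xn : `|x n| < e / (`|c| + 1).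
  by near: n; apply: x0; rewrite divr_gt0.
rewrite (le_lt_trans (yx n))//.
have cx : 0 <= c * `|x n| by rewrite (le_trans _ (yx n)).
rewrite -(ger0_norm cx) normrM normr_id.
rewrite ltr_pdivlMr// in xn; apply: le_lt_trans xn.
by rewrite mulrC ler_wpM2l// lerDl.
Unshelve. all: by end_near. Qed.

Lemma csumZ k (x : cprod) : x \in csum -> k *: x \in csum.
Proof. by move=> x0; apply: (csum_dom (c := `|k|) x0) => n; rewrite normrZ. Qed.

Lemma csumMl (x y : cprod) : y \in csum -> x ** y \in csum.
Proof.
have [M xM] := cseq_bounded x => y0; apply: (csum_dom (c := M) y0) => n.
by rewrite (le_trans (normM_le _ _)) ?ler_wpM2r ?xM.
Qed.

Lemma csumMr (x y : cprod) : x \in csum -> x ** y \in csum.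
Proof.
have [M yM] := cseq_bounded y => x0; apply: (csum_dom (c := M) x0) => n.
by rewrite (le_trans (normM_le _ _)) // mulrC ler_wpM2r ?yM.
Qed.

Lemma csum_star (x : cprod) : x \in csum -> star x \in csum.
Proof.
by move=> x0; apply: (csum_dom (c := 1) x0) => n; rewrite mul1r norm_star.
Qed.

(* Only the *-algebra structure of the quotient is needed to speak of its
   *-homomorphisms; its quotient norm plays no role in the definitions below. *)
Definition corona : Type := Quotient.quot csum.

HB.instance Definition _ := GRing.Zmodule.on corona.

Definition toCorona (x : cprod) : corona := (\pi_(Quotient.quot csum) x)%qT.

Lemma toCoronaP (x y : cprod) : (x - y \in csum) <-> toCorona x = toCorona y.
Proof. by rewrite Quotient.idealrBE; split => /eqP. Qed.

Lemma toCorona_surj (q : corona) : exists x, q = toCorona x.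
Proof. by exists (repr q); rewrite /toCorona reprK. Qed.

Lemma toCoronaD : {morph toCorona : x y / x + y}.
Proof. by move=> x y; rewrite /toCorona; exact: Quotient.pi_add. Qed.

Let reprP (x : cprod) : repr (toCorona x) - x \in csum.
Proof. by apply/toCoronaP; rewrite /toCorona reprK. Qed.

Let qscale k (q : corona) : corona := toCorona (k *: repr q).
Let qmul (q r : corona) : corona := toCorona (repr q ** repr r).
Let qstar (q : corona) : corona := toCorona (star (repr q)).

Fact toCorona_scale k x : qscale k (toCorona x) = toCorona (k *: x).
Proof. by apply/toCoronaP; rewrite -scalerBr csumZ. Qed.

Fact toCorona_mul x y : qmul (toCorona x) (toCorona y) = toCorona (x ** y).
Proof.
apply/toCoronaP; set x' := repr _; set y' := repr _.
have -> : x' ** y' - x ** y = (x' - x) ** y' + x ** (y' - y).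
  by rewrite amulDl amulDr amulNl amulNr addrA subrK.
by apply: rpredD; [apply: csumMr | apply: csumMl]; exact: reprP.
Qed.

Fact toCorona_star x : qstar (toCorona x) = toCorona (star x).
Proof. by apply/toCoronaP; rewrite -starN -starD csum_star. Qed.

Fact corona_scaleA k l q : qscale k (qscale l q) = qscale (k * l) q.
Proof.
by have [x ->] := toCorona_surj q; rewrite !toCorona_scale scalerA.
Qed.
Fact corona_scale1 : left_id 1 qscale.
Proof. by move=> q; have [x ->] := toCorona_surj q; rewrite toCorona_scale scale1r. Qed.
Fact corona_scaleDr : right_distributive qscale +%R.
Proof.
move=> k q r; have [x ->] := toCorona_surj q; have [y ->] := toCorona_surj r.
by rewrite -toCoronaD !toCorona_scale scalerDr toCoronaD.
Qed.
Fact corona_scaleDl q : {morph qscale^~ q : k l / k + l}.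
Proof.
move=> k l; have [x ->] := toCorona_surj q.
by rewrite !toCorona_scale scalerDl toCoronaD.
Qed.

HB.instance Definition _ := GRing.Zmodule_isLmodule.Build K corona
  corona_scaleA corona_scale1 corona_scaleDr corona_scaleDl.

Fact corona_mulA : associative qmul.
Proof.
move=> q r s; have [x ->] := toCorona_surj q; have [y ->] := toCorona_surj r.
by have [z ->] := toCorona_surj s; rewrite !toCorona_mul amulA.
Qed.
Fact corona_mulDl : left_distributive qmul +%R.
Proof.
move=> q r s; have [x ->] := toCorona_surj q; have [y ->] := toCorona_surj r.
have [z ->] := toCorona_surj s.
by rewrite -toCoronaD !toCorona_mul amulDl toCoronaD.
Qed.
Fact corona_mulDr : right_distributive qmul +%R.
Proof.
move=> q r s; have [x ->] := toCorona_surj q; have [y ->] := toCorona_surj r.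
have [z ->] := toCorona_surj s.
by rewrite -toCoronaD !toCorona_mul amulDr toCoronaD.
Qed.
Fact corona_mulZl k q r : qmul (k *: q) r = k *: qmul q r.
Proof.
have [x ->] := toCorona_surj q; have [y ->] := toCorona_surj r.
rewrite -[k *: toCorona x]/(qscale _ _) -[RHS]/(qscale _ _).
by rewrite toCorona_scale !toCorona_mul toCorona_scale amulZl.
Qed.
Fact corona_mulZr k q r : qmul q (k *: r) = k *: qmul q r.
Proof.
have [x ->] := toCorona_surj q; have [y ->] := toCorona_surj r.
rewrite -[k *: toCorona y]/(qscale _ _) -[RHS]/(qscale _ _).
by rewrite toCorona_scale !toCorona_mul toCorona_scale amulZr.
Qed.
Fact corona_starK : involutive qstar.
Proof. by move=> q; have [x ->] := toCorona_surj q; rewrite !toCorona_star starK. Qed.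
Fact corona_starD : {morph qstar : q r / q + r}.
Proof.
move=> q r; have [x ->] := toCorona_surj q; have [y ->] := toCorona_surj r.
by rewrite -toCoronaD !toCorona_star starD toCoronaD.
Qed.
Fact corona_starZ k q : qstar (k *: q) = Num.conj k *: qstar q.
Proof.
have [x ->] := toCorona_surj q.
rewrite -[k *: toCorona x]/(qscale _ _) -[RHS]/(qscale _ _).
by rewrite toCorona_scale !toCorona_star toCorona_scale starZ.
Qed.
Fact corona_starM q r : qstar (qmul q r) = qmul (qstar r) (qstar q).
Proof.
have [x ->] := toCorona_surj q; have [y ->] := toCorona_surj r.
by rewrite toCorona_mul !toCorona_star toCorona_mul starM.
Qed.

HB.instance Definition _ := isStarAlgebra.Build K corona
  corona_mulA corona_mulDl corona_mulDr corona_mulZl corona_mulZr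
  corona_starK corona_starD corona_starZ corona_starM.

Lemma toCorona_starhom : is_starhom toCorona.
Proof.
split=> [k x y|x y|x].
- by rewrite toCoronaD -toCorona_scale.
- by rewrite -toCorona_mul.
- by rewrite -toCorona_star.
Qed.

End Product.

(** * The C*-algebra of complex matrices *)

Definition adjmx (R : realType) n (A : 'M[R[i]]_n) : 'M[R[i]]_n :=
  map_mx Num.conj A^T.

HB.lock Definition vnorm (R : realType) n (u : 'rV[R[i]]_n) : R[i] :=
  sqrtC (dotmx u u).

(* As usual in MathComp a matrix acts on row vectors, on the right. *)
HB.lock Definition opnorm (R : realType) n (A : 'M[R[i]]_n) : R[i] :=
  (sup [set complex.Re (vnorm (u *m A)) | u in [set u | vnorm u <= 1]])%:C%C.

Section OperatorNorm.
Variable R : realType.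
Local Notation C := R[i].

Lemma vnorm_ge0 n (u : 'rV[C]_n) : 0 <= vnorm u.
Proof. by rewrite vnorm.unlock; exact: sqrt_dnorm_ge0. Qed.

Lemma Re_vnorm n (u : 'rV[C]_n) : (complex.Re (vnorm u))%:C%C = vnorm u.
Proof. by rewrite RRe_real ?ger0_real ?vnorm_ge0. Qed.

Lemma vnormD n (u v : 'rV[C]_n) : vnorm (u + v) <= vnorm u + vnorm v.
Proof. by rewrite vnorm.unlock; exact: (triangle_lerif (@dotmx C n) u v).1. Qed.

Lemma vnormZ n k (u : 'rV[C]_n) : vnorm (k *: u) = `|k| * vnorm u.
Proof.
by rewrite vnorm.unlock (dnormZ (@dotmx C n)) rootCMl ?exprn_ge0 // sqrCK.
Qed.

Lemma vnorm_eq0 n (u : 'rV[C]_n) : vnorm u = 0 -> u = 0.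
Proof. by rewrite vnorm.unlock => /eqP; rewrite (sqrt_dnorm_eq0 (@dotmx C n)) => /eqP. Qed.

Lemma vnorm0 n : vnorm (0 : 'rV[C]_n) = 0.
Proof. by rewrite -(scale0r 0) vnormZ normr0 mul0r. Qed.

Lemma vnorm_sum n I (s : seq I) (f : I -> 'rV[C]_n) :
  vnorm (\sum_(i <- s) f i) <= \sum_(i <- s) vnorm (f i).
Proof.
elim/big_ind2: _ => [|x a y b xa yb|//]; first by rewrite vnorm0.
by rewrite (le_trans (vnormD _ _)) ?lerD.
Qed.

Lemma vnorm_sqr n (u : 'rV[C]_n) : vnorm u ^+ 2 = dotmx u u.
Proof. by rewrite vnorm.unlock sqrtCK. Qed.

Lemma dotmx_sum n (u : 'rV[C]_n) : dotmx u u = \sum_i `|u 0 i| ^+ 2.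
Proof.
by rewrite dotmxE mxE; apply: eq_bigr => i _; rewrite !mxE normCK.
Qed.

Lemma entry_vnorm n (u : 'rV[C]_n) i : `|u 0 i| <= vnorm u.
Proof.
rewrite -(@ler_pXn2r _ 2) ?nnegrE ?vnorm_ge0// vnorm_sqr dotmx_sum (bigD1 i)//=.
by rewrite lerDl sumr_ge0 // => j _; rewrite exprn_ge0.
Qed.

Lemma vnorm_delta n i : vnorm (delta_mx 0 i : 'rV[C]_n) = 1.
Proof.
rewrite vnorm.unlock dotmx_sum (bigD1 i)//= big1 => [|j ji].
  by rewrite mxE !eqxx normr1 expr1n addr0 sqrtC1.
by rewrite mxE eqxx (negPf ji) normr0 expr0n.
Qed.

Lemma vnorm_le_sum n (u : 'rV[C]_n) : vnorm u <= \sum_i `|u 0 i|.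
Proof.
rewrite {1}[u]row_sum_delta (le_trans (vnorm_sum _ _)) // ler_sum // => i _.
by rewrite vnormZ vnorm_delta mulr1.
Qed.

Lemma vnorm_mulmx_le n (A : 'M[C]_n) u :
  vnorm (u *m A) <= (\sum_i \sum_j `|A i j|) * vnorm u.
Proof.
rewrite mulmx_sum_row (le_trans (vnorm_sum _ _)) // mulr_suml ler_sum // => i _.
rewrite vnormZ mulrC ler_pM ?vnorm_ge0 ?entry_vnorm //.
rewrite (le_trans (vnorm_le_sum _)) // ler_sum // => j _; by rewrite mxE.
Qed.

Lemma opnorm_has_sup n (A : 'M[C]_n) :
  has_sup [set complex.Re (vnorm (u *m A)) | u in [set u | vnorm u <= 1]].
Proof.
split; first by exists (complex.Re (vnorm (0 *m A))), 0; rewrite //= vnorm0.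
exists (complex.Re (\sum_i \sum_j `|A i j|)) => _ [u /= u1 <-].
have c0 : 0 <= \sum_i \sum_j `|A i j|.
  by rewrite sumr_ge0 // => i _; rewrite sumr_ge0.
rewrite -lecR Re_vnorm RRe_real ?ger0_real//.
by rewrite (le_trans (vnorm_mulmx_le _ _)) // ler_piMr.
Qed.

Lemma opnorm_ge0 n (A : 'M[C]_n) : 0 <= opnorm A.
Proof.
rewrite opnorm.unlock lecR; apply: ub_le_sup; first by case: (opnorm_has_sup A).
by exists 0; rewrite /= ?mul0mx vnorm0.
Qed.

Lemma vnorm_opnorm n (A : 'M[C]_n) u : vnorm (u *m A) <= opnorm A * vnorm u.
Proof.
have [u0|u0] := eqVneq (vnorm u) 0.
  by rewrite (vnorm_eq0 u0) mul0mx vnorm0 mulr0.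
have up : 0 < vnorm u by rewrite lt_def u0 vnorm_ge0.
have nu : `|(vnorm u)^-1| = (vnorm u)^-1 by rewrite ger0_norm ?invr_ge0 ?vnorm_ge0.
rewrite -ler_pdivrMr // mulrC -nu -vnormZ scalemxAl -Re_vnorm opnorm.unlock lecR.
apply: ub_le_sup; first by case: (opnorm_has_sup A).
by exists ((vnorm u)^-1 *: u) => //=; rewrite vnormZ nu mulVf.
Qed.

Lemma opnorm_le n (A : 'M[C]_n) (c : C) : 0 <= c ->
  (forall u, vnorm (u *m A) <= c * vnorm u) -> opnorm A <= c.
Proof.
move=> c0 Ac; rewrite opnorm.unlock -[c]RRe_real ?ger0_real // lecR.
apply: ge_sup; first by case: (opnorm_has_sup A).
move=> _ [u /= u1 <-]; rewrite -lecR Re_vnorm RRe_real ?ger0_real//.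
by rewrite (le_trans (Ac _)) // ler_piMr.
Qed.

Lemma opnorm_le_sum n (A : 'M[C]_n) : opnorm A <= \sum_i \sum_j `|A i j|.
Proof.
apply: opnorm_le => [|u]; last exact: vnorm_mulmx_le.
by rewrite sumr_ge0 // => i _; rewrite sumr_ge0.
Qed.

Lemma entry_opnorm n (A : 'M[C]_n) i j : `|A i j| <= opnorm A.
Proof.
have := vnorm_opnorm A (delta_mx 0 i); rewrite vnorm_delta mulr1 -rowE.
by apply: le_trans; have := entry_vnorm (row i A) j; rewrite mxE.
Qed.

Lemma opnormD n (A B : 'M[C]_n) : opnorm (A + B) <= opnorm A + opnorm B.
Proof.
apply: opnorm_le => [|u]; first by rewrite addr_ge0 ?opnorm_ge0.
by rewrite mulmxDr (le_trans (vnormD _ _)) // mulrDl lerD ?vnorm_opnorm.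
Qed.

Lemma opnorm0_eq0 n (A : 'M[C]_n) : opnorm A = 0 -> A = 0.
Proof.
move=> A0; apply/matrixP => i j; rewrite mxE; apply/eqP.
by rewrite -normr_le0 -A0 entry_opnorm.
Qed.

Lemma opnormZ n k (A : 'M[C]_n) : opnorm (k *: A) = `|k| * opnorm A.
Proof.
have le (l : C) (B : 'M[C]_n) : opnorm (l *: B) <= `|l| * opnorm B.
  apply: opnorm_le => [|u]; first by rewrite mulr_ge0 ?opnorm_ge0.
  by rewrite -scalemxAr vnormZ -mulrA ler_wpM2l ?vnorm_opnorm.
apply/eqP; rewrite eq_le le /=; have [->|k0] := eqVneq k 0.
  by rewrite normr0 mul0r opnorm_ge0.
have := le k^-1 (k *: A); rewrite scalerA mulVf // scale1r => leA.
apply: (le_trans (ler_wpM2l (normr_ge0 k) leA)).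
by rewrite mulrA -normrM (mulfV k0) normr1 mul1r.
Qed.

Lemma opnormM n (A B : 'M[C]_n) : opnorm (A *m B) <= opnorm A * opnorm B.
Proof.
apply: opnorm_le => [|u]; first by rewrite mulr_ge0 ?opnorm_ge0.
rewrite mulmxA; apply: (le_trans (vnorm_opnorm _ _)).
rewrite [opnorm A * _]mulrC -mulrA.
by apply: ler_wpM2l; [exact: opnorm_ge0 | exact: vnorm_opnorm].
Qed.

Lemma adjmxK n : involutive (@adjmx R n).
Proof. by move=> A; apply/matrixP => i j; rewrite !mxE conjCK. Qed.

Lemma adjmxM n (A B : 'M[C]_n) : adjmx (A *m B) = adjmx B *m adjmx A.
Proof. by rewrite /adjmx trmx_mul map_mxM. Qed.

Lemma adjmxD n : {morph @adjmx R n : A B / A + B}.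
Proof. by move=> A B; rewrite /adjmx linearD /= map_mxD. Qed.

Lemma adjmxZ n k (A : 'M[C]_n) : adjmx (k *: A) = Num.conj k *: adjmx A.
Proof. by rewrite /adjmx linearZ /= map_mxZ. Qed.

Lemma dotmx_le n (u v : 'rV[C]_n) : `|dotmx u v| <= vnorm u * vnorm v.
Proof. by rewrite vnorm.unlock; exact: (CauchySchwarz_sqrt (@dotmx C n) u v).1. Qed.

Lemma opnorm_adj_sqr n (A : 'M[C]_n) : opnorm A ^+ 2 <= opnorm (A *m adjmx A).
Proof.
have c0 := opnorm_ge0 (A *m adjmx A).
rewrite -[leRHS]sqrtCK ler_pXn2r ?nnegrE ?opnorm_ge0 ?sqrtC_ge0 //.
apply: opnorm_le => [|u]; first by rewrite sqrtC_ge0.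
rewrite -(@ler_pXn2r _ 2) ?nnegrE ?mulr_ge0 ?vnorm_ge0 ?sqrtC_ge0 //.
rewrite exprMn sqrtCK.
have uA : vnorm (u *m A) ^+ 2 = dotmx (u *m (A *m adjmx A)) u.
  by rewrite vnorm_sqr !dotmxE trmx_mul map_mxM !mulmxA.
have uA0 : 0 <= vnorm (u *m A) ^+ 2 by rewrite exprn_ge0 ?vnorm_ge0.
rewrite -[leLHS](ger0_norm uA0) uA; apply: (le_trans (dotmx_le _ _)).
rewrite [vnorm u ^+ 2]expr2 mulrA.
by apply: ler_wpM2r; [exact: vnorm_ge0 | exact: vnorm_opnorm].
Qed.

Lemma opnorm_adj n (A : 'M[C]_n) : opnorm (adjmx A) = opnorm A.
Proof.
have le (B : 'M[C]_n) : opnorm B <= opnorm (adjmx B).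
  have [->|B0] := eqVneq (opnorm B) 0; first exact: opnorm_ge0.
  have Bgt0 : 0 < opnorm B by rewrite lt_def B0 opnorm_ge0.
  by rewrite -(ler_pM2l Bgt0) -expr2 (le_trans (opnorm_adj_sqr _)) ?opnormM.
by apply/eqP; rewrite eq_le le andbT -{2}[A]adjmxK le.
Qed.

Lemma opnorm_cstar n (A : 'M[C]_n) : opnorm (adjmx A *m A) = opnorm A ^+ 2.
Proof.
apply/eqP; rewrite eq_le (le_trans (opnormM _ _)) ?opnorm_adj //=.
by have := opnorm_adj_sqr (adjmx A); rewrite adjmxK opnorm_adj.
Qed.

End OperatorNorm.

(* A copy of ['M[R[i]]_n] that does not inherit the maximum norm which
   MathComp-Analysis puts on matrices. *)
Definition cmatrix (R : realType) (n : nat) : Type := 'M[R[i]]_n.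

Section MatrixCStar.
Variables (R : realType) (n : nat).
Local Notation C := R[i].
Local Notation M := (cmatrix R n).

HB.instance Definition _ := GRing.Lmodule.copy M 'M[C]_n.

HB.instance Definition _ := @Lmodule_isNormed.Build C M
  (@opnorm R n) (@opnormD R n) (@opnormZ R n) (@opnorm0_eq0 R n).

Lemma cmatrix_cvg (F : set_system M) :
  ProperFilter F -> cauchy F -> cvg F.
Proof.
move=> FF /cauchyP cF.
have part (f : C -> R) (fD : {morph f : x y / x - y})
    (fle : forall x, (`|f x|)%:C%C <= `|x|) i j :
  cvg ((fun A : M => f ((A : 'M[C]_n) i j)) @ F).
  apply: R_complete; apply: cauchy_exP => e e0.
  have e0' : 0 < e%:C%C :> C by rewrite ltcR.
  have [A FA] := cF _ e0'.
  exists (f ((A : 'M[C]_n) i j)); rewrite /fmap /= /nbhs /=.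
  apply: filterS FA => B; rewrite -!ball_normE /= => AB.
  rewrite -fD -ltcR (le_lt_trans (fle _)) //; apply: le_lt_trans AB.
  by have := entry_opnorm ((A : 'M[C]_n) - (B : 'M[C]_n)) i j; rewrite !mxE.
have Re_le (x : C) : `|complex.Re x|%:C%C <= `|x| by exact: normc_ge_Re.
have Im_le (x : C) : `|complex.Im x|%:C%C <= `|x|.
  have := normc_ge_Re (x * 'i%C); rewrite ReiNIm normrN normrM.
  by rewrite [`|'i%C|]normc_def /= expr0n expr1n add0r sqrtr1 mulr1.
have normc_le (x : C) : `|x| <= `|complex.Re x|%:C%C + `|complex.Im x|%:C%C.
  rewrite {1}[x]complexE; apply: (le_trans (ler_normD _ _)); rewrite normrM.
  rewrite [`|'i%C|]normc_def /= expr0n expr1n add0r sqrtr1 mul1r.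
  by rewrite !normc_def /= expr0n !addr0 !sqrtr_sqr.
have ReB : {morph @complex.Re R : x y / x - y} by move=> [? ?] [? ?].
have ImB : {morph @complex.Im R : x y / x - y} by move=> [? ?] [? ?].
pose limp (f : C -> R) i j := lim ((fun A : M => f ((A : 'M[C]_n) i j)) @ F).
pose L : 'M[C]_n := \matrix_(i, j)
  (limp (@complex.Re R) i j +i* limp (@complex.Im R) i j)%C.
apply/cvg_ex; exists (L : M); apply/cvgrPdist_lt => e e0.
have eR : (complex.Re e)%:C%C = e by rewrite RRe_real ?gtr0_real.
pose d := complex.Re e / (n * n * 2).+1%:R.
have d0 : 0 < d by rewrite divr_gt0 // -ltcR eR.
have near_part (f : C -> R) (fc : forall i j,
    cvg ((fun A : M => f ((A : 'M[C]_n) i j)) @ F)) :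
  \forall A \near F, forall i j, `|limp f i j - f ((A : 'M[C]_n) i j)| < d.
  apply: filter_forall => i; apply: filter_forall => j.
  by have /cvgrPdist_lt h := fc i j; exact: h.
near=> A.
have AR i j : `|limp (@complex.Re R) i j - complex.Re ((A : 'M[C]_n) i j)| < d.
  by move: i j; near: A; apply: near_part => i j; exact: part.
have AI i j : `|limp (@complex.Im R) i j - complex.Im ((A : 'M[C]_n) i j)| < d.
  by move: i j; near: A; apply: near_part => i j; exact: part.
apply: (@le_lt_trans _ _ (\sum_(i < n) \sum_(j < n) (d *+ 2)%:C%C)).
  apply: (le_trans (opnorm_le_sum (L - (A : 'M[C]_n)))).
  apply: ler_sum => i _; apply: ler_sum => j _; rewrite !mxE.
  move: (AR i j) (AI i j); case: ((A : 'M[C]_n) i j) => a b /= ARij AIij.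
  apply: (le_trans (normc_le _)); rewrite [leRHS]rmorphD.
  by apply: lerD; rewrite lecR ltW.
rewrite !sumr_const !card_ord -!mulrnA -rmorphMn -eR ltcR.
have -> : complex.Re e = d *+ (n * n * 2).+1.
  by rewrite -[RHS]mulr_natr divfK ?pnatr_eq0.
by rewrite -mulrnA (ltr_pMn2l d0) ltnS mulnC.
Unshelve. all: by end_near. Qed.

HB.instance Definition _ := Uniform_isComplete.Build M cmatrix_cvg.

HB.instance Definition _ := isStarAlgebra.Build C M
  (@mulmxA C n n n n) (@mulmxDl C n n n) (@mulmxDr C n n n)
  (fun k A B => esym (scalemxAl k A B)) (fun k A B => esym (scalemxAr k A B))
  (@adjmxK R n) (@adjmxD R n) (@adjmxZ R n) (@adjmxM R n).

HB.instance Definition _ := isCStarAlgebra.Build C M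
  (@opnormM R n) (@opnorm_cstar R n).

End MatrixCStar.

Definition matricially_semiprojective (R : realType) (A : cstarAlgType R[i]) :
    Prop :=
  forall phi : A -> corona (fun n => cmatrix R n.+1), is_starhom phi ->
  exists2 psi : A -> cprod (fun n => cmatrix R n.+1),
    is_starhom psi & forall a, toCorona (psi a) = phi a.

(** * Directed graphs and their C*-algebras *)

Record digraph := Digraph {
  vertex : countType;
  edge : countType;
  src : edge -> vertex;
  rng : edge -> vertex }.

(* [a] is positive in a C*-algebra iff it is of the form [star c ** c]. *)
Definition cle (K : numClosedFieldType) (B : cstarAlgType K) (a b : B) : Prop :=
  exists c : B, b - a = star c ** c.

Definition is_projection (K : numClosedFieldType) (B : starAlgType K) (a : B) :
  Prop := star a = a /\ a ** a = a.

Record CK_family (G : digraph) (K : numClosedFieldType) (B : cstarAlgType K)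
    (p : vertex G -> B) (s : edge G -> B) : Prop := {
  CK_proj : forall v, is_projection (p v);
  CK_orth : forall v w, v != w -> p v ** p w = 0;
  CK_pisom : forall e, s e ** star (s e) ** s e = s e;
  CK_ranges : forall e f, e != f ->
    (s e ** star (s e)) ** (s f ** star (s f)) = 0;
  CK_source : forall e, star (s e) ** s e = p (src e);
  CK_sum : forall v,
    @rng G @^-1` [set v] !=set0 -> finite_set (@rng G @^-1` [set v]) ->
    p v = \sum_(e \in @rng G @^-1` [set v]) (s e ** star (s e));
  CK_range : forall e, cle (s e ** star (s e)) (p (rng e)) }.

Record is_star_subalgebra (K : numClosedFieldType) (A : starAlgType K)
    (D : set A) : Prop := {
  subalg0 : D 0;
  subalgD : forall a b, D a -> D b -> D (a + b);
  subalgZ : forall (k : K) a, D a -> D (k *: a);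
  subalgM : forall a b, D a -> D b -> D (a ** b);
  subalg_star : forall a, D a -> D (star a) }.

(* [A], with the families [p] and [s], is the graph C*-algebra of [G]: this
   determines [A] up to a unique isomorphism carrying generators to generators. *)
Record is_graph_cstar (R : realType) (G : digraph) (A : cstarAlgType R[i])
    (p : vertex G -> A) (s : edge G -> A) : Prop := {
  graph_cstar_family : CK_family p s;
  graph_cstar_generated : forall D : set A,
    is_star_subalgebra D -> closed D ->
    (forall v, D (p v)) -> (forall e, D (s e)) -> D = setT;
  graph_cstar_universal : forall (B : cstarAlgType R[i])
      (q : vertex G -> B) (t : edge G -> B), CK_family q t ->
    exists phi : A -> B, [/\ is_starhom phi,
      forall v, phi (p v) = q v & forall e, phi (s e) = t e] }.

(** * The subgraphs G' and G~ *)

Section TildeGraph.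
Variable G : digraph.
Local Notation V := (vertex G).
Local Notation E := (edge G).

(* A path is listed in the order in which it is travelled: the path written
   (nu_n, ..., nu_1) is the sequence [:: nu_1; ...; nu_n]. *)
Definition follows : rel E := [rel e f | rng e == src f].

Definition is_path (nu : seq E) : Prop := nu <> [::] /\ sorted follows nu.

Definition is_cycle (c : seq E) : Prop := c <> [::] /\ cycle follows c.

Definition endpoints (S : set E) : set V :=
  [set v | exists2 e, S e & v = src e \/ v = rng e].

Definition leads_to (nu c : seq E) : Prop :=
  (exists nu' e, nu = rcons nu' e /\ endpoints [set` c] (rng e)) /\
  (forall e, e \in nu -> e \notin c).

Definition Gprime_edge : set E :=
  [set e | exists nu c, [/\ is_path nu, is_cycle c, leads_to nu c & e \in nu]].

Definition Gprime_vertex : set V := endpoints Gprime_edge.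

Definition reached_from (S : set V) : set E :=
  [set e | exists f nu, [/\ is_path (f :: nu), S (src f) & last f nu = e]].

Definition Gtilde_edge1 : set E := [set e | exists c v,
  [/\ is_cycle c, forall f, f \in c -> ~ Gprime_edge f, endpoints [set` c] v &
      reached_from [set v] e]].

Definition Gtilde_edge2 : set E := ~` reached_from Gprime_vertex.

Definition Gtilde_edge3 : set E := [set e | exists f v,
  [/\ Gtilde_edge2 f, endpoints [set f] v & reached_from [set v] e]].

Definition Gtilde_edge4 : set E := [set e | exists p q,
  infinite_set [set f : E | [/\ src f = p, rng f = q & ~ Gprime_edge f]] /\
  reached_from [set q] e].

Definition Gtilde_edge : set E :=
  Gtilde_edge1 `|` Gtilde_edge2 `|` Gtilde_edge3 `|` Gtilde_edge4.

Definition isolated (p : V) : Prop := forall e : E, src e <> p /\ rng e <> p.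

Definition Gtilde_vertex : set V := [set p |
  [\/ endpoints Gtilde_edge p,
      infinite_set (@rng G @^-1` [set p]) /\
        (forall e : E, rng e = p -> ~ Gprime_edge e) |
      isolated p]].

Definition Gtilde_finite : Prop :=
  finite_set Gtilde_vertex /\ finite_set Gtilde_edge.

End TildeGraph.

(* Main.v *)
Require Import Defs.
From HB Require Import structures.
From mathcomp Require Import all_boot all_order all_algebra.
From mathcomp Require Import spectral.
From mathcomp Require Import complex.
From mathcomp Require Import all_classical all_reals all_analysis.

(** A *-homomorphism [phi] from C*(G) into the corona [Q] of the matrix algebras
    sees only part of the graph, because [Q] is finite: an isometry of a
    projection into itself is unitary ([corona_finite]).  So the range of a
    cycle fills the projection of each of its vertices, and an edge that enters
    the cycle from outside is sent to 0.  This spreads backwards along paths,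
    hence to the sources of all edges of G', and then forwards through the
    vertices that receive a finite nonzero number of edges, all sent to 0.  An
    edge that escapes this propagation is an edge of G~ ([not_Gtilde_dead]).

    Suppose G~ has finitely many edges.  Then [phi] lives on a finite graph, and
    the relations of a finite graph lift: first the vertex projections, one
    after the other ([lift_projections]), then the edges, by polar
    decomposition in the corner left free by the previous ones ([lift_edges]).
    The summation relations come for free far out in the sequence, since their
    defects are null sequences of projections ([lift_family]).  The universal
    property applied in each matrix algebra gives the lift.  It agrees with
    [phi] on the generators, and everywhere by continuity, which *-homomorphisms
    have because h = x + x - x ** x has a selfadjoint solution x for small
    h = star a ** a ([quasi_sqrt], [starhom_corona_bound]).

    Suppose G~ has infinitely many edges.  Infinitely many of them join the same
    vertex [u] to the same vertex [v].  A matrix algebra has no room for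
    infinitely many orthogonal copies of a nonzero projection, so every
    *-homomorphism into it kills [p u] ([infinite_edges_kill]), and a liftable
    [phi] satisfies phi (p u) = 0.  On the other hand [u] is reachable from a
    root ([Gtilde_rooted]): a cycle avoiding G', a vertex that receives nothing,
    or a vertex that receives infinitely many edges outside G'.  No path leaving
    the root meets a cycle, so only finitely many paths use the first k edges of
    G; edges act by prolonging these paths, and the resulting matrices satisfy
    more and more of the relations as k grows.  In the limit they define a
    *-homomorphism into [Q] which does not vanish on [p u]
    ([rooted_representation]).  For the universal property to apply there, the
    corona is first shown to be a C*-algebra for its quotient norm. *)

Set Implicit Arguments.
Unset Strict Implicit.
Unset Printing Implicit Defensive.

Import Order.TTheory GRing.Theory Num.Theory.
Import numFieldNormedType.Exports.

Local Open Scope classical_set_scope.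
Local Open Scope ring_scope.

(** * Functional calculus for hermitian matrices *)

Section FunctionalCalculus.
Variables (R : realType) (n : nat).
Local Notation C := R[i].
Implicit Types (A B h : 'M[C]_n) (f g : C -> C).

(** The rows of [spectralmx h] are an orthonormal eigenbasis of a hermitian [h],
    so this is f(h). *)
Definition hfun h f : 'M[C]_n :=
  adjmx (spectralmx h) *m diag_mx (map_mx f (spectral_diag h)) *m spectralmx h.

Lemma spectralmxVr h : spectralmx h *m adjmx (spectralmx h) = 1%:M.
Proof. exact/unitarymxP/spectral_unitarymx. Qed.

Lemma spectralmxVl h : adjmx (spectralmx h) *m spectralmx h = 1%:M.
Proof. exact/mulmx1C/spectralmxVr. Qed.

Lemma adjmx_hermsym h : adjmx h = h -> h \is hermsymmx.
Proof.
by move=> hh; apply/is_hermitianmxP; rewrite expr0 scale1r -[LHS]hh.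
Qed.

Lemma hfun_id h : adjmx h = h -> hfun h id = h.
Proof.
move=> /adjmx_hermsym/hermitian_normalmx/orthomx_spectralP hE.
have U := invmx_unitary (spectral_unitarymx h).
have -> : hfun h id = invmx (spectralmx h) *m diag_mx (spectral_diag h) *m spectralmx h.
  by rewrite /hfun U map_mx_id.
by [].
Qed.

Lemma hfunM h f g : hfun h (fun x => f x * g x) = hfun h f *m hfun h g.
Proof.
rewrite /hfun !mulmxA -(mulmxA _ (spectralmx h) (adjmx _)) spectralmxVr mulmx1.
congr (_ *m _); rewrite -mulmxA mulmx_diag; congr (_ *m diag_mx _).
by apply/rowP => i; rewrite !mxE.
Qed.

Lemma hfunB h f g : hfun h (fun x => f x - g x) = hfun h f - hfun h g.
Proof.
rewrite /hfun -mulmxBl -mulmxBr -raddfB; congr (_ *m diag_mx _ *m _).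
by apply/rowP => i; rewrite !mxE.
Qed.

Lemma hfun1 h : hfun h (fun=> 1) = 1%:M.
Proof.
rewrite /hfun (_ : map_mx _ _ = const_mx 1); last by apply/rowP => i; rewrite !mxE.
by rewrite diag_const_mx mulmx1 spectralmxVl.
Qed.

Lemma eq_hfun h f g : (forall i, f (spectral_diag h 0 i) = g (spectral_diag h 0 i)) ->
  hfun h f = hfun h g.
Proof.
move=> fg; congr (_ *m diag_mx _ *m _); apply/rowP => i.
by rewrite !mxE fg.
Qed.

Lemma adjmx_hfun h f : adjmx (hfun h f) = hfun h (fun x => Num.conj (f x)).
Proof.
rewrite /hfun !adjmxM adjmxK mulmxA; congr (_ *m _ *m _).
rewrite /adjmx tr_diag_mx map_diag_mx; congr diag_mx.
by apply/rowP => i; rewrite !mxE.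
Qed.

Lemma spectral_diag_real h i : adjmx h = h -> spectral_diag h 0 i \is Num.real.
Proof. by move=> /adjmx_hermsym/hermitian_spectral_diag_real/mxOverP. Qed.

(** In the eigenbasis, commuting with [h] forces the entry (i, j) to vanish
    unless the eigenvalues i and j agree; then f agrees on them too. *)
Lemma hfun_comm h A f : adjmx h = h -> A *m h = h *m A ->
  A *m hfun h f = hfun h f *m A.
Proof.
move=> hh Ah; pose U := spectralmx h; pose d := spectral_diag h.
pose B := U *m A *m adjmx U.
have AB : A = adjmx U *m B *m U.
  by rewrite /B !mulmxA spectralmxVl mul1mx -mulmxA spectralmxVl mulmx1.
have Bd : B *m diag_mx d = diag_mx d *m B.
  have dE : diag_mx d = U *m h *m adjmx U.
    rewrite -[in RHS](hfun_id hh) /hfun !mulmxA -/U /U spectralmxVr mul1mx map_mx_id//.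
    by rewrite -mulmxA spectralmxVr mulmx1.
  rewrite dE /B !mulmxA -!(mulmxA _ (adjmx U) U) spectralmxVl !mulmx1.
  by rewrite -!(mulmxA U) Ah.
clearbody B.
have Bf : B *m diag_mx (map_mx f d) = diag_mx (map_mx f d) *m B.
  apply/matrixP => i j; have /matrixP/(_ i j) := Bd.
  rewrite !mul_mx_diag !mul_diag_mx !mxE; have [->|dij] := eqVneq (d 0 i) (d 0 j).
    by move=> _; exact: mulrC.
  rewrite [RHS]mulrC => /eqP; rewrite -subr_eq0 -mulrBr mulf_eq0 subr_eq0.
  by rewrite (eq_sym (d 0 j)) (negPf dij) orbF => /eqP ->; rewrite mul0r mulr0.
rewrite {1 2}AB /hfun -/U -/d !mulmxA.
rewrite -(mulmxA _ U (adjmx U)) spectralmxVr mulmx1.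
rewrite -(mulmxA _ U (adjmx U)) spectralmxVr mulmx1.
by rewrite -!(mulmxA (adjmx U)) Bf.
Qed.

Lemma vnorm_unitary A (u : 'rV[C]_n) : A *m adjmx A = 1%:M -> vnorm (u *m A) = vnorm u.
Proof.
move=> AA; rewrite !vnorm.unlock; congr sqrtC; rewrite !dotmxE trmx_mul map_mxM.
by rewrite mulmxA -(mulmxA u) -/(adjmx A) AA mulmx1.
Qed.

Lemma opnorm_hfun_le h f (c : C) : 0 <= c ->
  (forall i, `|f (spectral_diag h 0 i)| <= c) -> opnorm (hfun h f) <= c.
Proof.
move=> c0 fc; apply: opnorm_le => // u; rewrite /hfun !mulmxA.
rewrite vnorm_unitary ?spectralmxVr//.
rewrite -[in leRHS](@vnorm_unitary (adjmx (spectralmx h)) u) ?adjmxK ?spectralmxVl//.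
set v := u *m _.
rewrite -(@ler_pXn2r _ 2) ?nnegrE ?mulr_ge0 ?vnorm_ge0//.
rewrite exprMn !vnorm_sqr !dotmx_sum mulr_sumr; apply: ler_sum => i _.
rewrite mul_mx_diag !mxE normrM exprMn mulrC ler_wpM2r ?exprn_ge0//.
by rewrite ler_pXn2r ?nnegrE.
Qed.

(** The i-th row of [spectralmx h] is a unit eigenvector for f(h). *)
Lemma opnorm_hfun_ge h f i : `|f (spectral_diag h 0 i)| <= opnorm (hfun h f).
Proof.
have U1 : vnorm (row i (spectralmx h)) = 1.
  by rewrite rowE vnorm_unitary ?spectralmxVr// vnorm_delta.
have := vnorm_opnorm (hfun h f) (row i (spectralmx h)).
rewrite U1 mulr1; apply: le_trans.
rewrite /hfun !mulmxA -row_mul spectralmxVr row1 vnorm_unitary ?spectralmxVr//.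
apply: le_trans (entry_vnorm _ i).
by rewrite mul_mx_diag !mxE !eqxx mul1r.
Qed.

End FunctionalCalculus.

(** * Perturbation of projections and partial isometries in matrices *)

Section MatrixPerturbation.
Variables (R : realType) (n : nat).
Local Notation C := R[i].
Implicit Types (A B h P : 'M[C]_n).

(** P = f(h) with f the indicator function of the numbers > 1/2: the distance
    from a real number x to f(x) is at most 2 |x^2 - x|. The factorizations
    through [h] let [P] inherit every relation of the form x h = 0 or h x = 0,
    which keeps lifted projections orthogonal to those already chosen. *)
Lemma projection_near h : adjmx h = h ->
  exists P g, [/\ adjmx P = P, P *m P = P, P = h *m g, P = g *m h &
                  opnorm (P - h) <= 2 * opnorm (h *m h - h)].
Proof.
move=> hh; pose f (x : C) : C := if 2^-1 < x then 1 else 0.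
pose g (x : C) : C := f x / x.
have fg x : f x = x * g x.
  rewrite /g /f; case: (boolP (2^-1 < x)) => [x2|_]; last by rewrite mul0r mulr0.
  by rewrite mul1r divff// gt_eqF// (lt_trans _ x2)// invr_gt0.
exists (hfun h f), (hfun h g); split.
- by rewrite adjmx_hfun; apply: eq_hfun => i; rewrite /f; case: (_ < _); rewrite ?rmorph1 ?rmorph0.
- rewrite -hfunM; apply: eq_hfun => i; rewrite /f.
  by case: (_ < _); rewrite ?mul1r ?mul0r.
- rewrite -{2}(hfun_id hh) -hfunM; exact: eq_hfun.
- rewrite -{3}(hfun_id hh) -hfunM; apply: eq_hfun => i.
  by rewrite fg mulrC.
rewrite -{2 3 4 5}(hfun_id hh) -!(hfunM, hfunB).
apply: opnorm_hfun_le => [|i]; first by rewrite mulr_ge0 ?opnorm_ge0.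
have := opnorm_hfun_ge h (fun x => x * x - x) i.
set x := spectral_diag h 0 i; have xr : x \is Num.real by exact: spectral_diag_real.
move=> xx; apply: (@le_trans _ _ (2 * `|x * x - x|)); last by rewrite ler_pM2l.
have -> : x * x - x = x * (x - 1) by rewrite mulrBr mulr1.
(* Of the two factors of x (x - 1), one is the distance to f(x) and the other
   has modulus at least 1/2. *)
rewrite normrM /f; case: (boolP (2^-1 < x)) => x2.
  have x0 : 0 < x by rewrite (lt_trans _ x2)// invr_gt0.
  rewrite distrC mulrA ler_peMl// (gtr0_norm x0).
  by rewrite mulrC -ler_pdivrMr// mul1r ltW.
rewrite sub0r normrN mulrCA ler_peMr//.
rewrite -real_leNgt ?realV ?realn// in x2.
have x1 : x - 1 <= - 2^-1.
  by rewrite lerBlDr (le_trans x2)// [X in _ <= _ + X](splitr 1) mul1r addKr.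
rewrite ler0_norm; last by rewrite (le_trans x1)// oppr_le0 invr_ge0.
by rewrite mulrC -ler_pdivrMr// mul1r lerNr.
Qed.

(** Polar decomposition relative to [P]: g is the inverse square root of k =
    x^* x + (1 - P), which is within 1/2 of the identity and commutes with [P].
    Adding 1 - P makes k invertible on the whole space. As the correction is
    x g, relations of the form y x = 0 or y x = x survive. *)
Lemma partial_isometry_near (x : 'M[C]_n) P : adjmx P = P -> P *m P = P -> x *m P = x ->
  opnorm (adjmx x *m x - P) <= 2^-1 ->
  exists g, adjmx (x *m g) *m (x *m g) = P /\
    opnorm (x *m g - x) <= opnorm x * opnorm (adjmx x *m x - P).
Proof.
move=> PP Pid xP xx; pose k : 'M[C]_n := adjmx x *m x + (1%:M - P).
have Px : P *m adjmx x = adjmx x by rewrite -{1}PP -adjmxM xP.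
have kk : adjmx k = k.
  rewrite /k !adjmxD adjmxM adjmxK -scaleN1r adjmxZ PP.
  by rewrite rmorphN1 scaleN1r /adjmx trmx1 map_mx1.
have kP : k *m P = adjmx x *m x.
  by rewrite /k mulmxDl mulmxBl mul1mx Pid subrr addr0 -mulmxA xP.
have Pk : P *m k = k *m P.
  by rewrite kP /k mulmxDr mulmxBr mulmx1 Pid subrr addr0 mulmxA Px.
have k1 : k - 1%:M = adjmx x *m x - P by rewrite /k -addrA (addrAC 1%:M) subrr add0r.
pose c := opnorm (adjmx x *m x - P); have c0 : 0 <= c by exact: opnorm_ge0.
have kd i : `|spectral_diag k 0 i - 1| <= c.
  have hk : hfun k (fun y => y - 1) = k - 1%:M.
    by rewrite (hfunB k id (fun=> 1)) hfun1 hfun_id.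
  rewrite /c -k1 -hk.
  exact: (opnorm_hfun_ge k (fun x => x - 1)).
pose f (y : C) : C := (sqrtC y)^-1.
have kd2 i : 2^-1 <= spectral_diag k 0 i.
  have yr : spectral_diag k 0 i \is Num.real by exact: spectral_diag_real.
  have := le_trans (kd i) xx; rewrite real_ler_norml ?realB ?realn// => /andP[h _].
  by move: h; rewrite lerBrDl [X in X - _ <= _](splitr 1) mul1r addrK.
have k0 i : 0 < spectral_diag k 0 i by rewrite (lt_le_trans _ (kd2 i))// invr_gt0.
pose g := hfun k f; exists g.
have gg : adjmx g = g.
  rewrite adjmx_hfun; apply: eq_hfun => i; rewrite /f.
  by rewrite conj_Creal// realV ger0_real// sqrtC_ge0 ltW.
have gk : g *m k *m g = 1%:M.
  have gkE : hfun k (fun y => f y * y * f y) = g *m k *m g.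
    by rewrite (hfunM k (fun y => f y * y)) (hfunM k f id) (hfun_id kk).
  rewrite -gkE -(hfun1 k); apply: eq_hfun => i; rewrite /f.
  rewrite -{2}[spectral_diag k 0 i]sqrtCK expr2 !mulrA mulVf ?mul1r ?divff//.
    by rewrite sqrtC_eq0 gt_eqF.
  by rewrite sqrtC_eq0 gt_eqF.
have gP : P *m g = g *m P by apply: hfun_comm.
split.
  rewrite adjmxM gg mulmxA -(mulmxA g (adjmx x)) -kP mulmxA -(mulmxA _ P) gP.
  by rewrite mulmxA gk mul1mx.
rewrite -{2}[x]mulmx1 -mulmxBr (le_trans (opnormM _ _))// ler_wpM2l ?opnorm_ge0//.
have gB : hfun k (fun y => f y - 1) = g - 1%:M by rewrite (hfunB k f) hfun1.
rewrite -gB; apply: opnorm_hfun_le => // i; rewrite /f.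
apply: le_trans (kd i); set y := spectral_diag k 0 i.
have y0 : 0 < sqrtC y by rewrite sqrtC_gt0 k0.
(* With y >= 1/2 both y and sqrt y are at least 1/2, and |1/sqrt y - 1| =
   |y - 1| / (sqrt y (1 + sqrt y)). *)
have y1 : 1 <= sqrtC y * (1 + sqrtC y).
  rewrite mulrDr mulr1 -expr2 sqrtCK (splitr 1) mul1r lerD ?kd2//.
  have y0' := ltW y0.
  rewrite -(@ler_pXn2r _ 2) ?nnegrE ?invr_ge0// sqrtCK.
  rewrite (le_trans _ (kd2 i))// expr2 -[leRHS]mulr1 ler_pM2l ?invr_gt0//.
  by rewrite invf_le1// ler1n.
have -> : y - 1 = (sqrtC y - 1) * (1 + sqrtC y).
  by rewrite (addrC 1) -subr_sqr_1 sqrtCK.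
have -> : (sqrtC y)^-1 - 1 = (1 - sqrtC y) / sqrtC y.
  by rewrite mulrBl mul1r divff// gt_eqF.
rewrite !normrM distrC ler_wpM2l// normfV !gtr0_norm ?addr_gt0//.
by rewrite -[leLHS]mul1r ler_pdivrMr// mulrC.
Qed.
End MatrixPerturbation.

(** * Finiteness and positivity in matrix algebras *)

Section MatrixFacts.
Variables (R : realType).
Local Notation C := R[i].
Local Notation M n := (cmatrix R n).

Lemma mxtrace_adj n (T : 'M[C]_n) : \tr (adjmx T *m T) = \sum_i \sum_j `|T j i| ^+ 2.
Proof.
apply: eq_bigr => i _; rewrite !mxE; apply: eq_bigr => j _.
by rewrite !mxE mulrC normCK.
Qed.

(** Here T = T^* T, whose trace is the sum of the squared moduli of the
    entries. *)
Lemma projection_trace0 n (T : 'M[C]_n) :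
  adjmx T = T -> T *m T = T -> \tr T = 0 -> T = 0.
Proof.
move=> Ta Ti; rewrite -{1}Ti -{1}Ta mxtrace_adj => /eqP.
rewrite psumr_eq0 => [/allP T0|i _]; last by rewrite sumr_ge0// => j _; rewrite exprn_ge0.
apply/matrixP => j i; rewrite mxE.
have := T0 i; rewrite mem_index_enum => /(_ isT).
rewrite psumr_eq0 => [/allP/(_ j)|k _]; last by rewrite exprn_ge0.
by rewrite mem_index_enum => /(_ isT); rewrite sqrf_eq0 normr_eq0 => /eqP.
Qed.

Lemma isometry_source (A : cstarAlgType C) (S P : A) : is_projection P ->
  star S ** S = P -> S ** P = S.
Proof.
move=> [Pa Pi] SP.
have e : star (S ** P - S) ** (S ** P - S) = 0.
  have e1 : star S ** (S ** P) = P by rewrite amulA SP.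
  rewrite starD starN starM Pa amulDl !amulDr !(amulNl, amulNr) opprK.
  by rewrite -!(amulA P) e1 SP Pi subrr addNr addr0.
apply/eqP; rewrite -subr_eq0 -normr_eq0 -sqrf_eq0 -norm_cstar e normr0.
exact: eqxx.
Qed.

(** Matrix algebras are finite: [P] and the subprojection S S^* have the same
    trace, so their difference is a projection of trace 0. *)
Lemma isometry_unitary n (S P : M n) : is_projection P ->
  star S ** S = P -> P ** S = S -> S ** star S = P.
Proof.
move=> [Pa Pi] SP PS; apply/esym/eqP; rewrite -subr_eq0; apply/eqP.
have SPP := isometry_source (conj Pa Pi) SP.
have SSi : S ** star S ** (S ** star S) = S ** star S.
  by rewrite -!amulA (amulA (star S)) SP -{1}Pa -starM SPP.
have PSS : P ** (S ** star S) = S ** star S by rewrite amulA PS.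
have SSP : S ** star S ** P = S ** star S.
  by rewrite -amulA -{1}Pa -starM PS.
apply: (@projection_trace0 _ (P - S ** star S)).
- by rewrite -[LHS]/(star (P - S ** star S)) starD starN starM starK Pa.
- rewrite -[LHS]/((P - S ** star S) ** (P - S ** star S)).
  by rewrite amulDl !amulDr !(amulNl, amulNr) Pi PSS SSP SSi opprK addNr addr0.
- by rewrite raddfB /= -SP (mxtrace_mulC (star S : 'M[C]_n)) subrr.
Qed.

Lemma norm_projection (A : cstarAlgType C) (p : A) : is_projection p ->
  p = 0 \/ `|p| = 1.
Proof.
move=> [pa pi]; have := norm_cstar p; rewrite pa pi => pp.
have [->|p0] := eqVneq p 0; [by left | right].
have n0 : `|p| != 0 by rewrite normr_eq0.
by apply: (mulfI n0); rewrite mulr1 -expr2 -pp.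
Qed.

(** Fix i with P i i <> 0. The i-th rows of the S_k^* are pairwise orthogonal
    vectors of squared length P i i, and there are more of them than the
    dimension allows. *)
Lemma orthogonal_isometries n (P : M n) (S : nat -> M n) :
  (forall i j, star (S i) ** S j = if i == j then P else 0) -> P = 0.
Proof.
move=> SP; have S0P : adjmx (S 0%N) *m S 0%N = P by exact: (SP 0%N 0%N).
have PiiE i : (P : 'M[C]_n) i i = \sum_j `|(S 0%N : 'M[C]_n) j i| ^+ 2.
  by rewrite -S0P mxE; apply: eq_bigr => j _; rewrite !mxE mulrC normCK.
suff Pii i : (P : 'M[C]_n) i i = 0.
  rewrite -S0P (_ : S 0%N = 0) ?mulmx0//; apply/matrixP => j i.
  have /eqP := Pii i; rewrite PiiE psumr_eq0 => [/allP/(_ j)|k _].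
    by rewrite mem_index_enum mxE => /(_ isT); rewrite sqrf_eq0 normr_eq0 => /eqP.
  by rewrite exprn_ge0.
apply/eqP; apply: contraT => Pii0.
(* The first n + 1 of these rows, in a space of dimension n. *)
pose W : 'M[C]_(n.+1, n) := \matrix_(k, l) adjmx (S k) i l.
have WW : W *m map_mx Num.conj W^T = ((P : 'M[C]_n) i i)%:M.
  apply/matrixP => k k'; rewrite !mxE.
  transitivity ((adjmx (S k) *m (S k' : 'M[C]_n)) i i).
    by rewrite mxE; apply: eq_bigr => l _; rewrite !mxE conjCK.
  have -> : adjmx (S k) *m (S k' : 'M[C]_n) = if k == k' then P else 0 by exact: (SP k k').
  by case: (k == k'); rewrite ?mulr1n ?mulr0n ?mxE.
have := mxrankM_maxl W (map_mx Num.conj W^T).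
rewrite WW -scalemx1 mxrank_scale_nz// mxrank1 => /leq_trans/(_ (rank_leq_col W)).
by rewrite ltnn.
Qed.

(** A sum of positive matrices dominates each summand: evaluate the quadratic
    forms on a vector. *)
Lemma opnorm_sum_squares n (x d : M n) :
  `|x| ^+ 2 <= `|star x ** x + star d ** d|.
Proof.
set e := _ + _; rewrite -(norm_star x).
rewrite -[leRHS]sqrtCK ler_pXn2r ?nnegrE ?sqrtC_ge0//.
apply: opnorm_le => [|u]; first by rewrite sqrtC_ge0.
rewrite -(@ler_pXn2r _ 2) ?nnegrE ?mulr_ge0 ?vnorm_ge0 ?sqrtC_ge0//.
rewrite exprMn sqrtCK.
have sq (y : 'M[C]_n) : vnorm (u *m adjmx y) ^+ 2 = dotmx (u *m (adjmx y *m y)) u.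
  by rewrite vnorm_sqr !dotmxE trmx_mul map_mxM -/(adjmx (adjmx y)) adjmxK !mulmxA.
apply: (@le_trans _ _ (vnorm (u *m adjmx x) ^+ 2 + vnorm (u *m adjmx d) ^+ 2)).
  by rewrite lerDl exprn_ge0 ?vnorm_ge0.
have e0 : 0 <= dotmx (u *m (e : 'M[C]_n)) u.
  rewrite mulmxDr linearDl /= -!sq.
  by rewrite addr_ge0 ?exprn_ge0 ?vnorm_ge0.
rewrite !sq -linearDl -mulmxDr -[leLHS]/(dotmx (u *m (e : 'M[C]_n)) u).
rewrite -(ger0_norm e0) (le_trans (dotmx_le _ _))// expr2 mulrA.
by rewrite ler_wpM2r ?vnorm_ge0// vnorm_opnorm.
Qed.

(** In the presence of a unit, the right-hand side is 1 - (1 - c)^2 + err, so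
    x^* x + (1 - c)^2 = 1 + err. Writing this without a unit lets [c] come from
    an algebra that has none. *)
Lemma opnorm_quasi_sqrt n (x c err : M n) : star c = c ->
  star x ** x = c + c - c ** c + err -> `|x| ^+ 2 <= 1 + `|err|.
Proof.
move=> cc xx; pose I : M n := (1%:M : 'M[C]_n).
have I1 (y : M n) : I ** y = y by exact: mul1mx.
have Ir (y : M n) : y ** I = y by exact: mulmx1.
have Is : star I = I by rewrite -[LHS]Ir -{2}[I]starK -starM Ir starK.
apply: (le_trans (opnorm_sum_squares x (I - c))).
rewrite xx starD starN Is cc amulDl !amulDr !(amulNl, amulNr) !I1 Ir opprK.
have -> : I - c + (- c + c ** c) = I - (c + c - c ** c).
  by rewrite !opprD opprK !addrA.
rewrite addrC addrA subrK (le_trans (ler_normD _ _))// lerD2r.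
have [->|->//] := @norm_projection (cmatrix R n) I (conj Is (I1 I)).
by rewrite normr0.
Qed.
End MatrixFacts.

(** * Square roots in C*-algebras *)

Section SquareRoot.
Variables (R : realType) (A : cstarAlgType R[i]).
Local Notation C := R[i].

Lemma small_geometric (e : C) : 0 < e -> exists k : nat, 2^-1 ^+ k < e.
Proof.
move=> e0; have eR : (complex.Re e)%:C%C = e by rewrite RRe_real ?gtr0_real.
have e0' : 0 < complex.Re e by rewrite -ltcR eR.
have [k _ hk] : \forall k \near \oo, `|0 - 2^-1 ^+ k| < complex.Re e.
  have half1 : `|2^-1 : R| < 1 by rewrite gtr0_norm ?invr_gt0// invf_lt1// ltr1n.
  by move/cvgrPdist_lt: (cvg_expr half1) => /(_ _ e0').
exists k; have := hk k (leqnn k); rewrite sub0r normrN ger0_norm ?exprn_ge0 ?invr_ge0//.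
by rewrite -ltcR eR rmorphXn /= fmorphV /= rmorph_nat.
Qed.

Lemma normr_small (V : normedModType C) (x : V) :
  (forall e : C, 0 < e -> `|x| <= e) -> x = 0.
Proof.
move=> xe; apply/eqP; rewrite -normr_eq0; apply: contraT => x0.
have xp : 0 < `|x| by rewrite lt_def x0 normr_ge0.
have := xe (2^-1 * `|x|); rewrite pmulr_rgt0 ?invr_gt0// => /(_ xp).
by rewrite -ler_pdivrMr// divff// lt_geF// invf_lt1// ltr1n.
Qed.

(** The element 1 - c is the square root of 1 - a^* a in the unitization. It is
    obtained without spectral theory, as the fixed point of c |-> (h + c^2) / 2
    with h = a^* a: for |h| <= 1/4 this map preserves the ball of radius 1/2 and
    contracts distances there by the factor 1/2. *)
Lemma quasi_sqrt (a : A) : `|a| <= 2^-1 ->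
  exists2 c : A, star c = c & star a ** a = c + c - c ** c.
Proof.
move=> a2; set h := star a ** a.
have h2 : `|h| <= 2^-1 ^+ 2 by rewrite norm_cstar lerXn2r ?nnegrE ?invr_ge0.
have hs : star h = h by rewrite starM starK.
pose F (c : A) : A := 2^-1 *: (h + c ** c).
pose u k := iter k F 0.
have half0 : (0 : C) <= 2^-1 by rewrite invr_ge0.
have halfn : `|2^-1 : C| = 2^-1 by rewrite ger0_norm.
have half2 : (2^-1 : C) + 2^-1 = 1 by rewrite [RHS]splitr mul1r.
have us k : star (u k) = u k.
  elim: k => [|k IH]; first by rewrite /u /= -(scale0r 0) starZ rmorph0 !scale0r.
  by rewrite /u /= starZ starD starM -/(u k) IH hs conj_Creal// realV realn.
have half_le1 : (2^-1 : C) <= 1 by rewrite invf_le1// ler1n.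
have u2 k : `|u k| <= 2^-1.
  elim: k => [|k IH]; first by rewrite normr0.
  rewrite /u /= normrZ halfn -[leRHS]mulr1 ler_wpM2l// -/(u k).
  rewrite (le_trans (ler_normD _ _))// -half2 lerD//.
    by rewrite (le_trans h2)// expr2 -[leRHS]mulr1 ler_wpM2l.
  rewrite (le_trans (normM_le _ _))// -[leRHS]mulr1 ler_pM//.
  exact: le_trans (IH) _.
have sqB (c d : A) : c ** c - d ** d = (c - d) ** c + d ** (c - d).
  by rewrite amulDl amulDr amulNl amulNr addrA subrK.
have FB (c d : A) : `|c| <= 2^-1 -> `|d| <= 2^-1 -> `|F c - F d| <= 2^-1 * `|c - d|.
  move=> c2 d2; rewrite /F -scalerBr opprD addrACA subrr add0r normrZ halfn ler_wpM2l//.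
  rewrite sqB (le_trans (ler_normD _ _))// -[leRHS]mul1r -half2 mulrDl lerD//.
    by rewrite (le_trans (normM_le _ _))// mulrC ler_wpM2r.
  by rewrite (le_trans (normM_le _ _))// ler_wpM2r.
have uB k m : `|u (k + m)%N - u k| <= 2^-1 ^+ k.
  elim: k m => [|k IH] m.
    by rewrite expr0 /u /= subr0 add0n (le_trans (u2 m)).
  rewrite addSn exprS; apply: (le_trans (FB _ _ (u2 _) (u2 _))).
  by rewrite ler_wpM2l// IH.
have : cvg (u @ \oo).
  apply: cauchy_cvg; apply/cauchyP => e e0.
  have [k ke] := small_geometric e0; exists (u k).
  exists k => // m /= km; rewrite -ball_normE /= distrC -(subnKC km).
  exact: le_lt_trans (uB _ _) ke.
move=> /cvg_ex[c /cvgrPdist_lt uc].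
have uc2 e : 0 < e -> exists k, `|c - u k| < e /\ `|c - u k.+1| < e.
  move=> /uc[k _ h1]; exists k; split; apply: h1 => //=.
exists c.
  apply/eqP; rewrite -subr_eq0; apply/eqP/normr_small => e e0.
  have e2 : 0 < 2^-1 * e by rewrite mulr_gt0// invr_gt0.
  have [k [ck _]] := uc2 _ e2.
  rewrite -(subrK (u k) c) starD us opprD addrACA subrr addr0.
  rewrite (le_trans (ler_normB _ _))// norm_star -[leRHS]mul1r -half2 mulrDl.
  by rewrite lerD// ltW.
have c1 : `|c| <= 1.
  have [|k [ck _]] := uc2 2^-1; first by rewrite invr_gt0.
  by rewrite -(subrK (u k) c) (le_trans (ler_normD _ _))// -half2 lerD// ltW.
apply/eqP; rewrite -subr_eq0; apply/eqP/normr_small => e e0.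
have e2 : 0 < 2^-1 ^+ 2 * e by rewrite mulr_gt0// exprn_gt0// invr_gt0.
have [k [ck /ltW ck1]] := uc2 _ e2.
have hE : h = u k.+1 + u k.+1 - u k ** u k.
  by rewrite {1 2}/u /= -/(u k) -scalerDl half2 scale1r addrK.
have -> : h - (c + c - c ** c) =
    (c ** c - u k ** u k) - ((c - u k.+1) + (c - u k.+1)).
  rewrite hE [(c - _) + _]addrACA -opprD !opprB addrACA [RHS]addrACA.
  by rewrite (addrC (c ** c)).
have ee (x y : A) : `|x| <= 2^-1 * e -> `|y| <= 2^-1 * e -> `|x - y| <= e.
  move=> xe ye; rewrite (le_trans (ler_normB _ _))// -[leRHS]mul1r -half2 mulrDl.
  exact: lerD.
have half_e : 2^-1 ^+ 2 * e + 2^-1 ^+ 2 * e = 2^-1 * e.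
  by rewrite -mulrDl expr2 -mulrDl half2 mul1r.
apply: ee.
  rewrite sqB (le_trans (ler_normD _ _))// -half_e lerD// (le_trans (normM_le _ _))//.
    by rewrite -[leRHS]mulr1 ler_pM// ltW.
  have uk1 := le_trans (u2 k) half_le1.
  by rewrite -[leRHS]mul1r ler_pM// ltW.
by rewrite (le_trans (ler_normD _ _))// -half_e lerD.
Qed.
End SquareRoot.

(** * Star-algebras and their homomorphisms *)

Section StarAlgebraFacts.
Variables (K : numClosedFieldType) (A B : starAlgType K).

Lemma amul0r (a : A) : 0 ** a = 0.
Proof. by rewrite -[X in X ** a](scale0r 0) amulZl scale0r. Qed.

Lemma amulr0 (a : A) : a ** 0 = 0.
Proof. by rewrite -[X in a ** X](scale0r 0) amulZr scale0r. Qed.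

Lemma star0 : star (0 : A) = 0.
Proof. by rewrite -[X in star X](scale0r 0) starZ rmorph0 scale0r. Qed.

Lemma amul_sumr I (r : seq I) (P : pred I) (F : I -> A) a :
  a ** (\sum_(i <- r | P i) F i) = \sum_(i <- r | P i) a ** F i.
Proof. by apply: (big_morph (amul a)); [exact: amulDr | exact: amulr0]. Qed.

Lemma amul_suml I (r : seq I) (P : pred I) (F : I -> A) a :
  (\sum_(i <- r | P i) F i) ** a = \sum_(i <- r | P i) F i ** a.
Proof.
by apply: (big_morph (amul^~ a)) => [x y|]; [exact: amulDl | exact: amul0r].
Qed.

Lemma star_sum I (r : seq I) (P : pred I) (F : I -> A) :
  star (\sum_(i <- r | P i) F i) = \sum_(i <- r | P i) star (F i).
Proof. by apply: big_morph; [exact: starD | exact: star0]. Qed.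

Variables (f : A -> B) (fH : is_starhom f).

Lemma starhomD x y : f (x + y) = f x + f y.
Proof. by have [fL _ _] := fH; have := fL 1 x y; rewrite !scale1r. Qed.

Lemma starhom0 : f 0 = 0.
Proof. by apply: (addIr (f 0)); rewrite -starhomD !add0r. Qed.

Lemma starhomZ k x : f (k *: x) = k *: f x.
Proof. by have [fL _ _] := fH; have := fL k x 0; rewrite starhom0 !addr0. Qed.

Lemma starhomN x : f (- x) = - f x.
Proof. by rewrite -scaleN1r starhomZ scaleN1r. Qed.

Lemma starhomB x y : f (x - y) = f x - f y.
Proof. by rewrite starhomD starhomN. Qed.

Lemma starhomM x y : f (x ** y) = f x ** f y.
Proof. by have [_ ->] := fH. Qed.

Lemma starhomS x : f (star x) = star (f x).
Proof. by have [_ _ ->] := fH. Qed.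

Lemma starhom_sum I (r : seq I) (P : pred I) (F : I -> A) :
  f (\sum_(i <- r | P i) F i) = \sum_(i <- r | P i) f (F i).
Proof. by apply: big_morph; [exact: starhomD | exact: starhom0]. Qed.

Lemma starhom_projection x : is_projection x -> is_projection (f x).
Proof. by move=> [xs xi]; split; rewrite -?starhomS -?starhomM ?xs ?xi. Qed.

End StarAlgebraFacts.

(** * Lifting from the corona of matrix algebras *)

Section Corona.
Variables (R : realType).
Local Notation C := R[i].
Local Notation M n := (cmatrix R n).
Local Notation Pr := (cprod (fun n => cmatrix R n.+1)).
Local Notation Q := (corona (fun n => cmatrix R n.+1)).
Local Notation pi := (@toCorona C (fun n => cmatrix R n.+1)).
Local Notation piH := (@toCorona_starhom C (fun n => cmatrix R n.+1)).
Implicit Types (x y P S : Pr) (q : Q).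

Lemma cprodB_n x y n : (x - y) n = x n - y n. Proof. by []. Qed.
Lemma cprodM_n x y n : (x ** y) n = x n ** y n. Proof. by []. Qed.
Lemma cprodS_n x n : (star x) n = star (x n). Proof. by []. Qed.
Lemma cprod_sum_n I (r : seq I) (p : pred I) (F : I -> Pr) n :
  (\sum_(i <- r | p i) F i) n = \sum_(i <- r | p i) F i n.
Proof. by apply: (big_morph (fun x : Pr => x n)). Qed.

Lemma cprod_projection_n P n : is_projection P -> is_projection (P n).
Proof. by move=> [Ps Pi]; split; rewrite -?cprodS_n -?cprodM_n ?Ps ?Pi. Qed.

Lemma toCorona_norm x y : pi x = pi y <->
  forall e : C, 0 < e -> \forall n \near \oo, `|x n - y n| < e.
Proof.
split=> [/toCoronaP/csumP xy e e0|xy]; first exact: xy.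
by apply/toCoronaP/csumP => e e0; exact: xy.
Qed.

(** Equality in the corona is insensitive to finitely many terms, so a relation
    need only hold eventually. *)
Lemma toCorona_near x y : (\forall n \near \oo, x n = y n) -> pi x = pi y.
Proof.
move=> xy; apply/toCorona_norm => e e0; apply: filterS xy => n ->.
by rewrite subrr normr0.
Qed.

(** Projections have norm 0 or 1, so a null sequence of them is eventually
    zero. *)
Lemma projection_near0 P : (\forall n \near \oo, is_projection (P n)) -> pi P = 0 ->
  \forall n \near \oo, P n = 0.
Proof.
move=> Pp; rewrite -(starhom0 piH) => /toCorona_norm/(_ 1 ltr01).
apply: filterS2 Pp => n Pn; rewrite subr0.
by have [//|->] := norm_projection Pn; rewrite ltxx.
Qed.

(** Projections lift by functional calculus. Orthogonality is achieved by
    lifting them one at a time: a selfadjoint lift of the next one is first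
    compressed by 1 - F, where F is the sum of the projections already lifted,
    and functional calculus stays in that corner. *)
Lemma lift_projections (V : eqType) (vs : seq V) (q : V -> Q) : uniq vs ->
  (forall v, is_projection (q v)) -> (forall v w, v != w -> q v ** q w = 0) ->
  exists P : V -> Pr, [/\ forall v, v \in vs -> pi (P v) = q v,
    forall v, v \in vs -> is_projection (P v) &
    forall v w, v \in vs -> w \in vs -> v != w -> P v ** P w = 0].
Proof.
move=> uvs qp q0; elim: vs uvs => [|v vs IH /= /andP[vvs uvs]]; first by exists (fun=> 0).
have [P [Pq Pp P0]] := IH uvs.
pose F : Pr := \sum_(w <- vs) P w.
have PF w : w \in vs -> P w ** F = P w.
  move=> wvs; rewrite amul_sumr (bigD1_seq w)//= (Pp w wvs).2 big1_seq ?addr0// => u.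
  by move=> /andP[uw uin]; rewrite P0// eq_sym.
have Fs : star F = F.
  by rewrite star_sum; apply: eq_big_seq => w /Pp[].
have [x qx] := toCorona_surj (q v).
pose h0 : Pr := (2^-1 : C) *: (x + star x).
have h0s : star h0 = h0.
  by rewrite starZ starD starK conj_Creal ?realV ?realn// addrC.
have qh0 : pi h0 = q v.
  rewrite (starhomZ piH) (starhomD piH) (starhomS piH) -qx (qp v).1 scalerDr -scalerDl.
  by rewrite -[_ + _]mul1r mulrDr !mul1r -{1 2}[2^-1]mul1r -splitr scale1r.
(* This is (1 - F) h0 (1 - F). *)
pose h : Pr := h0 - F ** h0 - (h0 - F ** h0) ** F.
have hs : star h = h.
  rewrite /h !starD !starN !starM !starD !starN !starM Fs h0s.
  rewrite amulDl amulDr !amulNl !amulNr amulA !opprD !opprK !addrA; congr (_ + _).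
  by rewrite addrAC.
have Ph w : w \in vs -> P w ** h = 0.
  move=> wvs; rewrite /h !amulDr !amulNr !amulA !amulDr !amulNr !amulA PF// subrr.
  by rewrite amul0r subr0.
have qF : pi F ** q v = 0.
  rewrite (starhom_sum piH) amul_suml big1_seq// => w /andP[_ wvs].
  by rewrite Pq// q0//; apply: contraNneq vvs => <-.
have qF' : q v ** pi F = 0.
  by rewrite -[LHS]starK starM (qp v).1 -(starhomS piH F) Fs qF star0.
have qh : pi h = q v.
  rewrite /h !(starhomB piH, starhomM piH) qh0 qF !subr0.
  by rewrite qF' subr0.
have hn n := projection_near (congr1 (fun y : Pr => y n) hs : star (h n) = h n).
pose T n : M n.+1 := projT1 (cid (hn n)).
have Tn n : exists g : M n.+1, [/\ star (T n) = T n, T n ** T n = T n,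
     T n = h n ** g, T n = g ** h n & `|T n - h n| <= 2 * `|h n ** h n - h n| ].
  exact: projT2 (cid (hn n)).
have Tb : exists B : C, forall n, `|T n| <= B.
  exists 1 => n; have [g [Ts Ti _ _ _]] := Tn n.
  by have [->|->//] := norm_projection (conj Ts Ti); rewrite normr0.
pose T' : Pr := CProd Tb.
have T'p : is_projection T'.
  by split; apply: cprodP => n; have [g []] := Tn n.
have T'q : pi T' = q v.
  rewrite -qh; apply/toCoronaP; apply: (@csum_dom _ _ (h ** h - h) _ 2); last first.
    by move=> n; have [g []] := Tn n.
  by apply/toCoronaP; rewrite (starhomM piH) qh (qp v).2.
have PT w : w \in vs -> P w ** T' = 0.
  move=> wvs; apply: cprodP => n; have [g [_ _ Tg _ _]] := Tn n.
  rewrite cprodM_n /= Tg amulA -cprodM_n Ph//.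
  exact: amul0r.
have TP w : w \in vs -> T' ** P w = 0.
  by move=> wvs; rewrite -[LHS]starK starM T'p.1 (Pp w wvs).1 PT// star0.
exists (fun w => if w == v then T' else P w); split=> [w|w|w u].
- by rewrite inE; have [->|_ /= /Pq] := eqVneq w v.
- by rewrite inE; have [->|_ /= /Pp] := eqVneq w v.
- rewrite !inE; have [->|wv] := eqVneq w v; have [->|uv] := eqVneq u v => //=.
  + by move=> _ uin _; exact: TP.
  + by move=> win _ _; exact: PT.
  + exact: P0.
Qed.

(** The lift is a right multiple of [y] term by term, so it satisfies the same
    left annihilation and range relations. *)
Lemma lift_isometry y P : is_projection P -> y ** P = y ->
  pi (star y ** y) = pi P ->
  exists S, [/\ pi S = pi y, \forall n \near \oo, star (S n) ** S n = P n &
    forall n, exists g, S n = y n ** g].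
Proof.
move=> Pp yP yy.
have yn n : exists g : M n.+1, `|y n ** g| <= 1 /\
    (`|star (y n) ** y n - P n| <= 2^-1 -> star (y n ** g) ** (y n ** g) = P n /\
     `|y n ** g - y n| <= `|y n| * `|star (y n) ** y n - P n|).
  case: (boolP (`|star (y n) ** y n - P n| <= 2^-1)) => [le|_]; last first.
    by exists 0; rewrite amulr0 normr0 ler01.
  have [Ps Pi] := cprod_projection_n n Pp.
  have ynP : y n ** P n = y n by rewrite -cprodM_n yP.
  have [g [SP Sy]] := partial_isometry_near Ps Pi ynP le.
  exists g; split=> //.
  rewrite -(@ler_pXn2r _ 2) ?nnegrE// -norm_cstar expr1n.
  rewrite [X in `|X|](SP : star (y n ** g) ** (y n ** g) = P n).
  by have [->|->//] := norm_projection (conj Ps Pi); rewrite normr0.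
(* Where the norm condition fails, g = 0; this happens for finitely many n
   only. *)
pose g n : M n.+1 := projT1 (cid (yn n)).
have gn n : `|y n ** g n| <= 1 /\
    (`|star (y n) ** y n - P n| <= 2^-1 -> star (y n ** g n) ** (y n ** g n) = P n /\
     `|y n ** g n - y n| <= `|y n| * `|star (y n) ** y n - P n|).
  exact: projT2 (cid (yn n)).
have Sb : exists B : C, forall n, `|y n ** g n| <= B.
  by exists 1 => n; have [] := gn n.
pose S : Pr := CProd Sb.
have /csumP D0 := proj2 (toCoronaP _ _) yy.
have half0 : 0 < 2^-1 :> C by rewrite invr_gt0.
exists S; split; last by move=> n; exists (g n).
- apply/toCorona_norm => e e0; have [B yB] := cseq_bounded y.
  have B1 : 0 < `|B| + 1 by rewrite ltr_wpDl.
  apply: filterS2 (D0 _ half0) (D0 (e / (`|B| + 1)) (divr_gt0 e0 B1)) => n Dn2 DnB.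
  have [_ /(_ (ltW Dn2))[_ Sy]] := gn n.
  apply: (le_lt_trans Sy); rewrite ltr_pdivlMr// in DnB; apply: le_lt_trans DnB.
  rewrite mulrC ler_wpM2l// (le_trans (yB n))//.
  have B0 : 0 <= B by rewrite (le_trans _ (yB n)).
  by rewrite ger0_norm// lerDl.
- apply: filterS (D0 _ half0) => n Dn2.
  by have [_ /(_ (ltW Dn2))[]] := gn n.
Qed.

(** The corona inherits finiteness from the matrix algebras, because an isometry
    of a projection into itself lifts to exact isometries of matrices. *)
Lemma corona_finite (q W : Q) : is_projection q -> star W ** W = q ->
  q ** W = W -> W ** q = W -> W ** star W = q.
Proof.
move=> qp WW qW Wq.
have [P [Pq Pp _]] : exists P : unit -> Pr, [/\ forall v, v \in [:: tt] -> pi (P v) = q,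
    forall v, v \in [:: tt] -> is_projection (P v) &
    forall v w, v \in [:: tt] -> w \in [:: tt] -> v != w -> P v ** P w = 0].
  by apply: (lift_projections (q := fun=> q)) => // -[] [].
move: (P tt) (Pq tt (mem_head _ _)) (Pp tt (mem_head _ _)) => {Pq Pp}P Pq Pp.
have [x Wx] := toCorona_surj W.
pose y : Pr := P ** x ** P.
have yW : pi y = W by rewrite !(starhomM piH) Pq -Wx qW Wq.
have yP : y ** P = y by rewrite /y -amulA Pp.2.
have Py : P ** y = y by rewrite /y !amulA Pp.2.
have [|S [Sy SS Sg]] := lift_isometry Pp yP.
  by rewrite (starhomM piH) (starhomS piH) yW WW Pq.
rewrite -yW -Sy -Pq -(starhomS piH) -(starhomM piH); apply: toCorona_near.
apply: filterS SS => n SSn; apply: isometry_unitary SSn _.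
  exact: cprod_projection_n.
by have [g ->] := Sg n; rewrite amulA -cprodM_n Py.
Qed.

(** Matrices satisfy |x|^2 <= |x x^* + d^* d|, and the right-hand side tends to
    0. *)
Lemma corona_definite (x d : Q) : x ** star x + star d ** d = 0 -> x = 0.
Proof.
have [X ->] := toCorona_surj x; have [D ->] := toCorona_surj d.
rewrite -!(starhomS piH) -!(starhomM piH) -(starhomD piH) -(starhom0 piH).
move=> /toCorona_norm XD0; apply/toCorona_norm => e e0.
apply: filterS (XD0 _ (exprn_gt0 2 e0)) => n; rewrite !subr0 => XDn.
have e0' := ltW e0; rewrite -(@ltr_pXn2r _ 2) ?nnegrE//; apply: le_lt_trans XDn.
have := opnorm_sum_squares (star (X n)) (D n); rewrite norm_star starK.
exact.
Qed.

(** For |a| <= 1/2 the image under f of the identity of [quasi_sqrt] bounds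
    |f a| by 1. *)
Lemma starhom_matrix_bound (A : cstarAlgType C) n (f : A -> M n) (a : A) :
  is_starhom f -> `|f a| <= 2 * `|a|.
Proof.
move=> fH; have bound b : `|b| <= 2^-1 -> `|f b| <= 1.
  move=> /quasi_sqrt[c cs cE].
  rewrite -(@ler_pXn2r _ 2) ?nnegrE// expr1n -[leRHS]addr0 -(normr0 (M n)).
  apply: (@opnorm_quasi_sqrt _ _ _ (f c)); first by rewrite -(starhomS fH) cs.
  by rewrite addr0 -(starhomS fH) -!(starhomM fH) cE (starhomB fH) (starhomD fH).
have [->|a0] := eqVneq a 0; first by rewrite (starhom0 fH) !normr0 mulr0.
have an : 0 < 2 * `|a| by rewrite mulr_gt0// normr_gt0.
have := bound ((2 * `|a|)^-1 *: a); rewrite (starhomZ fH) !normrZ !gtr0_norm ?invr_gt0//.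
rewrite invfM -mulrA mulVf ?normr_eq0// mulr1 lexx => /(_ isT).
by rewrite -invfM mulrC ler_pdivrMr// mul1r.
Qed.

(** The same argument, except that the identity of [quasi_sqrt] holds up to an
    error that is eventually less than 1. *)
Lemma starhom_corona_bound (A : cstarAlgType C) (f : A -> Q) (a : A) x (d : C) :
  is_starhom f -> f a = pi x -> 0 < d -> `|a| <= d ->
  \forall n \near \oo, `|x n| <= 4 * d.
Proof.
move=> fH fa d0 ad.
have bound b y : `|b| <= 2^-1 -> f b = pi y -> \forall n \near \oo, `|y n| <= 2.
  move=> /quasi_sqrt[c cs cE] fb; have [z fc] := toCorona_surj (f c).
  pose z' : Pr := 2^-1 *: (z + star z).
  have fz' : pi z' = f c.
    rewrite (starhomZ piH) (starhomD piH) (starhomS piH) -fc -(starhomS fH) cs.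
    by rewrite scalerDr -scalerDl -{1 2}[2^-1]mul1r -splitr scale1r.
  have z's : star z' = z'.
    by rewrite starZ starD starK conj_Creal ?realV ?realn// addrC.
  (* The selfadjoint part z' of a lift of f c is again a lift of it. *)
  have /toCorona_norm/(_ 1 ltr01) : pi (star y ** y) = pi (z' + z' - z' ** z').
    rewrite (starhomB piH) (starhomD piH) !(starhomM piH) (starhomS piH) -fb fz'.
    by rewrite -(starhomS fH) -!(starhomM fH) cE (starhomB fH) (starhomD fH).
  apply: filterS => n /ltW yn.
  have zn : star (z' n) = z' n by rewrite -cprodS_n z's.
  rewrite -(@ler_pXn2r _ 2) ?nnegrE//.
  apply: (le_trans (opnorm_quasi_sqrt zn (esym (subrKC _ _)))).
  rewrite (le_trans (lerD (lexx 1) yn))// -natrX -[1 + 1]/(2%:R) ler_nat.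
  done.
have := bound ((2 * d)^-1 *: a) ((2 * d)^-1 *: x).
rewrite (starhomZ fH) (starhomZ piH) -fa normrZ gtr0_norm ?invr_gt0 ?mulr_gt0//.
rewrite mulrC ler_pdivrMr ?mulr_gt0// mulKf// => /(_ ad erefl).
apply: filterS => n; rewrite [X in `|X|](_ : _ = (2 * d)^-1 *: x n)// normrZ.
rewrite gtr0_norm ?invr_gt0 ?mulr_gt0// mulrC ler_pdivrMr ?mulr_gt0// mulrA.
by rewrite -natrM.
Qed.
End Corona.

(** * The corona as a C*-algebra *)

(** Take for kappa n the largest k <= n with P k n. *)
Lemma diagonal_sequence (P : nat -> nat -> bool) : (forall n, P 0%N n) ->
  (forall k, \forall n \near \oo, P k n) ->
  exists kappa : nat -> nat, (forall n, P (kappa n) n) /\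
    forall k, \forall n \near \oo, (k <= kappa n)%N.
Proof.
move=> P0 Pk.
have ex n : exists k, (k <= n)%N && P k n by exists 0%N; rewrite P0.
have ub n k : (k <= n)%N && P k n -> (k <= n)%N by case/andP.
exists (fun n => ex_maxn (ex n) (ub n)); split.
  by move=> n; case: ex_maxnP => k /andP[].
move=> k; apply: filterS2 (Pk k) (nbhs_infty_ge k) => n Pkn kn.
by case: ex_maxnP => m _; apply; rewrite kn.
Qed.

Section CoronaNorm.
Variables (R : realType) (B : nat -> cstarAlgType R[i]).
Local Notation C := R[i].
Implicit Types (x y : cprod B) (M : R).

Definition eventual_bound x : set R :=
  [set M | 0 <= M /\ \forall n \near \oo, `|x n| <= M%:C%C].

(** This infimum is the limit superior of the norms |x n|, which is the quotient
    norm of the class of [x]. *)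
Definition cnorm x : R := inf (eventual_bound x).

Lemma eventual_bound_has_inf x : has_inf (eventual_bound x).
Proof.
split; last by exists 0 => M [].
have [K xK] := cseq_bounded x.
have K0 : 0 <= K by rewrite (le_trans _ (xK 0%N)).
have KE : (complex.Re K)%:C%C = K by rewrite RRe_real ?ger0_real.
exists (complex.Re K); split; first by rewrite -lecR KE.
by near=> n; rewrite KE.
Unshelve. all: by end_near. Qed.

Lemma cnorm_ge0 x : 0 <= cnorm x.
Proof.
by apply: lb_le_inf => [|M []//]; have [] := eventual_bound_has_inf x.
Qed.

Lemma cnorm_le x M : 0 <= M -> (\forall n \near \oo, `|x n| <= M%:C%C) -> cnorm x <= M.
Proof.
by move=> M0 xM; apply: ge_inf; [exact: (eventual_bound_has_inf x).2 | split].
Qed.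

Lemma cnorm_lt x M : cnorm x < M -> \forall n \near \oo, `|x n| <= M%:C%C.
Proof.
move=> xM; have [N [N0 xN] NM] := inf_lt (eventual_bound_has_inf x).1 xM.
by apply: filterS xN => n /le_trans; apply; rewrite lecR ltW.
Qed.

Lemma cnorm_bound x e : 0 < e -> \forall n \near \oo, `|x n| <= (cnorm x + e)%:C%C.
Proof. by move=> e0; apply: cnorm_lt; rewrite ltrDl. Qed.

Lemma cnorm_csum x y : x - y \in @csum C B -> cnorm x <= cnorm y.
Proof.
move=> /csumP xy; apply/ler_addgt0Pr => e e0.
have e2 : 0 < e / 2 by rewrite divr_gt0.
have e2C : 0 < (e / 2)%:C%C :> C by rewrite ltcR.
apply: cnorm_le; first by rewrite addr_ge0 ?cnorm_ge0// ltW.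
apply: filterS2 (cnorm_bound y e2) (xy _ e2C) => n yn xyn.
rewrite -(subrK (y n) (x n)) (le_trans (ler_normD _ _))// addrC (splitr e) addrA.
by rewrite [leRHS]rmorphD lerD// ltW.
Qed.

Lemma cnormD x y : cnorm (x + y) <= cnorm x + cnorm y.
Proof.
apply/ler_addgt0Pr => e e0; have e2 : 0 < e / 2 by rewrite divr_gt0.
apply: cnorm_le; first by rewrite !addr_ge0 ?cnorm_ge0// ltW.
apply: filterS2 (cnorm_bound x e2) (cnorm_bound y e2) => n xn yn.
by rewrite (le_trans (ler_normD _ _))// (splitr e) addrACA [leRHS]rmorphD lerD.
Qed.

Lemma cnormZ (k : C) x : (cnorm (k *: x))%:C%C = `|k| * (cnorm x)%:C%C.
Proof.
have le (l : C) z : (cnorm (l *: z))%:C%C <= `|l| * (cnorm z)%:C%C.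
  have [->|l0] := eqVneq l 0.
    rewrite normr0 mul0r lecR; apply: cnorm_le => //.
    by near=> n; rewrite [X in `|X|](scale0r (z n)) normr0.
  have lE : (complex.Re `|l|)%:C%C = `|l| by rewrite RRe_real ?ger0_real.
  have l1 : 0 < complex.Re `|l| by rewrite -ltcR lE normr_gt0.
  rewrite -lE -rmorphM lecR; apply/ler_addgt0Pr => e e0.
  have e1 : 0 < e / complex.Re `|l| by rewrite divr_gt0.
  apply: cnorm_le; first by rewrite addr_ge0 ?mulr_ge0 ?cnorm_ge0// ltW.
  apply: filterS (cnorm_bound z e1) => n zn.
  rewrite [X in `|X|](_ : _ = l *: z n)// normrZ -{1}lE.
  apply: (le_trans (ler_wpM2l _ zn)); first by rewrite lecR ltW.
  by rewrite -rmorphM mulrDr mulrCA divff ?mulr1// gt_eqF.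
apply/eqP; rewrite eq_le le /=; have [->|k0] := eqVneq k 0.
  by rewrite normr0 mul0r lecR cnorm_ge0.
have := le k^-1 (k *: x); rewrite scalerA mulVf // scale1r => leA.
apply: (le_trans (ler_wpM2l (normr_ge0 k) leA)).
by rewrite mulrA -normrM (mulfV k0) normr1 mul1r.
Unshelve. all: by end_near. Qed.

Lemma cnorm_eq0 x : cnorm x = 0 -> x \in @csum C B.
Proof.
move=> x0; apply/csumP => e e0.
have eE : (complex.Re e)%:C%C = e by rewrite RRe_real ?gtr0_real.
have e1 : 0 < complex.Re e / 2 by rewrite divr_gt0// -ltcR eE.
apply: filterS (cnorm_bound x e1) => n /le_lt_trans; apply.
by rewrite x0 add0r -[ltRHS]eE ltcR ltr_pdivrMr// ltr_pMr ?ltr1n// -ltcR eE.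
Qed.

Lemma cnormM x y : cnorm (x ** y) <= cnorm x * cnorm y.
Proof.
apply/ler_addgt0Pr => e e0.
have s0 : 0 < cnorm x + cnorm y + 1 by rewrite ltr_wpDl ?addr_ge0 ?cnorm_ge0.
pose d := Num.min 1 (e / (cnorm x + cnorm y + 1)).
have d0 : 0 < d by rewrite lt_min ltr01 divr_gt0.
apply: (@le_trans _ _ ((cnorm x + d) * (cnorm y + d))).
  apply: cnorm_le; first by rewrite mulr_ge0// addr_ge0 ?cnorm_ge0// ltW.
  apply: filterS2 (cnorm_bound x d0) (cnorm_bound y d0) => n xn yn.
  by rewrite (le_trans (normM_le _ _))// rmorphM ler_pM.
rewrite mulrDl !mulrDr -addrA lerD2l addrA (mulrC d) -mulrDl -mulrDl.
rewrite (@le_trans _ _ ((cnorm x + cnorm y + 1) * d))//.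
  by rewrite ler_pM2r// lerD2l ge_min lexx.
by rewrite mulrC -ler_pdivlMr// ge_min lexx orbT.
Qed.

Lemma cnorm_star x : cnorm (star x) = cnorm x.
Proof.
have le z : cnorm (star z) <= cnorm z.
  apply/ler_addgt0Pr => e e0; apply: cnorm_le.
    by rewrite addr_ge0 ?cnorm_ge0// ltW.
  apply: filterS (cnorm_bound z e0) => n zn.
  by rewrite [X in `|X|](_ : _ = star (z n))// norm_star.
by apply/eqP; rewrite eq_le le /= -{1}[x]starK le.
Qed.

(** The C*-identity holds term by term. *)
Lemma cnorm_cstar x : cnorm (star x ** x) = cnorm x ^+ 2.
Proof.
apply/eqP; rewrite eq_le; apply/andP; split.
  by rewrite (le_trans (cnormM _ _))// cnorm_star.
apply/ler_addgt0Pr => e e0; set s := cnorm (star x ** x) + e.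
have s0 : 0 < s by rewrite ltr_wpDl ?cnorm_ge0.
suff: cnorm x <= Num.sqrt s.
  by rewrite -(@ler_pXn2r _ 2) ?nnegrE ?cnorm_ge0 ?sqrtr_ge0// sqr_sqrtr// ltW.
apply: cnorm_le; first exact: sqrtr_ge0.
apply: filterS (cnorm_bound (star x ** x) e0) => n.
rewrite [X in `|X|](_ : _ = star (x n) ** x n)// norm_cstar => xn.
rewrite -(@ler_pXn2r _ 2) ?nnegrE ?lecR ?sqrtr_ge0//.
by rewrite -rmorphXn sqr_sqrtr// ltW.
Qed.

(** A copy of the corona, to carry the quotient norm. *)
Definition ncorona : Type := corona B.
HB.instance Definition _ := GRing.Lmodule.copy ncorona (corona B).

Definition qnorm (q : ncorona) : C := (cnorm (repr (q : corona B)))%:C%C.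

Lemma qnormE x : qnorm (toCorona x) = (cnorm x)%:C%C.
Proof.
have e : toCorona (repr (toCorona x)) = toCorona x by rewrite /toCorona reprK.
congr (_%:C%C); apply/eqP; rewrite eq_le !cnorm_csum//; apply/toCoronaP => //.
Qed.

Let piH := @toCorona_starhom C B.

Lemma qnormD (q r : ncorona) : qnorm (q + r) <= qnorm q + qnorm r.
Proof.
have [x ->] := toCorona_surj q; have [y ->] := toCorona_surj r.
rewrite [X in qnorm X](_ : _ = toCorona (x + y)); last by rewrite (starhomD piH).
by rewrite !qnormE -rmorphD lecR cnormD.
Qed.

Lemma qnormZ (k : C) (q : ncorona) : qnorm (k *: q) = `|k| * qnorm q.
Proof.
have [x ->] := toCorona_surj q.
rewrite [X in qnorm X](_ : _ = toCorona (k *: x)); last by rewrite (starhomZ piH).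
by rewrite !qnormE cnormZ.
Qed.

Lemma qnorm_eq0 (q : ncorona) : qnorm q = 0 -> q = 0.
Proof.
have [x ->] := toCorona_surj q; rewrite qnormE => /complexI/cnorm_eq0 x0.
by rewrite -[RHS](starhom0 piH); apply/toCoronaP; rewrite subr0.
Qed.

HB.instance Definition _ := @Lmodule_isNormed.Build C ncorona
  qnorm qnormD qnormZ qnorm_eq0.

(** Choose [x k] with F concentrated within 2^-k of its class. Then x i and x j
    are eventually within 2 * 2^-i of each other for i <= j. The limit is the
    class of the diagonal sequence n |-> x (kappa n) n, where kappa tends to
    infinity so slowly that the first kappa n of these estimates hold at n. *)
Lemma ncorona_cvg (F : set_system ncorona) : ProperFilter F -> cauchy F -> cvg F.
Proof.
move=> FF /cauchyP cF.
pose e k : C := 2^-1 ^+ k.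
have e0 k : 0 < e k by rewrite exprn_gt0// invr_gt0.
have eE k : e k = ((2^-1 : R) ^+ k)%:C%C by rewrite rmorphXn fmorphV rmorph_nat.
have eE2 k : e k *+ 2 = ((2^-1 : R) ^+ k *+ 2)%:C%C by rewrite eE -rmorphMn.
have qk k : exists x : cprod B, F (ball (toCorona x : ncorona) (e k)).
  by have [q Fq] := cF _ (e0 k); have [x qx] := toCorona_surj q; exists x; rewrite -qx.
have [x Fx] := choice qk.
have e_le i j : (i <= j)%N -> e j <= e i.
  by move=> ij; rewrite ler_wiXn2l ?invr_ge0// invf_le1// ler1n.
pose Q z : ncorona := toCorona z.
have nE y z : `|Q y - Q z| = (cnorm (y - z))%:C%C.
  by rewrite -qnormE (starhomB piH).
have xij i j : (i <= j)%N -> \forall n \near \oo, `|x i n - x j n| <= e i *+ 2.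
  move=> ij; have [q [qi qj]] := filter_ex (filterI (Fx i) (Fx j)).
  have : `|Q (x i) - Q (x j)| < e i *+ 2.
    have -> : Q (x i) - Q (x j) = (Q (x i) - q) - (Q (x j) - q).
      by rewrite opprB addrA subrK.
    rewrite (le_lt_trans (ler_normB _ _))// mulr2n ltrD//.
    by move: qj; rewrite -ball_normE /= => /lt_le_trans; apply; exact: e_le.
  by rewrite nE eE2 ltcR => /cnorm_lt.
pose P k n := `[< forall i j, (i <= j <= k)%N -> `|x i n - x j n| <= e i *+ 2 >].
have [n|k|kappa [Pk kinf]] := @diagonal_sequence P.
- apply/asboolP => i j /andP[ij]; rewrite leqn0 => /eqP j0.
  by move: ij; rewrite j0 leqn0 => /eqP->; rewrite subrr normr0 mulrn_wge0// ltW.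
- have : \forall n \near \oo, forall i j : 'I_k.+1, (i <= j)%N -> `|x i n - x j n| <= e i *+ 2.
    apply: filter_forall => i; apply: filter_forall => j.
    have [ij|ij] := leqP i j; last by apply: nearW => n.
    by apply: filterS (xij _ _ ij) => n.
  apply: filterS => n h; apply/asboolP => i j /andP[ij jk].
  have ik : (i < k.+1)%N by rewrite ltnS (leq_trans ij).
  by have := h (Ordinal ik) (Ordinal (jk : j < k.+1)%N) ij.
have xk n j : (j <= kappa n)%N -> `|x j n - x (kappa n) n| <= e j *+ 2.
  by move=> jk; have /asboolP := Pk n; apply; rewrite jk leqnn.
have [M xM] := cseq_bounded (x 0%N).
have yb : exists M : C, forall n, `|x (kappa n) n| <= M.
  exists (M + e 0%N *+ 2) => n; rewrite -[X in `|X|](subrKC (x 0%N n)).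
  by rewrite (le_trans (ler_normD _ _))// lerD// distrC xk.
pose y : cprod B := CProd yb.
have qy j : `|Q y - Q (x j)| <= e j *+ 2.
  rewrite nE eE2 lecR; apply: cnorm_le; first by rewrite mulrn_wge0// exprn_ge0// invr_ge0.
  apply: filterS (kinf j) => n jn; rewrite -eE2.
  by rewrite [X in `|X|](_ : _ = x (kappa n) n - x j n)// distrC xk.
apply/cvg_ex; exists (Q y); apply/cvgrPdist_lt => d d0.
have [|j jd] := @small_geometric R (d / 3); first by rewrite divr_gt0.
apply: filterS (Fx j) => q; rewrite -ball_normE /= => qj.
rewrite -[X in `|X|](subrKA (Q (x j))) (le_lt_trans (ler_normD _ _))//.
rewrite (le_lt_trans (lerD (qy j) (ltW qj)))// -mulrSr -mulr_natr -ltr_pdivlMr//.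
Qed.

HB.instance Definition _ := Uniform_isComplete.Build ncorona ncorona_cvg.

HB.instance Definition _ := isStarAlgebra.Build C ncorona
  (@amulA C (corona B)) (@amulDl C (corona B)) (@amulDr C (corona B))
  (@amulZl C (corona B)) (@amulZr C (corona B)) (@starK C (corona B))
  (@starD C (corona B)) (@starZ C (corona B)) (@starM C (corona B)).

Lemma ncorona_normE x : `|toCorona x : ncorona| = (cnorm x)%:C%C.
Proof. exact: qnormE. Qed.

Lemma ncorona_normM (q r : ncorona) : `|q ** r| <= `|q| * `|r|.
Proof.
have [x ->] := toCorona_surj q; have [y ->] := toCorona_surj r.
rewrite [X in `|X|](_ : _ = toCorona (x ** y)); last by rewrite (starhomM piH).
by rewrite !ncorona_normE -rmorphM lecR cnormM.
Qed.

Lemma ncorona_cstar (q : ncorona) : `|star q ** q| = `|q| ^+ 2.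
Proof.
have [x ->] := toCorona_surj q.
rewrite [X in `|X|](_ : _ = toCorona (star x ** x)).
  by rewrite !ncorona_normE cnorm_cstar rmorphXn.
by rewrite (starhomM piH) (starhomS piH).
Qed.

HB.instance Definition _ := isCStarAlgebra.Build C ncorona ncorona_normM ncorona_cstar.

End CoronaNorm.

(** * Walks, cycles and the subgraph G' *)

Lemma not_uniq_split (T : Type) (T' : eqType) (f : T -> T') (s : seq T) :
  ~~ uniq (map f s) -> exists a x b y c, s = a ++ x :: b ++ y :: c /\ f x = f y.
Proof.
elim: s => [//|x s IH] /=; rewrite negb_and negbK => /orP[|/IH].
  have mapE : forall s' : seq T, f x \in map f s' ->
      exists b y c, s' = b ++ y :: c /\ f x = f y.
    elim=> [//|z s' IH'] /=; rewrite inE => /predU1P[fxz|/IH'[b [y [c [-> fxy]]]]].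
      by exists [::], z, s'.
    by exists (z :: b), y, c.
  by move=> /mapE[b [y [c [-> fxy]]]]; exists [::], x, b, y, c.
by move=> [a [z [b [y [c [-> fzy]]]]]]; exists (x :: a), z, b, y, c.
Qed.

Section Walks.
Variable G : digraph.
Local Notation V := (vertex G).
Local Notation E := (edge G).
Implicit Types (u v w : V) (e f g : E) (a b c d nu : seq E).

(** In contrast to [is_path], a walk may be empty and carries its endpoints;
    this is what concatenation of walks needs. *)
Fixpoint walk u nu v : bool :=
  if nu is e :: nu' then (src e == u) && walk (rng e) nu' v else u == v.

Lemma walk_cat u a b w : reflect (exists2 v, walk u a v & walk v b w) (walk u (a ++ b) w).
Proof.
elim: a u => [|e a IH] u /=.
  by apply: (iffP idP) => [bw|[v /eqP->]//]; exists u.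
apply: (iffP andP) => [[-> /IH[v av bw]]|[v /andP[-> av] bw]]; first by exists v.
by split=> //; apply/IH; exists v.
Qed.

Lemma walk_catI u a v b w : walk u a v -> walk v b w -> walk u (a ++ b) w.
Proof. by move=> ua vb; apply/walk_cat; exists v. Qed.

Lemma path_walk e nu : path (@follows G) e nu = walk (rng e) nu (rng (last e nu)).
Proof. by elim: nu e => [|f nu IH] e /=; rewrite ?eqxx// IH eq_sym. Qed.

Lemma cycle_walk e nu : cycle (@follows G) (e :: nu) = walk (src e) (e :: nu) (src e).
Proof.
rewrite /= eqxx /= rcons_path path_walk /=.
apply/andP/idP => [[h /eqP<-]//|h].
suff ve : rng (last e nu) = src e by split; rewrite /follows /= ve.
by move: h; elim: nu {1 3}e => [|f nu IH] g /=; [move/eqP | move/andP=> [_ /IH]].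
Qed.

Lemma walk_last u e nu v : walk u (e :: nu) v -> v = rng (last e nu).
Proof. by elim: nu u e => [|f nu IH] u e /= /andP[_]; [move/eqP | move=> /IH]. Qed.

Lemma walk_split u a e b v : walk u (a ++ e :: b) v -> walk u a (src e) /\ walk (rng e) b v.
Proof. by case/walk_cat => w aw /= /andP[/eqP-> bv]. Qed.

Lemma walk_rot u a e b : walk u (a ++ e :: b) u -> walk (src e) (e :: b ++ a) (src e).
Proof. by move/walk_split => [ua bu] /=; rewrite eqxx (walk_catI bu ua). Qed.

Lemma cycleP c : is_cycle c -> exists2 u, walk u c u & c <> [::].
Proof. by case: c => [[]//|e c [_]]; rewrite cycle_walk => h; exists (src e). Qed.

Lemma walk_cycle u c : walk u c u -> c <> [::] -> is_cycle c.
Proof.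
case: c => // e c h _; split=> //; rewrite cycle_walk.
have eu : src e = u by case/andP: h => /eqP.
by rewrite eu; exact: h.
Qed.

Lemma closed_walk_ends u c : walk u c u ->
  forall v, (v \in map (@src G) c) = (v \in map (@rng G) c).
Proof.
suff gen w : walk u c w -> u :: map (@rng G) c = rcons (map (@src G) c) w.
  move=> /gen e v; have : perm_eq (u :: map (@rng G) c) (u :: map (@src G) c).
    by rewrite e perm_rcons.
  by rewrite perm_cons => /perm_mem ->.
elim: c u => [|e c IH] u /=; first by move/eqP->.
by move=> /andP[/eqP<- /IH->].
Qed.

(** A cycle can be started at any of its vertices. *)
Lemma closed_walk_at u c v : walk u c u -> c <> [::] -> endpoints [set` c] v ->
  exists2 d, walk v d v & perm_eq d c.
Proof.
move=> uc c0 [e ec ve].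
have {ve ec}: v \in map (@src G) c.
  case: ve => ->; first by apply/mapP; exists e.
  by rewrite (closed_walk_ends uc); apply/mapP; exists e.
case/mapP => f fc ->; case/splitPr: fc uc c0 => a b uc _.
exists (f :: b ++ a); first exact: walk_rot uc.
by rewrite -cat_cons perm_catC.
Qed.

Lemma reached_fromP (S : set V) e :
  reached_from S e <-> exists u nu, S u /\ walk u nu (src e).
Proof.
split=> [[f [nu [[_ fnu] Sf le]]]|[u [nu [Su wnu]]]].
  move: fnu => /=; rewrite path_walk le.
  case/lastP: nu le => [/= <- _|nu g]; first by exists (src f), [::]; rewrite /= eqxx.
  rewrite last_rcons => <-; rewrite -cats1 => /walk_split[wf _].
  by exists (src f), (f :: nu); split=> //=; rewrite eqxx.
case: nu wnu => [/= /eqP ue|f nu wnu].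
  by exists e, [::]; split=> //; rewrite -ue.
exists f, (rcons nu e); rewrite last_rcons; split=> //.
  split=> //=; rewrite path_walk last_rcons -cats1.
  move: wnu => /= /andP[_ wnu]; apply: walk_catI wnu _; by rewrite /= !eqxx.
by move: wnu => /= /andP[/eqP->].
Qed.

(** A normal form of membership in G': the edges before [e] are dropped, and the
    cycle starts where the path ends. *)
Lemma Gprime_edgeP e : Gprime_edge e <-> exists nu v c,
  [/\ walk (src e) (e :: nu) v, walk v c v, c <> [::] &
      forall f, f \in e :: nu -> f \notin c].
Proof.
split=> [[nu [c [[_ pnu] cc [[nu' [g [gE gc]]] nuc] enu]]]|].
  have [u uc c0] := cycleP cc; have [d wd dc] := closed_walk_at uc c0 gc.
  case/splitPr: enu nuc pnu gE => a b nuc pnu gE.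
  exists b, (rng g), d; split=> //.
  - have eab : path (@follows G) e b.
      case: a {nuc gE} pnu => [//|f a] /=.
      by rewrite cat_path /= => /and3P[].
    have ->: g = last e b.
      have := congr1 (last e) gE; rewrite last_rcons last_cat /= => <-.
      by [].
    by rewrite /= eqxx -path_walk.
  - by move=> d0; move: dc c0; rewrite d0 perm_sym => /perm_nilP.
  - move=> x xin; rewrite (perm_mem dc); apply: nuc.
    by rewrite mem_cat xin orbT.
move=> [nu [v [c [wnu wc c0 nuc]]]]; exists (e :: nu), c; split.
- split=> //=; rewrite path_walk; move: (wnu) => /= /andP[_].
  by rewrite -(walk_last wnu).
- exact: walk_cycle wc c0.
- split=> //; exists (belast e nu), (last e nu); split; first exact: lastI.
  rewrite -(walk_last wnu).
  case: c c0 wc {nuc} => // f c _ /= /andP[/eqP fv _].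
  by exists f => /=; [rewrite inE eqxx | left].
- exact: mem_head.
Qed.

Lemma Gprime_step e : Gprime_edge e -> (exists2 f, Gprime_edge f & src f = rng e) \/
  exists c, [/\ walk (rng e) c (rng e), c <> [::] & e \notin c].
Proof.
move=> /Gprime_edgeP[nu [v [c [wnu wc c0 nuc]]]].
case: nu wnu nuc => [|f nu] wnu nuc.
  right; exists c; move: wnu => /= /andP[_ /eqP->]; split=> //.
  exact/nuc/mem_head.
left; exists f.
  apply/Gprime_edgeP; exists nu, v, c; split=> //.
    by move: wnu => /= /and3P[_ /eqP-> ->]; rewrite eqxx.
  by move=> x xin; apply: nuc; rewrite inE xin orbT.
by move: wnu => /= /and3P[_ /eqP->].
Qed.

(** Cut the walk at the first vertex of the cycle: an edge of the cycle starts
    at a vertex of the cycle, so no edge travelled before belongs to it. *)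
Lemma walk_first_hit u nu v d : walk u nu v -> walk v d v -> d <> [::] ->
  exists nu' v' d', [/\ walk u nu' v', walk v' d' v', d' <> [::], d' =i d &
    forall f, f \in nu' -> f \notin d].
Proof.
move=> unu vd d0; elim: nu u unu => [|e nu IH] u /=.
  by move=> /eqP uv; exists [::], v, d; split=> //; rewrite uv /=.
case/andP=> /eqP eu enu; have [ed|ed] := boolP (e \in d).
  have [d' wd' dd'] := closed_walk_at vd d0 (ex_intro2 _ _ e ed (or_introl erefl)).
  exists [::], (src e), d'; split=> //; first by rewrite /= eu.
    by move=> d'0; move: dd' d0; rewrite d'0 perm_sym => /perm_nilP.
  exact: perm_mem.
have [nu' [v' [d' [wnu' wd' d'0 dd' nud]]]] := IH _ enu.
exists (e :: nu'), v', d'; split=> //; first by rewrite /= eu eqxx.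
by move=> f; rewrite inE => /predU1P[->|/nud].
Qed.

(** The walk may run along edges of the cycle; it is cut where it first meets
    the cycle. *)
Lemma Gprime_leads e nu v d : walk (rng e) nu v -> walk v d v -> d <> [::] ->
  e \notin d -> Gprime_edge e.
Proof.
move=> enu vd d0 ed.
have [nu' [v' [d' [wnu' wd' d'0 dd' nud]]]] := walk_first_hit enu vd d0.
apply/Gprime_edgeP; exists nu', v', d'; split=> //; first by rewrite /= eqxx.
by move=> f; rewrite dd' inE => /predU1P[->|/nud].
Qed.

(** A walk longer than the number of vertices leaves some vertex twice. *)
Lemma walk_pigeonhole (vs : seq V) u nu v : (forall v, v \in vs) ->
  (size vs < size nu)%N -> walk u nu v ->
  exists a c b w, [/\ nu = a ++ c ++ b, c <> [::], walk u a w, walk w c w & walk w b v].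
Proof.
move=> vsT vsnu wnu; have : ~~ uniq (map (@src G) nu).
  apply: contraL vsnu => usrc; rewrite -leqNgt -(size_map (@src G) nu).
  by apply: uniq_leq_size => // w _; exact: vsT.
case/not_uniq_split => a [e [c [f [b [nuE ef]]]]].
exists a, (e :: c), (f :: b), (src e); rewrite nuE in wnu *.
have [wa wb] := walk_split wnu; have [wc wb'] := walk_split wb.
by split=> //=; rewrite ?eqxx ?ef ?eqxx.
Qed.

(** These are the vertices subject to the summation relation. *)
Definition regular v : Prop :=
  @rng G @^-1` [set v] !=set0 /\ finite_set (@rng G @^-1` [set v]).

(** The consequences of finiteness, in combinatorial form: [dead] stands for the
    set of vertices whose projection is sent to 0 by a given *-homomorphism into
    the corona. *)
Section Dead.
Variables (vs : seq V) (vsT : forall v, v \in vs) (dead : V -> Prop).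
Hypothesis dead_entry : forall c f, walk (rng f) c (rng f) -> c <> [::] ->
  f \notin c -> dead (src f).
Hypothesis dead_src : forall e, dead (rng e) -> dead (src e).
Hypothesis dead_regular : forall v, regular v ->
  (forall e, rng e = v -> dead (src e)) -> dead v.

Lemma dead_walk u nu v : walk u nu v -> dead v -> dead u.
Proof.
elim: nu u => [|e nu IH] u /=; first by move/eqP->.
by move=> /andP[/eqP<- /IH h] /h /dead_src.
Qed.

Lemma Gprime_dead e : Gprime_edge e -> dead (src e).
Proof.
move=> /Gprime_edgeP[nu [v [c [/= /andP[_ wnu] wc c0 nuc]]]].
elim: nu e wnu nuc => [|f nu IH] e /=.
  move=> /eqP ev nuc; rewrite -ev in wc.
  by apply: (dead_entry wc c0); apply: nuc; rewrite mem_head.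
move=> /andP[/eqP fe wnu] nuc; apply: dead_src; rewrite -fe; apply: IH => // x xin.
by apply: nuc; rewrite inE xin orbT.
Qed.

Lemma Gtilde_reach e f nu : ~ Gtilde_edge e -> walk (rng f) nu (src e) ->
  ~ Gtilde_edge f.
Proof.
move=> eG wnu fG; apply: eG.
have reach (S : set V) : reached_from S f -> reached_from S e.
  move=> /reached_fromP[u [mu [Su wmu]]]; apply/reached_fromP.
  exists u, (mu ++ f :: nu); split=> //.
  by apply: walk_catI wmu _; rewrite /= eqxx.
move: fG => [[[[c [v [cc cG cv fv]]]|f2]|[g [v [g2 gv fv]]]]|[p [q [pq fq]]]].
- by left; left; left; exists c, v; split=> //; exact: reach.
- left; right; exists f, (rng f); split=> //; first by exists f => //; right.
  by apply/reached_fromP; exists (rng f), nu.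
- by left; right; exists g, v; split=> //; exact: reach.
- by right; exists p, q; split=> //; exact: reach.
Qed.

(** Some edge entering [src e] must be alive, by the summation relation. That
    relation applies because [src e] receives no edge of G' (it would be dead or
    on a cycle that avoids G', the first case of G~), at least one edge (or it
    would be dead, or [e] in the second case), and finitely many edges (the
    fourth case). *)
Lemma alive_pred e : ~ Gtilde_edge e -> ~ dead (src e) ->
  exists f, [/\ ~ Gtilde_edge f, ~ dead (src f) & rng f = src e].
Proof.
move=> eG ev; set v := src e in ev *.
have noG' f : rng f = v -> ~ Gprime_edge f.
  move=> fv fG'; have [[g gG' gf]|[c [wc c0 fc]]] := Gprime_step fG'.
    by apply: ev; rewrite -fv -gf; exact: Gprime_dead.
  rewrite fv in wc; apply: eG; left; left; left; exists c, v; split.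
  - exact: walk_cycle wc c0.
  - move=> g gc gG'; apply: ev.
    case/splitPr: gc wc {c0 fc} => a b /walk_split[wa _].
    exact: dead_walk wa (Gprime_dead gG').
  - case: c wc c0 {fc} => // g c /= /andP[/eqP gv _] _.
    by exists g => /=; [rewrite inE eqxx | left].
  - by apply/reached_fromP; exists v, [::]; rewrite /= eqxx.
have v_rec : @rng G @^-1` [set v] !=set0.
  apply: contrapT => v0; apply: eG; left; left; right => /reached_fromP.
  move=> [u [nu [[g gG' ug] wnu]]].
  case/lastP: nu wnu => [/eqP uv|nu f]; last first.
    by rewrite -cats1 => /walk_split[_ /eqP fv]; apply: v0; exists f.
  case: ug => ug; last by apply: v0; exists g; rewrite /= -ug.
  by apply: ev; rewrite /v -uv ug; exact: Gprime_dead.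
have v_fin : finite_set (@rng G @^-1` [set v]).
  apply: contrapT => vinf; apply: eG.
  suff [p pinf] : exists p, infinite_set [set f : E | [/\ src f = p, rng f = v & ~ Gprime_edge f]].
    by right; exists p, v; split=> //; apply/reached_fromP; exists v, [::]; rewrite /= eqxx.
  apply: contrapT => /forallNP pfin; apply: vinf.
  apply: (@sub_finite_set _ _ (\bigcup_(p in [set` vs])
    [set f : E | [/\ src f = p, rng f = v & ~ Gprime_edge f]])).
    by move=> f fv; exists (src f); [exact: vsT | split=> //; exact: noG'].
  apply: bigcup_finite => [|p _]; first exact: finite_seq.
  exact: contrapT (pfin p).
apply: contrapT => /forallNP nof; apply: ev; apply: dead_regular => // f fv.
apply: contrapT => fa; apply: (nof f); split=> //.
by apply: (@Gtilde_reach e f [::]) => //; rewrite /= fv.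
Qed.

(** Otherwise one could go backwards from [e] along live edges forever and close
    up a cycle. Live edges are not in G', so [e] would belong to G~ by the first
    case. *)
Lemma not_Gtilde_dead e : ~ Gtilde_edge e -> dead (src e).
Proof.
move=> eG; apply: contrapT => ev.
have long m : exists u nu, [/\ walk u nu (src e), size nu = m &
    forall f, f \in nu -> ~ dead (src f)].
  suff [f [nu [_ _ wnu num nua]]] : exists f nu, [/\ ~ Gtilde_edge f,
      ~ dead (src f), walk (src f) nu (src e), size nu = m &
      forall g, g \in nu -> ~ dead (src g)] by exists (src f), nu.
  elim: m => [|m [f [nu [fG fa wnu num nua]]]]; first by exists e, [::]; rewrite /= eqxx.
  have [g [gG ga gf]] := alive_pred fG fa.
  exists g, (g :: nu); split=> //=; rewrite ?eqxx ?gf ?num//.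
  by move=> h; rewrite inE => /predU1P[->|/nua].
have [u [nu [wnu nus nua]]] := long (size vs).+1.
have [|a [c [b [w [nuE c0 _ wc wb]]]]] := walk_pigeonhole vsT _ wnu; first by rewrite nus.
apply: eG; left; left; left; exists c, w; split.
- exact: walk_cycle wc c0.
- move=> f fc /Gprime_dead; apply: nua.
  by rewrite nuE !mem_cat fc orbT.
- case: c c0 wc {nuE} => // f c _ /= /andP[/eqP fw _].
  by exists f => /=; [rewrite inE eqxx | left].
- by apply/reached_fromP; exists w, b.
Qed.

End Dead.
End Walks.

(** * Roots of the subgraph G~ *)

Section Roots.
Variable G : digraph.
Local Notation V := (vertex G).
Local Notation E := (edge G).
Implicit Types (u v w : V) (e f g : E) (a b c d nu : seq E).

(** [W] is the set of starting vertices of the path model. It is either one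
    vertex, with [c] empty, or the set of vertices of the simple cycle [c]. In
    both cases each vertex of [W] which is subject to a summation relation has a
    unique edge of [c] to satisfy it, and walks that do not start along [c] meet
    no cycle. *)
Record good_root (W : seq V) (c : seq E) : Prop := {
  root_src : forall e, e \in c -> src e \in W;
  root_rng : forall e, e \in c -> rng e \in W;
  root_inj : {in c &, injective (@rng G)};
  root_relation : forall w, w \in W -> (exists2 e, e \in c & rng e = w) \/ ~ regular w;
  root_acyclic : forall w a b v, w \in W -> (forall e, ohead (a ++ b) = Some e -> e \notin c) ->
    walk w a v -> walk v b v -> b = [::] }.

Definition rooted v := exists W c w nu, [/\ good_root W c, w \in W & walk w nu v].

Lemma rooted_walk u nu v : rooted u -> walk u nu v -> rooted v.
Proof.
move=> [W [c [w [mu [Wc wW wmu]]]]] wnu; exists W, c, w, (mu ++ nu); split=> //.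
exact: walk_catI wmu wnu.
Qed.

(** Suppose that a walk from [w] starts outside the cycle [c] and comes back to
    it for the first time at w1. Then the detour followed by the arc of [c] from
    w1 to [w] is a cycle. It misses the edge of [c] that starts at [w], and this
    edge leads to it, hence lies in G'. *)
Lemma simple_cycle_no_return c u w w' e nu : walk u c u -> uniq c ->
  (forall e, e \in c -> ~ Gprime_edge e) ->
  w \in map (@src G) c -> w' \in map (@src G) c ->
  walk w (e :: nu) w' -> e \in c.
Proof.
move=> uc uqc cG wW w'W /= /andP[/eqP ew enu]; apply: contraT => ec.
have [mu [w1 [w1W wmu muc]]] : exists mu w1, [/\ w1 \in map (@src G) c,
    walk (rng e) mu w1 & forall f, f \in mu -> f \notin c].
  elim: nu (rng e) enu => [|f nu IH] z /=; first by move=> /eqP->; exists [::], w'; rewrite /= eqxx.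
  move=> /andP[/eqP fz fnu]; have [zW|zW] := boolP (z \in map (@src G) c).
    by exists [::], z; rewrite /= eqxx.
  have [mu [w1 [w1W wmu muc]]] := IH _ fnu.
  exists (f :: mu), w1; split=> //=; first by rewrite fz eqxx.
  move=> g; rewrite inE => /predU1P[->|/muc//].
  by apply: contra zW => fc; rewrite -fz; apply/mapP; exists f.
have c0 : c <> [::] by move=> cE; rewrite cE in wW.
have w1c : endpoints [set` c] w1.
  by case/mapP: w1W => f fc ->; exists f => //; left.
have [c' wc' cc'] := closed_walk_at uc c0 w1c.
have wc'W : w \in map (@src G) c' by rewrite (perm_mem (perm_map _ cc')).
case/mapP: wc'W => g gc' wg; have uc' : uniq c' by rewrite (perm_uniq cc').
have gc : g \in c by rewrite -(perm_mem cc').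
(* [c] read from w1 splits into the arc [b] from w1 to [w], the edge [g] that
   starts at [w], and the rest [d]. *)
case/splitPr: gc' wc' cc' uc' => b d wbd cc' uc'.
have [wb wd] := walk_split wbd; rewrite -wg in wb.
exfalso; apply: (cG _ gc); apply: (@Gprime_leads _ g (d ++ b) w (e :: mu ++ b)) => //.
- exact: walk_catI wd wb.
- by rewrite /= ew eqxx; exact: walk_catI wmu wb.
- rewrite inE mem_cat !negb_or; apply/and3P; split.
  + by apply: contraNneq ec => <-.
  + by apply: contraL gc => /muc.
  + by move: uc'; rewrite cat_uniq => /and3P[_ /=]; rewrite negb_or => /andP[].
Qed.

(** A cycle reached after leaving [c] cannot pass through [c], by
    [simple_cycle_no_return]; so the edges of [c] lead to it and are in G'. *)
Lemma simple_cycle_root c u : walk u c u -> c <> [::] -> uniq (map (@rng G) c) ->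
  (forall e, e \in c -> ~ Gprime_edge e) -> good_root (map (@src G) c) c.
Proof.
move=> uc c0 urng cG; have uqc := map_uniq urng.
have inW e : e \in c -> src e \in map (@src G) c by move=> ec; apply/mapP; exists e.
split=> //.
- by move=> e ec; rewrite (closed_walk_ends uc); apply/mapP; exists e.
- move=> e f ec fc; case/splitPr: ec fc urng => a b.
  rewrite mem_cat inE map_cat cat_uniq /= => fab /and3P[_ /norP[ea _] /andP[eb _]] ef.
  case/or3P: fab => [fa|/eqP->//|fb].
    by case/negP: ea; rewrite ef; apply/mapP; exists f.
  by case/negP: eb; rewrite ef; apply/mapP; exists f.
- by move=> w; rewrite (closed_walk_ends uc) => /mapP[e ec ->]; left; exists e.
- move=> w a b v wW hd wa vb; apply: contrapT => b0.
  have [e ec ew] : exists2 e, e \in c & rng e = w.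
    by move: wW; rewrite (closed_walk_ends uc) => /mapP[e ec ->]; exists e.
  have [eb|eb] := boolP (e \in b); last first.
    by apply: (cG _ ec); apply: (Gprime_leads (nu := a) (v := v) (d := b)) => //; rewrite ew.
  case/splitPr: eb vb hd {b0} => b1 b2 /walk_split[vb1 _].
  rewrite catA; have := walk_catI wa vb1.
  case: (a ++ b1) => [_|f nu wnu] /= hd; first by case/negP: (hd e erefl).
  case/negP: (hd f erefl).
  exact: simple_cycle_no_return uc uqc cG wW (inW _ ec) wnu.
Qed.

(** A cycle that passes twice through a vertex contains a shorter one, from
    which the whole cycle can be reached. *)
Lemma cycle_rooted c u : walk u c u -> c <> [::] ->
  (forall e, e \in c -> ~ Gprime_edge e) -> rooted u.
Proof.
have [m] := ubnP (size c); elim: m => // m IH in c u *; rewrite ltnS => cm uc c0 cG.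
have [urng|/not_uniq_split[a [e [d [f [b [cE ef]]]]]]] := boolP (uniq (map (@rng G) c)).
  exists (map (@src G) c), c, u, [::].
  split; [exact: simple_cycle_root uc c0 urng cG| |by rewrite /=].
  by case: c uc c0 {cm cG urng} => // e c /= /andP[/eqP<- _] _; rewrite inE eqxx.
rewrite cE in uc cm cG; have [ua wb] := walk_split uc.
move: wb; rewrite -cat1s catA => /walk_cat[v wdf wb].
have vf : v = rng f.
  by move: wdf; rewrite -[X in walk _ X v]/(d ++ [:: f]) => /walk_split[_ /eqP].
rewrite -ef in vf; rewrite vf in wdf wb.
apply: rooted_walk wb; apply: IH wdf _ _.
- move: cm; rewrite !size_cat /= !size_cat /= => cm; apply: leq_trans cm.
  by rewrite addn1 !addnS !ltnS (leq_trans (leq_addr _ _) (leq_addl _ _)).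
- by case: (d).
- by move=> g gdf; apply: cG; rewrite mem_cat inE -(cat1s f) catA mem_cat gdf !orbT.
Qed.

Lemma closed_walk_rng v b e : walk v b v -> e \in b -> exists2 f, f \in b & rng f = src e.
Proof.
move=> vb eb; have : src e \in map (@src G) b by apply/mapP; exists e.
by rewrite (closed_walk_ends vb) => /mapP[f fb ->]; exists f.
Qed.

(** The first edge of a walk to a cycle would lead to it, as a cycle cannot pass
    through a vertex that receives nothing. *)
Lemma source_rooted u : (forall e, rng e <> u) ->
  (forall e, src e = u -> ~ Gprime_edge e) -> rooted u.
Proof.
move=> u_src uG; exists [:: u], [::], u, [::]; split; rewrite ?mem_head//=.
split=> // w; first by rewrite inE => /eqP->; right => -[[e /u_src]].
move=> a b v; rewrite inE => /eqP-> _ wa vb.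
apply: contrapT => b0; have nsrc e : src e = u -> e \notin b.
  by move=> eu; apply/negP => /(closed_walk_rng vb)[f _]; rewrite eu => /u_src.
case: a wa => [/= /eqP uv|e a /= /andP[/eqP eu wa]].
  case: b vb b0 nsrc => // e b /= /andP[/eqP eu _] _ /(_ e).
  by rewrite inE eqxx eu uv => /(_ erefl).
exact: (uG _ eu) (Gprime_leads wa vb b0 (nsrc _ eu)).
Qed.

(** One of the infinitely many edges is not in a given cycle reachable from [q],
    and would be in G'. As [q] receives infinitely many edges, it is subject to
    no summation relation. *)
Lemma infinite_receiver_rooted p q :
  infinite_set [set f : E | [/\ src f = p, rng f = q & ~ Gprime_edge f]] -> rooted q.
Proof.
move=> pq; exists [:: q], [::], q, [::]; split; rewrite ?mem_head//=.
split=> // w.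
  rewrite inE => /eqP->; right => -[_ qfin]; apply: pq; apply: sub_finite_set qfin.
  by move=> f [].
move=> a b v; rewrite inE => /eqP-> _ wa vb; apply: contrapT => b0; apply: pq.
apply: (@sub_finite_set _ _ [set` b]); last exact: finite_seq.
move=> f [_ fq fG]; apply: contrapT => fb; apply: fG.
apply: (Gprime_leads (nu := a) (v := v) (d := b)) => //; first by rewrite fq.
exact/negP.
Qed.

(** Going backwards from [e], one either stops at a vertex that receives nothing
    or closes up a cycle. No edge of G' is met, since [e] is reachable from all
    these edges. *)
Lemma Gtilde_edge2_rooted (vs : seq V) e : (forall v, v \in vs) ->
  Gtilde_edge2 e -> rooted (src e).
Proof.
move=> vsT e2.
have noG' f nu : walk (src f) nu (src e) -> ~ Gprime_edge f.
  move=> wnu fG'; apply: e2; apply/reached_fromP; exists (src f), nu; split=> //.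
  by exists f => //; left.
have [[u [nu [u_src wnu]]]|nosrc] :=
    pselect (exists u nu, (forall f, rng f <> u) /\ walk u nu (src e)).
  apply: rooted_walk (wnu); apply: source_rooted => [//|f fu].
  have fnu : walk (src f) nu (src e) by rewrite fu.
  exact: noG' fnu.
have long m : exists u nu, walk u nu (src e) /\ size nu = m.
  elim: m => [|m [u [nu [wnu num]]]]; first by exists (src e), [::]; rewrite /= eqxx.
  have [f fu] : exists f, rng f = u.
    by apply: contrapT => /forallNP h; apply: nosrc; exists u, nu.
  by exists (src f), (f :: nu); rewrite /= eqxx fu num.
have [u [nu [wnu nus]]] := long (size vs).+1.
have [|a [c [b [w [nuE c0 _ wc wb]]]]] := walk_pigeonhole vsT _ wnu; first by rewrite nus.
apply: rooted_walk (wb); apply: (cycle_rooted wc c0) => f fc.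
case/splitPr: fc nuE wc c0 => c1 c2 nuE wc c0; have [_ wc2] := walk_split wc.
have fnu : walk (src f) (f :: c2 ++ b) (src e) by rewrite /= eqxx (walk_catI wc2 wb).
exact: noG' fnu.
Qed.

Lemma Gtilde_rooted (vs : seq V) e : (forall v, v \in vs) ->
  Gtilde_edge e -> rooted (src e).
Proof.
move=> vsT [[[[c [v [cc cG cv /reached_fromP[_ [nu [-> wnu]]]]]]|]|]|].
- have [u uc c0] := cycleP cc; have [d wd dc] := closed_walk_at uc c0 cv.
  apply: rooted_walk wnu; apply: (cycle_rooted wd) => [d0|f]; last by rewrite (perm_mem dc) => /cG.
  by move: dc c0; rewrite d0 perm_sym => /perm_nilP.
- exact: Gtilde_edge2_rooted.
- move=> [f [v [f2 [_ -> fv] /reached_fromP[_ [nu [-> wnu]]]]]].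
  have fr := Gtilde_edge2_rooted vsT f2.
  apply: rooted_walk wnu; case: fv => -> //.
  by apply: (@rooted_walk _ [:: f]) fr _; rewrite /= !eqxx.
- move=> [p [q [pq /reached_fromP[_ [nu [-> wnu]]]]]].
  by apply: rooted_walk wnu; exact: infinite_receiver_rooted pq.
Qed.
End Roots.

(** * Matrices of partial maps *)

Section PartialMatrix.
Variables (R : realType) (T : eqType) (L : seq T) (N : nat).
Hypotheses (uL : uniq L) (LN : (size L <= N)%N).
Local Notation C := R[i].
Implicit Types f g h : T -> option T.

(** Basis vectors are numbered by their position in [L], so that matrices of any
    size N >= size L can be used; the indices beyond the end of [L] carry zero
    rows and columns. *)
Definition pentry f (i j : nat) : bool :=
  if (ohead (drop i L), ohead (drop j L)) is (Some x, Some y) then f y == Some x else false.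

Definition pmx f : cmatrix R N := (\matrix_(i < N, j < N) (pentry f i j)%:R : 'M[C]_N).

Lemma pentry_nth x0 f (i j : nat) : (i < size L)%N -> (j < size L)%N ->
  pentry f i j = (f (nth x0 L j) == Some (nth x0 L i)).
Proof. by move=> iL jL; rewrite /pentry (drop_nth x0 iL) (drop_nth x0 jL). Qed.

Lemma pentryP f (i j : nat) : reflect (exists x y, [/\ x \in L, y \in L,
  i = index x L, j = index y L & f y = Some x]) (pentry f i j).
Proof.
apply: (iffP idP) => [|[x [y [xL yL -> -> fyx]]]]; last first.
  by rewrite (pentry_nth x) ?index_mem// !nth_index// fyx.
have [iL|iL] := ltnP i (size L); last by rewrite /pentry drop_oversize.
have [jL|jL] := ltnP j (size L); last first.
  by rewrite /pentry (drop_oversize jL); case: (ohead _).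
have x0 : T by case: (L) iL => // x.
rewrite (pentry_nth x0)// => /eqP fyx.
exists (nth x0 L i), (nth x0 L j); split; rewrite ?mem_nth ?index_uniq//.
Qed.

Lemma pmx_ext f g : (forall y x, y \in L -> x \in L -> f y = Some x <-> g y = Some x) ->
  pmx f = pmx g.
Proof.
move=> fg; apply/matrixP => i j; rewrite !mxE; congr (nat_of_bool _)%:R.
by apply/pentryP/pentryP => -[x [y [xL yL ix jy h]]]; exists x, y; split=> //;
  apply/(fg y x).
Qed.

Lemma pmx_adj f g : (forall y x, y \in L -> x \in L -> f y = Some x <-> g x = Some y) ->
  star (pmx f) = pmx g.
Proof.
move=> fg; apply/matrixP => i j; rewrite !mxE conjC_nat; congr (nat_of_bool _)%:R.
by apply/pentryP/pentryP => -[x [y [xL yL ix jy h]]]; exists y, x; split=> //;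
  apply/fg.
Qed.

Lemma pmx_eq0 f : (forall y x, y \in L -> x \in L -> f y <> Some x) -> pmx f = 0.
Proof.
move=> f0; apply/matrixP => i j; rewrite !mxE; case: (boolP (pentry _ _ _)) => //.
by move=> /pentryP[x [y [xL yL _ _ /f0]]]; case.
Qed.

Lemma pmxM f g : (forall y x, y \in L -> g y = Some x -> x \in L) ->
  pmx f ** pmx g = pmx (fun y => obind f (g y)).
Proof.
move=> gL; apply/matrixP => i j; rewrite !mxE.
have [/pentryP[x [y [xL yL ix jy]]]|] := boolP (pentry _ i j).
  case gy: (g y) => [z|//] /= fz; have zL := gL _ _ yL gy.
  have zN : (index z L < N)%N by rewrite (leq_trans _ LN)// index_mem.
  rewrite (bigD1 (Ordinal zN))//= big1 => [|k kz]; rewrite !mxE.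
    have -> : pentry f i (index z L) by apply/pentryP; exists x, z.
    have -> : pentry g (index z L) j by apply/pentryP; exists z, y.
    by rewrite mulr1 addr0.
  have [/pentryP[z' [y' [z'L y'L kz' jy' gy']]]|] := boolP (pentry g k j); last by rewrite mulr0.
  case/eqP: kz; apply: val_inj => /=; rewrite kz'.
  move: jy'; rewrite jy => /(congr1 (nth y L)); rewrite !nth_index// => yy'.
  by move: gy'; rewrite -yy' gy => -[->].
move=> ne; rewrite big1 => // k _; rewrite !mxE.
have [/pentryP[x [z [xL zL ix kz fz]]]|] := boolP (pentry f i k); last by rewrite mul0r.
have [/pentryP[z' [y [z'L yL kz' jy gy]]]|] := boolP (pentry g k j); last by rewrite mulr0.
case/negP: ne; apply/pentryP; exists x, y; split=> //.
move: kz'; rewrite kz => /(congr1 (nth x L)); rewrite !nth_index// => zz'.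
by rewrite gy -zz' /= fz.
Qed.

Lemma pmx_neq0 f x y : x \in L -> y \in L -> f y = Some x -> pmx f <> 0.
Proof.
move=> xL yL fyx; have iN z : z \in L -> (index z L < N)%N.
  by move=> zL; rewrite (leq_trans _ LN)// index_mem.
move=> /matrixP/(_ (Ordinal (iN _ xL)) (Ordinal (iN _ yL))); rewrite !mxE /=.
have -> : pentry f (index x L) (index y L) by apply/pentryP; exists x, y.
by move=> /eqP; rewrite oner_eq0.
Qed.

Lemma pmx_sum (I : eqType) (F : seq I) (g : I -> T -> option T) f : uniq F ->
  (forall y x, y \in L -> x \in L -> f y = Some x <-> exists2 e, e \in F & g e y = Some x) ->
  (forall e e' y x, e \in F -> e' \in F -> y \in L -> x \in L ->
     g e y = Some x -> g e' y = Some x -> e = e') ->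
  pmx f = \sum_(e <- F) pmx (g e).
Proof.
move=> uF fg ginj; apply/matrixP => i j.
transitivity (\sum_(e <- F) (pmx (g e) : 'M[C]_N) i j); last first.
  by rewrite [in RHS](_ : \sum_(e <- F) _ = \sum_(e <- F) (pmx (g e) : 'M[C]_N)) ?summxE.
rewrite mxE.
have [/pentryP[x [y [xL yL ix jy /(fg _ _ yL xL)[e eF gy]]]]|ne] := boolP (pentry f i j).
  rewrite (bigD1_seq e)//= mxE (_ : pentry (g e) i j); last by apply/pentryP; exists x, y.
  rewrite big_seq_cond big1 ?addr0// => e' /andP[e'F e'e]; rewrite mxE.
  have [/pentryP[x' [y' [x'L y'L ix' jy' gy']]]|//] := boolP (pentry (g e') i j).
  move: ix' jy'; rewrite ix jy => /(congr1 (nth y L)) + /(congr1 (nth y L)).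
  rewrite !nth_index// => xx' yy'; rewrite -xx' -yy' in gy'.
  by case/eqP: e'e; apply: (ginj _ _ y x).
rewrite big_seq_cond big1// => e /andP[eF _]; rewrite mxE.
have [/pentryP[x [y [xL yL ix jy gy]]]|//] := boolP (pentry (g e) i j).
by case/negP: ne; apply/pentryP; exists x, y; split=> //; apply/fg => //; exists e.
Qed.

End PartialMatrix.

(** * The path model of a rooted subgraph

    The basis vectors are the pairs (w, nu) of a vertex [w] of [W] and a walk
    [nu] from [w] that does not start along [c]; they sit at the vertex where
    [nu] ends.  An edge prolongs the walks that end at its source, except that
    an edge of [c] moves the empty walk at its source to the empty walk at its
    range.  Thus a cycle [c] permutes the vectors (w, [::]), and it acts on
    their span as a unitary. *)

Section PathModel.
Variables (G : digraph) (vs : seq (vertex G)) (W : seq (vertex G)) (c : seq (edge G)).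
Hypotheses (vsT : forall v, v \in vs) (Wc : good_root W c).
Local Notation V := (vertex G).
Local Notation E := (edge G).
Local Notation T := (V * seq E)%type.
Implicit Types (v w : V) (e f : E) (nu : seq E) (x y : T).

Definition tgt x : V := last x.1 (map (@rng G) x.2).

Definition valid x : bool :=
  [&& x.1 \in W, walk x.1 x.2 (tgt x) & if x.2 is e :: _ then e \notin c else true].

Definition ext e x : option T :=
  if tgt x == src e then
    Some (if (x.2 == [::]) && (e \in c) then (rng e, [::]) else (x.1, rcons x.2 e))
  else None.

(** The inverse of the injection [ext e]. *)
Definition cut e y : option T :=
  if y.2 is f :: nu then
    if last f nu == e then Some (y.1, belast f nu) else None
  else if (e \in c) && (rng e == y.1) then Some (src e, [::]) else None.

Definition at_vertex v x : option T := if tgt x == v then Some x else None.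

Lemma tgt_rcons w nu e : tgt (w, rcons nu e) = rng e.
Proof. by rewrite /tgt /= map_rcons last_rcons. Qed.

Lemma tgt_walk w nu v : walk w nu v -> tgt (w, nu) = v.
Proof. by rewrite /tgt /=; elim: nu w => [|e nu IH] w /=; [move/eqP | move=> /andP[_ /IH]]. Qed.

Lemma ext_tgt e x y : ext e x = Some y -> tgt y = rng e.
Proof. by rewrite /ext; case: eqP => // _ [<-]; case: ifP => // _; rewrite tgt_rcons. Qed.

Lemma cut_rcons e w nu f : cut e (w, rcons nu f) = if f == e then Some (w, nu) else None.
Proof.
rewrite /cut; case: nu => [|g nu] //=.
by rewrite last_rcons; case: eqP => // _; rewrite belast_rcons.
Qed.

Lemma ext_valid e x y : valid x -> ext e x = Some y -> valid y.
Proof.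
case: x => w nu /and3P[/= wW wnu hd]; rewrite /ext; case: eqP => // te [<-].
case: ifP => [/andP[_ ec]|/= he].
  by rewrite /valid /= (root_rng Wc)//= /tgt /= eqxx.
rewrite /valid tgt_rcons /= wW -cats1 (walk_catI wnu) /=; last by rewrite te !eqxx.
by case: nu he {wnu te} hd => //= /negbT.
Qed.

Lemma cut_valid e x y : valid y -> cut e y = Some x -> valid x /\ tgt x = src e.
Proof.
case: y => w nu /and3P[/= wW wnu hd]; case/lastP: nu wnu hd => [|nu f] wnu hd.
  rewrite /cut /=; case: ifP => // /andP[ec _] [<-].
  by rewrite /valid /= (root_src Wc)//= /tgt /= eqxx.
rewrite cut_rcons; case: eqP => // <- [<-].
move: wnu; rewrite -cats1 => /walk_split[wnu _]; rewrite (tgt_walk wnu); split=> //.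
rewrite /valid /= wW (tgt_walk wnu) wnu /=.
by case: nu hd {wnu}.
Qed.

Lemma ext_cut e x y : valid y -> ext e x = Some y <-> cut e y = Some x.
Proof.
move=> yv; split.
  case: x => w nu; rewrite /ext; case: eqP => // te [<-].
  case: ifP => [/andP[/eqP/= nu0 ec]|_]; last by rewrite cut_rcons eqxx.
  by rewrite /cut /= ec eqxx /=; move: te; rewrite nu0 /tgt /= => ->.
move=> ye; have [_ te] := cut_valid yv ye; move: ye.
case: y yv => w nu /and3P[/= wW wnu hd]; case/lastP: nu wnu hd => [|nu f] wnu hd.
  rewrite /cut /=; case: ifP => // /andP[ec /eqP ew] [<-].
  by rewrite /ext /tgt /= eqxx ec ew.
rewrite cut_rcons; case: eqP => // fe [xE]; rewrite -xE in te *; rewrite /ext te eqxx /=.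
by case: nu hd {wnu te xE} => [|g nu] //= hd; rewrite -?fe ?(negPf hd).
Qed.

(** Distinct edges have disjoint ranges: the last edge of a nonempty walk is
    determined, and [c] has at most one edge into each vertex. *)
Lemma cut_unique e f x y z : cut e y = Some x -> cut f y = Some z -> e = f.
Proof.
case: y => w nu; case/lastP: nu => [|nu g].
  rewrite /cut /=; case: ifP => // /andP[ec /eqP ew] _; case: ifP => // /andP[fc /eqP fw] _.
  by apply: (root_inj Wc) => //; rewrite ew.
by rewrite !cut_rcons; case: eqP => // <- _; case: eqP.
Qed.

Lemma cut_tgt e x y : valid y -> cut e y = Some x -> tgt y = rng e.
Proof. by move=> yv /(ext_cut _ _ yv)/ext_tgt. Qed.

(** This is the summation relation: a basis vector at a regular vertex lies in
    the range of some edge. For an empty walk that edge is provided by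
    [root_relation]. *)
Lemma cut_regular y : valid y -> regular (tgt y) -> exists e x, cut e y = Some x.
Proof.
case: y => w nu /and3P[/= wW _ _]; case/lastP: nu => [|nu g].
  rewrite /tgt /= => wreg; have [[e ec ew]|//] := root_relation Wc wW.
  by exists e, (src e, [::]); rewrite /cut /= ec ew eqxx.
by exists g, (w, nu); rewrite cut_rcons eqxx.
Qed.

Fixpoint words (es : seq E) (m : nat) : seq (seq E) :=
  [::] :: (if m is m'.+1 then [seq e :: nu | e <- es, nu <- words es m'] else [::]).

Lemma mem_words es m nu : (size nu <= m)%N -> {subset nu <= es} -> nu \in words es m.
Proof.
elim: m nu => [|m IH] [|e nu] //= num nues; rewrite inE; apply/orP; right.
apply/allpairsP; exists (e, nu); split=> //=; first exact/nues/mem_head.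
by apply: IH => // f fnu; apply: nues; rewrite inE fnu orbT.
Qed.

(** The bound on the length of the words loses no walk, by [valid_size]; so this
    is the whole set of basis vectors that involve only the first k edges of
    [G]. *)
Definition level k : seq T :=
  undup [seq x <- [seq (w, nu) | w <- W, nu <- words (pmap unpickle (iota 0 k)) (size vs)]
        | valid x && all (fun e => pickle e < k)%N x.2].

Lemma valid_size x : valid x -> (size x.2 <= size vs)%N.
Proof.
case: x => w nu /and3P[/= wW wnu hd]; rewrite leqNgt; apply/negP => nus.
have [a [d [b [u [nuE d0 wa ud ub]]]]] := walk_pigeonhole vsT nus wnu.
apply: d0; apply: (root_acyclic Wc wW _ wa ud) => e.
move: hd; rewrite nuE; case: a {wa nuE} => [|f a] /=; last by move=> fc [<-].
by case: d ud => [|f d] //= ud fc [<-].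
Qed.

Lemma mem_level k x : (x \in level k) = valid x && all (fun e => pickle e < k)%N x.2.
Proof.
rewrite mem_undup mem_filter andb_idr// => /andP[xv xk].
case: x xv xk => w nu xv xk; apply/allpairsP; exists (w, nu); split=> //=.
  by case/and3P: xv.
apply: mem_words; first exact: (valid_size xv).
move=> e /(allP xk) /= ek; rewrite mem_pmap; apply/mapP; exists (pickle e).
  by rewrite mem_iota.
by rewrite pickleK.
Qed.

Lemma level_uniq k : uniq (level k). Proof. exact: undup_uniq. Qed.

Lemma level_valid k x : x \in level k -> valid x.
Proof. by rewrite mem_level => /andP[]. Qed.

Lemma ext_level k e x y : (pickle e < k)%N -> x \in level k -> ext e x = Some y -> y \in level k.
Proof.
rewrite !mem_level => ek /andP[xv xk] xy; rewrite (ext_valid xv xy)/=.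
move: xy; rewrite /ext; case: eqP => // _ [<-]; case: ifP => //= _.
by rewrite all_rcons ek xk.
Qed.

Lemma cut_level k e x y : y \in level k -> cut e y = Some x -> x \in level k.
Proof.
rewrite !mem_level => /andP[yv yk] yx; have [-> _] /= := cut_valid yv yx.
move: yx yk; case: y {yv} => w nu; case/lastP: nu => [|nu f].
  by rewrite /cut /=; case: ifP => // _ [<-].
by rewrite cut_rcons; case: eqP => // _ [<-] /=; rewrite all_rcons => /andP[].
Qed.

(** Remove from the given walk its initial segment along [c]. *)
Lemma rooted_level w nu v : w \in W -> walk w nu v -> exists k x,
  forall k', (k <= k')%N -> x \in level k' /\ tgt x = v.
Proof.
move=> wW wnu; suff [x [xv xt]] : exists x, valid x /\ tgt x = v.
  exists (\max_(e <- x.2) (pickle e).+1), x => k' kk'; split=> //.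
  rewrite mem_level xv; apply/allP => e ex; apply: leq_trans kk'.
  by rewrite (big_rem e ex) /= leq_maxl.
elim: nu w wW wnu => [|e nu IH] w wW.
  by move=> /= /eqP<-; exists (w, [::]); rewrite /valid /= wW /tgt /= eqxx.
move=> wnu; have [ec|ec] := boolP (e \in c).
  by move: wnu => /= /andP[_]; apply: IH; exact: (root_rng Wc).
exists (w, e :: nu); rewrite (tgt_walk wnu); split=> //.
by apply/and3P; split=> //=; rewrite (tgt_walk wnu).
Qed.

Variables (R : realType) (N k : nat).
Hypothesis LN : (size (level k) <= N)%N.
Local Notation mat := (@pmx R T (level k) N).

Definition vertex_mx v : cmatrix R N := mat (at_vertex v).
Definition edge_mx e : cmatrix R N := mat (ext e).

Lemma vertex_mx_projection v : is_projection (vertex_mx v).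
Proof.
split.
  rewrite /vertex_mx; apply: (pmx_adj R N (level_uniq k)) => y x _ _; rewrite /at_vertex.
  by split; case: eqP => // t [<-]; rewrite t eqxx.
rewrite /vertex_mx pmxM ?level_uniq// => [|y x yL]; last first.
  by rewrite /at_vertex; case: ifP => // _ [<-].
apply: (pmx_ext R N (level_uniq k)) => y x _ _; rewrite /at_vertex.
by case: (tgt y =P v) => //= ->; rewrite eqxx.
Qed.

Lemma vertex_mx_orth v w : v != w -> vertex_mx v ** vertex_mx w = 0.
Proof.
move=> vw; rewrite /vertex_mx pmxM ?level_uniq// => [|y x yL]; last first.
  by rewrite /at_vertex; case: ifP => // _ [<-].
apply: (pmx_eq0 R N (level_uniq k)) => y x _ _; rewrite /at_vertex.
by case: (tgt y =P w) => //= ->; rewrite eq_sym (negPf vw).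
Qed.

Lemma star_edge_mx e : star (edge_mx e) = mat (cut e).
Proof. by apply: (pmx_adj R N (level_uniq k)) => y x _ /level_valid xv; exact: ext_cut. Qed.

Lemma edge_mx_source e : (pickle e < k)%N ->
  star (edge_mx e) ** edge_mx e = vertex_mx (src e).
Proof.
move=> ek; rewrite star_edge_mx pmxM ?level_uniq// => [|y x yL /(ext_level ek yL)//].
apply: (pmx_ext R N (level_uniq k)) => y x /level_valid yv _; rewrite /at_vertex.
case: (tgt y =P src e) => [te|/eqP te]; last by rewrite /ext (negPf te).
have [z ez] : exists z, ext e y = Some z by rewrite /ext te eqxx; eexists.
by rewrite ez /= (iffLR (ext_cut _ _ (ext_valid yv ez)) ez).
Qed.

Lemma edge_mx_range e : (pickle e < k)%N -> vertex_mx (rng e) ** edge_mx e = edge_mx e.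
Proof.
move=> ek; rewrite pmxM ?level_uniq// => [|y x yL /(ext_level ek yL)//].
apply: (pmx_ext R N (level_uniq k)) => y x _ _; case ey: (ext e y) => [z|]//=.
by rewrite /at_vertex (ext_tgt ey) eqxx.
Qed.

Lemma edge_mx_orth e f : e != f -> (pickle f < k)%N ->
  star (edge_mx e) ** edge_mx f = 0.
Proof.
move=> ef fk; rewrite star_edge_mx pmxM ?level_uniq// => [|y x yL /(ext_level fk yL)//].
apply: (pmx_eq0 R N (level_uniq k)) => y x /level_valid yv _.
case fy: (ext f y) => [z|]//= ez.
have fz := iffLR (ext_cut _ _ (ext_valid yv fy)) fy.
by rewrite (cut_unique ez fz) eqxx in ef.
Qed.

Lemma vertex_mx_sum v (F : seq E) : regular v -> uniq F ->
  (forall e, e \in F <-> rng e = v) -> (forall e, e \in F -> (pickle e < k)%N) ->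
  vertex_mx v = \sum_(e <- F) edge_mx e ** star (edge_mx e).
Proof.
move=> vreg uF Fv Fk.
rewrite (eq_big_seq (fun e => mat (fun y => obind (ext e) (cut e y)))); last first.
  move=> e eF; rewrite star_edge_mx pmxM ?level_uniq// => y x yL.
  exact: cut_level yL.
have extcut e y z x : valid y -> cut e y = Some z -> ext e z = Some x -> x = y.
  by move=> yv /(ext_cut _ _ yv)-> [].
apply: (pmx_sum R N (level_uniq k)) => //.
  move=> y x /level_valid yv _; rewrite /at_vertex; split.
    case: eqP => // yt [<-]; rewrite -yt in vreg; have [e [z ez]] := cut_regular yv vreg.
    exists e; first by apply/Fv; rewrite -(cut_tgt yv ez).
    by rewrite ez /=; apply/(ext_cut _ _ yv).
  move=> [e /Fv ev]; case ez: (cut e y) => [z|]//= zx.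
  by rewrite (extcut _ _ _ _ yv ez zx) (cut_tgt yv ez) ev eqxx.
move=> e f y x _ _ _ _; case ez: (cut e y) => [z|]//= _.
by case fz: (cut f y) => [z'|]//= _; exact: cut_unique ez fz.
Qed.

Lemma vertex_mx_neq0 x : x \in level k -> vertex_mx (tgt x) <> 0.
Proof.
move=> xL; have xx : at_vertex (tgt x) x = Some x by rewrite /at_vertex eqxx.
exact: (pmx_neq0 (level_uniq k) LN xL xL xx).
Qed.

End PathModel.

(** * Cuntz-Krieger relations *)

Section CKFacts.
Variables (R : realType).
Local Notation C := R[i].

(** The difference P - S S^* is a projection, hence its own square. *)
Lemma cle_range (B : cstarAlgType C) (P S : B) : is_projection P -> P ** S = S ->
  S ** star S ** S = S -> cle (S ** star S) P.
Proof.
move=> [Ps Pi] PS SSS; exists (P - S ** star S).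
have PSS : P ** (S ** star S) = S ** star S by rewrite amulA PS.
have SSP : S ** star S ** P = S ** star S.
  by rewrite -amulA -{1}Ps -starM PS.
have SSi : S ** star S ** (S ** star S) = S ** star S by rewrite amulA SSS.
rewrite starD starN starM starK Ps.
by rewrite amulDl !amulDr !(amulNl, amulNr) Pi PSS SSP SSi opprK addNr addr0.
Qed.

(** Both summands are compressions by 1 - q, of t t^* and of d^* d, and these
    two elements add up to q. *)
Lemma compress_sum (B : starAlgType C) (q t d : B) : is_projection q ->
  q - t ** star t = star d ** d ->
  (t - q ** t) ** star (t - q ** t) + star (d - d ** q) ** (d - d ** q) = 0.
Proof.
move=> [qs qi] qd.
have xx : (t - q ** t) ** star (t - q ** t) =
    (t ** star t - q ** (t ** star t)) - (t ** star t - q ** (t ** star t)) ** q.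
  rewrite starD starN starM qs amulDl amulNl !amulDr !amulNr amulDl amulNl !amulA.
  by rewrite !opprD !opprK !addrA; congr (_ + _); rewrite addrAC.
have yy : star (d - d ** q) ** (d - d ** q) =
    (star d ** d - q ** (star d ** d)) - (star d ** d - q ** (star d ** d)) ** q.
  rewrite starD starN starM qs amulDl amulNl !amulDr !amulNr amulDl amulNl !amulA.
  by rewrite !opprD !opprK !addrA; congr (_ + _); rewrite addrAC.
rewrite xx yy -qd addrACA -opprD -amulDl.
have -> : t ** star t - q ** (t ** star t) + (q - t ** star t - q ** (q - t ** star t)) = 0.
  by rewrite addrACA -opprD -amulDr subrKC qi subrr.
by rewrite amul0r subr0.
Qed.

Lemma ranges_orthogonal (B : starAlgType C) (t u : B) :
  t ** star t ** t = t -> u ** star u ** u = u ->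
  (t ** star t) ** (u ** star u) = 0 -> star t ** u = 0.
Proof.
move=> tt uu tu; rewrite -uu -{1}tt !starM starK !amulA.
have -> : star t ** t ** star t ** u ** star u ** u =
    star t ** ((t ** star t) ** (u ** star u)) ** u by rewrite !amulA.
by rewrite tu amulr0 amul0r.
Qed.

Lemma near_all_in (T : eqType) (s : seq T) (P : T -> nat -> Prop) :
  (forall x, x \in s -> \forall n \near \oo, P x n) ->
  \forall n \near \oo, forall x, x \in s -> P x n.
Proof.
elim: s => [|y s IH] sP; first exact: nearW.
apply: filterS2 (sP y (mem_head _ _)) (IH _) => [n Py Ps x|x xs].
  by rewrite inE => /predU1P[->//|/Ps].
by apply: sP; rewrite inE xs orbT.
Qed.

Lemma finite_set_enum (T : choiceType) (D : set T) : finite_set D -> exists F : seq T,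
  [/\ uniq F, forall e, e \in F <-> D e & forall (M : nmodType) (g : T -> M),
    \sum_(e \in D) g e = \sum_(e <- F) g e].
Proof.
move=> /finite_seqP[r ->]; exists (undup r); split.
- exact: undup_uniq.
- by move=> e; rewrite mem_undup.
- move=> M g; have <- : [set` undup r] = [set` r].
    by apply/seteqP; split=> x /=; rewrite mem_undup.
  by rewrite -fsbig_seq ?undup_uniq.
Qed.

End CKFacts.

(** * Representations that do not lift *)

Section NonLiftable.
Variables (R : realType) (G : digraph) (vs : seq (vertex G)).
Hypothesis (vsT : forall v, v \in vs).
Variables (A : cstarAlgType R[i]) (p : vertex G -> A) (s : edge G -> A).
Hypothesis AG : is_graph_cstar p s.
Local Notation C := R[i].
Local Notation V := (vertex G).
Local Notation E := (edge G).
Local Notation MM := (fun n => cmatrix R n.+1).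
Local Notation Pr := (cprod MM).
Local Notation Q := (corona MM).
Local Notation pi := (@toCorona C MM).
Local Notation piH := (@toCorona_starhom C MM).

Lemma infinite_edges_kill n (f : A -> cmatrix R n) u v : is_starhom f ->
  infinite_set [set e : E | src e = u /\ rng e = v] -> f (p u) = 0.
Proof.
move=> fH /infiniteP/card_leP[g].
have CK := graph_cstar_family AG.
pose h k : E := set_val (g (to_setT k)).
have hu k : src (h k) = u by have [] := set_valP (g (to_setT k)).
have hinj : injective h.
  move=> i j /val_inj; move=> /(@inj _ _ _ g); rewrite !inE => /(_ I I).
  by move=> /(congr1 val).
apply: (@orthogonal_isometries _ _ _ (fun i => f (s (h i)))) => i j.
rewrite -(starhomS fH) -(starhomM fH); case: eqP => [->|ij].
  by rewrite (CK_source CK) hu.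
have hij : h i != h j by apply/eqP => /hinj.
rewrite (ranges_orthogonal (CK_pisom CK _) (CK_pisom CK _) (CK_ranges CK hij)).
exact: starhom0.
Qed.

(** At the n-th place, use the largest level k <= n whose basis fits into n + 1
    dimensions, and only the first k edges. A given relation then holds for all
    large n. *)
Lemma rooted_representation v : rooted v -> exists2 phi : A -> Q,
  is_starhom phi & phi (p v) <> 0.
Proof.
move=> [W [c [w [nu [Wc wW wnu]]]]].
pose L := level vs W c.
pose ok k n := (size (L k) <= n.+1)%N.
(* The disjunct k = 0 makes the condition true for every n at the start; it is
   void as soon as kappa n > 0. *)
have [n||kappa [kok kinf]] := @diagonal_sequence (fun k n => (k == 0)%N || ok k n).
- by [].
- by move=> k; apply: filterS (nbhs_infty_ge (size (L k))) => n nk; rewrite /ok leqW ?orbT.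
have okn : \forall n \near \oo, ok (kappa n) n.
  apply: filterS (kinf 1%N) => n; have := kok n.
  by case: (kappa n).
pose Pn v n : MM n := if ok (kappa n) n then @vertex_mx G vs W c R n.+1 (kappa n) v else 0.
pose good (e : E) n := ok (kappa n) n && (pickle e < kappa n)%N.
pose Sn e n : MM n := if good e n then @edge_mx G vs W c R n.+1 (kappa n) e else 0.
have proj0 n : is_projection (0 : MM n) by split; rewrite ?star0 ?amul0r.
have Pp u n : is_projection (Pn u n).
  by rewrite /Pn; case: ifP => // h; apply: vertex_mx_projection.
have SS e n : good e n -> star (Sn e n) ** Sn e n = Pn (src e) n.
  move=> h; rewrite /Sn h; case/andP: h => ho hk; rewrite /Pn ho.
  exact: edge_mx_source.
have Pb u : exists M : C, forall n, `|Pn u n| <= M.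
  by exists 1 => n; have [->|->//] := norm_projection (Pp u n); rewrite normr0.
have Sb e : exists M : C, forall n, `|Sn e n| <= M.
  exists 1 => n; have [h|h] := boolP (good e n); last by rewrite /Sn (negPf h) normr0.
  rewrite -(@ler_pXn2r _ 2) ?nnegrE// -norm_cstar SS// expr1n.
  by have [->|->//] := norm_projection (Pp (src e) n); rewrite normr0.
pose PP u : Pr := CProd (Pb u).
pose S e : Pr := CProd (Sb e).
have goodn e : \forall n \near \oo, good e n.
  by apply: filterS2 okn (kinf (pickle e).+1) => n; rewrite /good => -> ->.
have PPp u : is_projection (PP u).
  by have h n := Pp u n; split; apply: cprodP => n; have [] := h n.
pose q u : ncorona MM := pi (PP u).
pose t e : ncorona MM := pi (S e).
have tt e : star (t e) ** t e = q (src e).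
  transitivity (pi (star (S e) ** S e)); first by rewrite (starhomM piH) (starhomS piH).
  by apply: toCorona_near; apply: filterS (goodn e) => n; exact: SS.
have qp u : is_projection (q u).
  exact: (starhom_projection piH (PPp u)).
have qt e : q (rng e) ** t e = t e.
  transitivity (pi (PP (rng e) ** S e)); first by rewrite (starhomM piH).
  apply: toCorona_near; apply: filterS (goodn e) => n h.
  rewrite cprodM_n /= /Sn h /Pn; case/andP: h => ho hk; rewrite ho.
  exact: edge_mx_range.
have tu e f : e != f -> star (t e) ** t f = 0.
  move=> ef; transitivity (pi (star (S e) ** S f)).
    by rewrite (starhomM piH) (starhomS piH).
  rewrite -(starhom0 piH); apply: toCorona_near.
  apply: filterS2 (goodn e) (goodn f) => n he hf.
  rewrite cprodM_n cprodS_n /= /Sn he hf; case/andP: hf => ho hk.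
  exact: edge_mx_orth.
have tiso e : t e ** star (t e) ** t e = t e.
  by rewrite -amulA tt; exact: isometry_source (qp _) (tt e).
have CK : CK_family q t.
  split=> //.
  - move=> u u' uu'; transitivity (pi (PP u ** PP u')); first by rewrite (starhomM piH).
    rewrite -(starhom0 piH); apply: toCorona_near.
    apply: filterS okn => n ho; rewrite cprodM_n /= /Pn ho.
    exact: vertex_mx_orth.
  - move=> e f ef; rewrite -amulA (amulA (star (t e))) tu// amul0r amulr0.
    by [].
  - move=> u u0 ufin; have [F [uF Fu ->]] := finite_set_enum ufin.
    transitivity (pi (\sum_(e <- F) S e ** star (S e))).
      apply: toCorona_near; have Fn : \forall n \near \oo, forall e, e \in F -> good e n.
        by apply: near_all_in => e _; exact: goodn.
      apply: filterS2 okn Fn => n ho h; rewrite cprod_sum_n /= /Pn ho.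
      rewrite (@vertex_mx_sum G vs W c vsT Wc R n.+1 (kappa n) ho u F)//; last first.
        by move=> e /h /andP[].
      by apply: eq_big_seq => e /h he; rewrite /Sn he.
    rewrite (starhom_sum piH); apply: eq_bigr => e _.
    by rewrite (starhomM piH) (starhomS piH).
  - by move=> e; apply: cle_range.
have [phi [phiH phip phis]] := graph_cstar_universal AG CK.
exists phi => //; rewrite phip => q0.
have P0 : \forall n \near \oo, PP v n = 0.
  apply: projection_near0 => //; apply: nearW => n.
  exact: Pp.
have [k0 [x kx]] := rooted_level vsT Wc wW wnu.
have [n] := filter_ex (filterI P0 (filterI okn (kinf k0))).
move=> [Pn0 [ho hk]]; have [xL xv] := kx _ hk.
have : Pn v n <> 0 by rewrite /Pn ho -xv; apply: vertex_mx_neq0.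
exact.
Qed.

End NonLiftable.

(** * Lifting *)

Lemma fiber_sum (E : eqType) (W : eqType) (r : E -> W) (v : W) (F es : seq E) (M : nmodType)
    (g : E -> M) : uniq F -> uniq es -> (forall e, e \in F <-> r e = v) ->
  (forall e, r e = v -> e \notin es -> g e = 0) ->
  \sum_(e <- F) g e = \sum_(e <- es | r e == v) g e.
Proof.
move=> uF ues Fv g0; rewrite -[RHS]big_filter (bigID (mem es))/=.
rewrite [X in _ + X]big_seq_cond [X in _ + X]big1 ?addr0 => [|e /andP[/Fv]]; last exact: g0.
rewrite -big_filter; apply: perm_big; apply: uniq_perm; rewrite ?filter_uniq// => e.
rewrite !mem_filter andbC; congr andb.
by apply/idP/eqP => /Fv.
Qed.

Section Lifting.
Variables (R : realType) (G : digraph) (vs : seq (vertex G)).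
Hypothesis (vsT : forall v, v \in vs).
Variables (A : cstarAlgType R[i]) (p : vertex G -> A) (s : edge G -> A).
Hypothesis AG : is_graph_cstar p s.
Local Notation C := R[i].
Local Notation V := (vertex G).
Local Notation E := (edge G).
Local Notation MM := (fun n => cmatrix R n.+1).
Local Notation Pr := (cprod MM).
Local Notation Q := (corona MM).
Local Notation pi := (@toCorona C MM).
Local Notation piH := (@toCorona_starhom C MM).
Variables (phi : A -> Q) (phiH : is_starhom phi).

Let q v : Q := phi (p v).
Let t e : Q := phi (s e).
Let CK := graph_cstar_family AG.

Let q_proj v : is_projection (q v).
Proof. exact: (starhom_projection phiH (CK_proj CK v)). Qed.

Let q_orth v w : v != w -> q v ** q w = 0.
Proof. by move=> vw; rewrite -(starhomM phiH) (CK_orth CK vw) (starhom0 phiH). Qed.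

Let t_source e : star (t e) ** t e = q (src e).
Proof. by rewrite -(starhomS phiH) -(starhomM phiH) (CK_source CK). Qed.

Let t_iso e : t e ** star (t e) ** t e = t e.
Proof. by rewrite -(starhomS phiH) -!(starhomM phiH) (CK_pisom CK). Qed.

Let t_src e : t e ** q (src e) = t e.
Proof. by rewrite -t_source amulA t_iso. Qed.

(** In the C*-algebra A this would require that positive elements have a trivial
    sum only if they vanish. In the corona that is [corona_definite]. *)
Let t_rng e : q (rng e) ** t e = t e.
Proof.
have [d pd] := CK_range CK e; apply/esym/eqP; rewrite -subr_eq0; apply/eqP.
apply: (@corona_definite _ _ (phi d - phi d ** q (rng e))); apply: compress_sum => //.
rewrite -(starhomS phiH (s e)) -(starhomS phiH d) -!(starhomM phiH) -pd.
by rewrite (starhomB phiH).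
Qed.

Let t_orth e f : e != f -> star (t e) ** t f = 0.
Proof.
move=> ef; apply: (ranges_orthogonal (t_iso e) (t_iso f)).
rewrite -!(starhomS phiH) -!(starhomM phiH) (CK_ranges CK ef).
exact: starhom0.
Qed.

Let t_sum v : regular v -> exists F : seq E, [/\ uniq F, forall e, e \in F <-> rng e = v &
  q v = \sum_(e <- F) t e ** star (t e)].
Proof.
move=> [v0 vfin]; have [F [uF Fv Fsum]] := finite_set_enum vfin.
exists F; split=> //.
rewrite /q (CK_sum CK v0 vfin) Fsum (starhom_sum phiH); apply: eq_bigr => e _.
by rewrite (starhomM phiH) (starhomS phiH).
Qed.

Let t_dead e : q (src e) = 0 -> t e = 0.
Proof. by move=> qe; rewrite -t_src qe amulr0. Qed.

Let dead v := q v = 0.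

Let dead_src e : dead (rng e) -> dead (src e).
Proof.
by rewrite /dead => qe; rewrite -t_source -(t_rng e) qe amul0r amulr0.
Qed.

Let dead_regular v : regular v -> (forall e, rng e = v -> dead (src e)) -> dead v.
Proof.
move=> /t_sum[F [_ Fv qv]] ev; rewrite /dead qv big_seq big1// => e /Fv/ev/t_dead ->.
by rewrite amul0r.
Qed.

(** T is the product of the images of the edges of the walk. *)
Let path_isometry u nu v : walk u nu v -> exists T : Q,
  [/\ star T ** T = q u, q v ** T = T, T ** q u = T &
      forall nu' e, nu = rcons nu' e -> exists T', T = t e ** T'].
Proof.
elim/last_ind: nu v => [|nu e IH] v.
  move=> /= /eqP->; exists (q v); have [qs qi] := q_proj v; split; rewrite ?qs//.
  by case.
rewrite -cats1 => /walk_split[/IH[T [TT qT Tq _]] /= /eqP ev].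
exists (t e ** T); split.
- by rewrite starM -!amulA (amulA (star (t e))) t_source qT.
- by rewrite amulA -ev t_rng.
- by rewrite -amulA Tq.
- by move=> nu' f; rewrite cats1 => /rcons_inj[_ <-]; exists T.
Qed.

(** By finiteness the range projection of the cycle is all of q (rng f), and the
    range of t f is orthogonal to that of the last edge of the cycle. *)
Let dead_entry c f : walk (rng f) c (rng f) -> c <> [::] -> f \notin c -> dead (src f).
Proof.
move=> wc c0 fc; have [T [TT qT Tq Tlast]] := path_isometry wc.
have Tfin := corona_finite (q_proj _) TT qT Tq.
case/lastP: c wc c0 fc Tlast => // c g _ _ fc /(_ _ _ erefl)[T' TE].
suff tf : t f = 0 by rewrite /dead -t_source tf amulr0.
rewrite -t_rng -Tfin {2}TE starM -!amulA t_orth ?amulr0//.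
by apply: contraNneq fc => <-; rewrite mem_rcons mem_head.
Qed.

(** Edges are lifted one at a time. The next one is first cut down to the
    complement of the ranges already used and to the correct source and range
    projections; the exact relations then hold eventually by polar
    decomposition. *)
Lemma lift_edges (P : V -> Pr) (es : seq E) : uniq es ->
  (forall v, pi (P v) = q v) -> (forall v, is_projection (P v)) ->
  (forall v w, v != w -> P v ** P w = 0) ->
  exists S : E -> Pr, [/\ forall e, e \in es -> pi (S e) = t e,
    forall e, e \in es -> \forall n \near \oo, star (S e n) ** S e n = P (src e) n,
    forall e, e \in es -> P (rng e) ** S e = S e &
    forall e f, e \in es -> f \in es -> e != f ->
      \forall n \near \oo, star (S e n) ** S f n = 0].
Proof.
move=> ues Pq Pp P0; elim: es ues => [|e es IH /= /andP[ees ues]]; first by exists (fun=> 0).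
have [S [St SS PS S0]] := IH ues.
have [x tx] := toCorona_surj (t e).
pose z : Pr := P (rng e) ** x ** P (src e).
have zt : pi z = t e by rewrite !(starhomM piH) !Pq -tx t_rng t_src.
have zP : z ** P (src e) = z by rewrite -amulA (Pp _).2.
have Pz : P (rng e) ** z = z by rewrite /z !amulA (Pp _).2.
clearbody z.
pose y : Pr := z - \sum_(f <- es) S f ** star (S f) ** z.
have yt : pi y = t e.
  rewrite (starhomB piH) zt (starhom_sum piH) big_seq big1 ?subr0// => f fes.
  rewrite !(starhomM piH) (starhomS piH) zt St// -amulA t_orth ?amulr0//.
  by apply: contraNneq ees => <-.
have yP : y ** P (src e) = y.
  rewrite amulDl amulNl zP amul_suml; congr (_ - _); apply: eq_bigr => f _.
  by rewrite -amulA zP.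
have Py : P (rng e) ** y = y.
  rewrite amulDr amulNr Pz amul_sumr; congr (_ - _); apply: eq_big_seq => f fes.
  have [re|re] := eqVneq (rng e) (rng f); first by rewrite !amulA re PS.
  have -> : S f ** star (S f) ** z = 0; last by rewrite amulr0.
  rewrite -{2}(PS f fes) starM (Pp _).1 -Pz -!amulA (amulA (P (rng f))) P0 ?(eq_sym (rng f))//.
  by rewrite amul0r !amulr0.
have [|Se [Sey SeS Seg]] := lift_isometry (Pp (src e)) yP.
  by rewrite (starhomM piH) (starhomS piH) yt t_source Pq.
have S0e : \forall n \near \oo, forall f, f \in es -> star (S f n) ** Se n = 0.
  have SSn : \forall n \near \oo, forall f, f \in es -> star (S f n) ** S f n = P (src f) n.
    by apply: near_all_in => f fes; exact: SS.
  have S0n : \forall n \near \oo, forall f, f \in es -> forall g, g \in es -> f != g ->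
      star (S f n) ** S g n = 0.
    apply: near_all_in => f fes; apply: near_all_in => g ges.
    have [->|fg] := eqVneq f g; first exact: nearW.
    by apply: filterS (S0 f g fes ges fg) => n.
  apply: filterS2 SSn S0n => n SSn S0n f fes; have [g ->] := Seg n.
  suff Sy : star (S f n) ** y n = 0 by rewrite amulA Sy amul0r.
  rewrite /y cprodB_n cprod_sum_n amulDr amulNr amul_sumr (bigD1_seq f)//=.
  rewrite big_seq_cond big1 => [|h /andP[hes hf]]; last first.
    by rewrite !amulA S0n ?(eq_sym f)// !amul0r.
  have Pn := cprod_projection_n n (Pp (src f)).
  have SP := isometry_source Pn (SSn f fes).
  rewrite addr0 !amulA SSn// -[in X in _ - X]Pn.1 -starM SP.
  by rewrite subrr.
exists (fun f => if f == e then Se else S f); split.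
- by move=> f; rewrite inE; have [->|_ /= /St] := eqVneq f e; rewrite ?Sey.
- by move=> f; rewrite inE; have [->|_ /= /SS] := eqVneq f e.
- move=> f; rewrite inE; have [-> _|_ /= /PS//] := eqVneq f e.
  apply: cprodP => n; rewrite cprodM_n; have [g ->] := Seg n.
  by rewrite amulA -cprodM_n Py.
- move=> f g; rewrite !inE; have [->|fe] := eqVneq f e; have [->|ge] := eqVneq g e => //=.
  + move=> _ ges _; apply: filterS S0e => n /(_ g ges) h.
    by rewrite -[LHS]starK starM starK h star0.
  + by move=> fes _ _; apply: filterS S0e => n; exact.
  + exact: S0.
Qed.

(** The defect of each summation relation is eventually a projection and tends
    to 0, hence is eventually 0. The finitely many exceptional terms, and the
    vertices and edges sent to 0, are replaced by 0. *)
Lemma lift_family (es : seq E) : uniq es -> (forall e, e \in es <-> q (src e) <> 0) ->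
  exists (P : V -> Pr) (S : E -> Pr), [/\ forall n, CK_family (P ^~ n) (S ^~ n),
    forall v, pi (P v) = q v & forall e, pi (S e) = t e].
Proof.
move=> ues esq.
have [P0 [P0q P0p P0o]] := lift_projections (undup_uniq vs) q_proj q_orth.
have vsU v : v \in undup vs by rewrite mem_undup.
have [S0 [S0t S0S S0P S0o]] := lift_edges ues (fun v => P0q v (vsU v))
  (fun v => P0p v (vsU v)) (fun v w => P0o v w (vsU v) (vsU w)).
have Pp v n : is_projection (P0 v n) by apply: cprod_projection_n; exact: P0p.
have SSn : \forall n \near \oo, forall e, e \in es -> star (S0 e n) ** S0 e n = P0 (src e) n.
  by apply: near_all_in => e; exact: S0S.
have Son : \forall n \near \oo, forall e, e \in es -> forall f, f \in es -> e != f ->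
    star (S0 e n) ** S0 f n = 0.
  apply: near_all_in => e ein; apply: near_all_in => f fin.
  have [->|ef] := eqVneq e f; first exact: nearW.
  by apply: filterS (S0o e f ein fin ef) => n.
have PSn e n : e \in es -> P0 (rng e) n ** S0 e n = S0 e n.
  by move=> ein; rewrite -cprodM_n S0P.
have sumn : \forall n \near \oo, forall v, v \in vs -> regular v ->
    P0 v n = \sum_(e <- es | rng e == v) S0 e n ** star (S0 e n).
  apply: near_all_in => v _; have [vreg|vreg] := pselect (regular v); last exact: nearW.
  pose D : Pr := P0 v - \sum_(e <- es | rng e == v) S0 e ** star (S0 e).
  suff D0 : \forall n \near \oo, D n = 0.
    apply: filterS D0 => n Dn _; apply/eqP; rewrite -subr_eq0; move/eqP: Dn.
    by rewrite /D cprodB_n cprod_sum_n.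
  apply: projection_near0.
    apply: filterS2 SSn Son => n SSn Son; rewrite /D cprodB_n cprod_sum_n.
    set F := \sum_(e <- es | _) _.
    have Fs : star F = F.
      by rewrite star_sum; apply: eq_bigr => e _; rewrite !starM starK.
    have SF f : f \in es -> rng f = v -> star (S0 f n) ** F = star (S0 f n).
      move=> fes fv; rewrite amul_sumr -big_filter.
      rewrite (bigD1_seq f) ?mem_filter ?fv ?eqxx ?filter_uniq//=.
      rewrite big_seq_cond big1 ?addr0 => [|g /andP[]]; last first.
        rewrite mem_filter => /andP[_ ges] gf.
        by rewrite amulA Son ?amul0r// eq_sym.
      have SP := isometry_source (Pp (src f) n) (SSn f fes).
      by rewrite amulA SSn// -{1}(Pp (src f) n).1 -starM SP.
    have FF : F ** F = F.
      rewrite {1}/F amul_suml big_seq_cond [RHS]big_seq_cond.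
      apply: eq_bigr => f /andP[fes /eqP fv]; by rewrite -amulA SF.
    have PF : P0 v n ** F = F.
      rewrite amul_sumr big_seq_cond [RHS]big_seq_cond; apply: eq_bigr => f /andP[fes /eqP fv].
      by rewrite cprodM_n amulA -fv PSn.
    have FP : F ** P0 v n = F by rewrite -[LHS]starK starM (Pp v n).1 Fs PF.
    split; first by rewrite starD starN Fs (Pp v n).1.
    by rewrite amulDl !amulDr !(amulNl, amulNr) (Pp v n).2 PF FP FF opprK addNr addr0.
  rewrite (starhomB piH) P0q// (starhom_sum piH).
  have [F [uF Fv ->]] := t_sum vreg.
  rewrite (fiber_sum uF ues Fv) => [|e _ ees]; last first.
    rewrite t_dead ?amul0r//; apply: contrapT => qe; case/negP: ees.
    exact/esq.
  apply/eqP; rewrite subr_eq0; apply/eqP.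
  rewrite big_seq_cond [RHS]big_seq_cond; apply: eq_bigr => e /andP[ees _].
  by rewrite (starhomM piH) (starhomS piH) S0t.
have [N _ hN] := filterI SSn (filterI Son sumn).
have SSN n : (N <= n)%N -> forall e, e \in es -> star (S0 e n) ** S0 e n = P0 (src e) n.
  by move=> /hN[].
have SoN n : (N <= n)%N -> forall e, e \in es -> forall f, f \in es -> e != f ->
    star (S0 e n) ** S0 f n = 0.
  by move=> /hN[_ []].
have sumN n : (N <= n)%N -> forall v, regular v ->
    P0 v n = \sum_(e <- es | rng e == v) S0 e n ** star (S0 e n).
  by move=> /hN[_ [_ h]] v; apply: h.
pose alive v := `[< q v <> 0 >].
pose Pn v n : MM n := if (N <= n)%N && alive v then P0 v n else 0.
pose Sn e n : MM n := if (N <= n)%N && (e \in es) then S0 e n else 0.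
have Pb v : exists M : C, forall n, `|Pn v n| <= M.
  have [M PM] := cseq_bounded (P0 v); exists M => n; rewrite /Pn.
  case: ifP => _; first exact: PM.
  by rewrite normr0 (le_trans _ (PM 0%N)).
have Sb e : exists M : C, forall n, `|Sn e n| <= M.
  have [M SM] := cseq_bounded (S0 e); exists M => n; rewrite /Sn.
  case: ifP => _; first exact: SM.
  by rewrite normr0 (le_trans _ (SM 0%N)).
have nearN : \forall n \near \oo, (N <= n)%N by exact: nbhs_infty_ge.
exists (fun v => CProd (Pb v)), (fun e => CProd (Sb e)); split => [n|v|e] /=; last 2 first.
- rewrite -(P0q v (vsU v)); have [qv|qv] := boolP (alive v).
    by apply: toCorona_near; apply: filterS nearN => n Nn; rewrite /= /Pn Nn qv.
  move: qv => /asboolPn/contrapT qv; rewrite P0q// qv -(starhom0 piH).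
  apply: toCorona_near; apply: nearW => n; rewrite /= /Pn /alive.
  by case: asboolP => // h; rewrite andbF.
- have [ees|ees] := boolP (e \in es).
    rewrite -(S0t e ees); apply: toCorona_near; apply: filterS nearN => n Nn.
    by rewrite /= /Sn Nn ees.
  rewrite t_dead; last by apply: contrapT => /esq; exact/negP.
  rewrite -(starhom0 piH); apply: toCorona_near; apply: nearW => n.
  by rewrite /= /Sn (negPf ees) andbF.
have proj0 : is_projection (0 : MM n) by split; rewrite ?star0 ?amul0r.
have Pnp v : is_projection (Pn v n) by rewrite /Pn; case: ifP => _; [exact: Pp | exact: proj0].
have aliveE e : e \in es -> alive (src e) /\ alive (rng e).
  move=> /esq qe; split; apply/asboolP => // qr; exact: qe (dead_src qr).
have Snn e : ~~ ((N <= n)%N && (e \in es)) -> Sn e n = 0 by rewrite /Sn => /negPf->.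
have SSn' e : star (Sn e n) ** Sn e n = Pn (src e) n.
  have [Nn|Nn] := boolP (N <= n)%N; last by rewrite /Sn /Pn (negPf Nn) amulr0.
  have [ees|ees] := boolP (e \in es).
    by rewrite /Sn /Pn Nn ees (aliveE e ees).1 SSN.
  rewrite /Sn (negPf ees) andbF amulr0 /Pn; case: (asboolP (q (src e) <> 0)) => //=.
    by move=> /esq; rewrite (negPf ees).
  by rewrite /alive => h; case: asboolP => //; rewrite andbF.
have Siso e : Sn e n ** star (Sn e n) ** Sn e n = Sn e n.
  by rewrite -amulA SSn'; exact: isometry_source (Pnp _) (SSn' e).
have PSn' e : Pn (rng e) n ** Sn e n = Sn e n.
  rewrite /Sn; case: ifP => [/andP[Nn ees]|_]; last by rewrite amulr0.
  by rewrite /Pn Nn (aliveE e ees).2 PSn.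
split=> //.
- move=> v w vw; rewrite /Pn; case: ifP => _; rewrite ?amul0r//.
  case: ifP => _; rewrite ?amulr0//.
  by rewrite -cprodM_n P0o.
- move=> e f ef; rewrite -amulA (amulA (star (Sn e n))).
  suff -> : star (Sn e n) ** Sn f n = 0 by rewrite amul0r amulr0.
  rewrite {1}/Sn; case: ifP => [/andP[Nn ees]|_]; last by rewrite star0 amul0r.
  rewrite /Sn; case: ifP => [/andP[_ fes]|_]; last by rewrite amulr0.
  exact: SoN.
- move=> v v0 vfin; have [F [uF Fv ->]] := finite_set_enum vfin.
  rewrite (fiber_sum uF ues Fv) => [|e _ ees]; last first.
    by rewrite Snn ?(negPf ees) ?andbF// amul0r.
  have [Nn|Nn] := boolP (N <= n)%N; last first.
    rewrite /Pn (negPf Nn) big1// => e _; rewrite Snn ?(negPf Nn)//.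
    exact: amul0r.
  rewrite /Pn Nn /=; case: ifP => [av|av].
    rewrite (sumN _ Nn v (conj v0 vfin)).
    rewrite big_seq_cond [RHS]big_seq_cond; apply: eq_bigr => e /andP[ees _].
    by rewrite /Sn Nn ees.
  rewrite big_seq_cond big1// => e /andP[ees /eqP ev].
  by have := (aliveE e ees).2; rewrite ev av.
- by move=> e; apply: cle_range.
Qed.

(** The set where the two homomorphisms agree is a star-subalgebra, closed
    because both are bounded. *)
Lemma agree_on_generators (psi : A -> Pr) : is_starhom psi ->
  (forall a n, `|psi a n| <= 2 * `|a|) ->
  (forall v, pi (psi (p v)) = phi (p v)) -> (forall e, pi (psi (s e)) = phi (s e)) ->
  forall a, pi (psi a) = phi a.
Proof.
move=> psiH psib psip psis a.
pose D : set A := [set b | pi (psi b) = phi b].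
suff : D = setT by move=> DT; rewrite -[LHS]/(pi (psi a)); have : D a by rewrite DT.
apply: (graph_cstar_generated AG) => //.
  split; rewrite /D /=.
  - by rewrite (starhom0 psiH) (starhom0 piH) (starhom0 phiH).
  - move=> b b' bD bD'.
    by rewrite (starhomD psiH) (starhomD piH) bD bD' -(starhomD phiH).
  - by move=> k b bD; rewrite (starhomZ psiH) (starhomZ piH) bD -(starhomZ phiH).
  - move=> b b' bD bD'.
    by rewrite (starhomM psiH) (starhomM piH) bD bD' -(starhomM phiH).
  - by move=> b bD; rewrite (starhomS psiH) (starhomS piH) bD -(starhomS phiH).
move=> b Db; rewrite /D /=; have [x bx] := toCorona_surj (phi b); rewrite bx.
(* 7 > 2 + 4, the sum of the constants in the bounds for psi and for phi. *)
apply/toCorona_norm => e e0; pose d := e / 7.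
have d0 : 0 < d by rewrite divr_gt0.
have [b' [Db' bb']] := Db _ (nbhsx_ballx b d d0).
move: bb'; rewrite -ball_normE /= => /ltW bb'.
have xb : phi (b - b') = pi (x - psi b').
  by rewrite (starhomB phiH) (starhomB piH) -bx Db'.
apply: filterS (starhom_corona_bound phiH xb d0 bb') => n xn.
have -> : psi b n - x n = psi (b - b') n - (x - psi b') n.
  by rewrite (starhomB psiH) !cprodB_n opprB addrA subrK.
rewrite (le_lt_trans (ler_normB _ _))//.
have -> : e = 2 * d + 4 * d + d.
  by rewrite -mulrDl -natrD -[X in _ + X]mul1r -mulrDl natr1 /d mulrC divfK.
rewrite ltr_pwDr// lerD// (le_trans (psib _ _))// ler_pM2l//.
Qed.

Lemma lift_starhom : finite_set (@Gtilde_edge G) -> exists2 psi : A -> Pr,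
  is_starhom psi & forall a, pi (psi a) = phi a.
Proof.
move=> /finite_seqP[gs gsE].
pose es := undup [seq e <- gs | `[< q (src e) <> 0 >] ].
have [|P [S [PS Pq St]]] := @lift_family es (undup_uniq _).
  move=> e; rewrite mem_undup mem_filter; split=> [/andP[/asboolP//]|qe].
  apply/andP; split; first exact/asboolP.
  suff : Gtilde_edge e by rewrite gsE.
  apply: contrapT => /(@not_Gtilde_dead G vs vsT dead dead_entry dead_src dead_regular).
  exact: qe.
have ex n := graph_cstar_universal AG (PS n).
pose f n : A -> MM n := projT1 (cid (ex n)).
have fP n : [/\ is_starhom (f n), forall v, f n (p v) = P v n & forall e, f n (s e) = S e n].
  exact: projT2 (cid (ex n)).
have fb a n : `|f n a| <= 2 * `|a| by have [fH _ _] := fP n; exact: starhom_matrix_bound.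
have fB a : exists M : C, forall n, `|f n a| <= M by exists (2 * `|a|).
pose psi a : Pr := CProd (fB a).
have psiH : is_starhom psi.
  split=> [k a b|a b|a]; apply: cprodP => n; have [[fl fm fs] _ _] := fP n.
  - exact: fl.
  - exact: fm.
  - exact: fs.
exists psi => //; apply: agree_on_generators => // [v|e].
- by rewrite -/(q v) -Pq; congr pi; apply: cprodP => n; have [_ + _] := fP n; apply.
- by rewrite -/(t e) -St; congr pi; apply: cprodP => n; have [_ _] := fP n; apply.
Qed.

End Lifting.

Lemma infinite_parallel_edges (G : digraph) (vs : seq (vertex G)) (D : set (edge G)) :
  (forall v, v \in vs) -> infinite_set D ->
  exists u v, infinite_set [set e | D e /\ (src e = u /\ rng e = v)].
Proof.
move=> vsT; apply: contraPP => /forallNP h; apply.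
apply: (@sub_finite_set _ _ (\bigcup_(uv in [set` [seq (u, v) | u <- vs, v <- vs]])
    [set e : edge G | D e /\ (src e = uv.1 /\ rng e = uv.2)])).
  move=> e De; exists (src e, rng e) => //=.
  by apply/allpairsP; exists (src e, rng e).
apply: bigcup_finite => [|[u v] _]; first exact: finite_seq.
by apply: contrapT => inf; apply: (h u); exists v.
Qed.

Theorem theorem5p15 (R : realType) (G : digraph)
    (finV : finite_set [set: vertex G])
    (A : cstarAlgType R[i]) (p : vertex G -> A) (s : edge G -> A)
    (AG : is_graph_cstar p s) :
  matricially_semiprojective A <-> Gtilde_finite G.
Proof.
have [vs vsE] := (finite_seqP _).1 finV.
have vsT v : v \in vs by have : [set: vertex G] v by []; rewrite vsE.
split=> [Amsp|[_ Efin] phi phiH]; last exact: lift_starhom vsT _ _ _ AG phi phiH Efin.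
split; first by apply: sub_finite_set finV.
apply: contrapT => /(infinite_parallel_edges vsT)[u [v uv]].
have [e [eG [eu ev]]] : [set e | Gtilde_edge e /\ (src e = u /\ rng e = v)] !=set0.
  by apply/set0P; apply: contra_not_neq uv => ->.
have [phi phiH phiu] := rooted_representation vsT AG (Gtilde_rooted vsT eG).
rewrite eu in phiu; have [psi psiH psi_phi] := Amsp phi phiH.
apply: phiu; rewrite -psi_phi (_ : psi (p u) = 0).
  by rewrite (starhom0 (@toCorona_starhom _ _)).
apply: cprodP => n.
have psinH : is_starhom (fun a => psi a n : cmatrix R n.+1).
  by have [l m st] := psiH; split=> [k a b|a b|a]; rewrite ?l ?m ?st.
apply: (infinite_edges_kill AG psinH (v := v)).
by apply: sub_infinite_set uv => f [].
Qed.
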